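(* The equator map $u^*:B^n\to\mathbb{S}^n$, $u^*(x)=(x/|x|,0)$, is (i) a minimizing extrinsic triharmonic map if $n\geq 12$; (ii) an unstable extrinsic triharmonic map if $7\leq n<12$.
   Context: $B^n\subset\mathbb{R}^n$ is the Euclidean unit ball and $\mathbb{S}^n\subset\mathbb{R}^{n+1}=\mathbb{R}^n\times\mathbb{R}$ the unit sphere. $W^{3,2}(B^n,\mathbb{S}^n)=\{u\in W^{3,2}(B^n,\mathbb{R}^{n+1}) : u(x)\in\mathbb{S}^n \text{ for a.e. } x\}$. The extrinsic $3$-energy is defined on $W^{3,2}(B^n,\mathbb{S}^n)$ by $E_3^{\rm ext}(u)=\int_{B^n}|\nabla\Delta u|^2\,dx$, where $\Delta$ and $\nabla$ act componentwise and norms are Euclidean. A map $u\in W^{3,2}(B^n,\mathbb{S}^n)$ is extrinsic triharmonic (i.e. extrinsic weakly $3$-harmonic) if $\frac{d}{dt}E_3^{\rm ext}(u_t)\big|_{t=0}=0$ for all variations $u_t=\Pi(u+t\phi)$ with $\phi\in C_0^\infty(B^n,\mathbb{R}^{n+1})$, where $\Pi(y)=y/|y|$ is the nearest point projection onto $\mathbb{S}^n$. It is minimizing if $E_3^{\rm ext}(u)\leq E_3^{\rm ext}(v)$ for all $v\in W^{3,2}(B^n,\mathbb{S}^n)$ with $u-v\in W_0^{3,2}(B^n,\mathbb{R}^{n+1})$. An extrinsic triharmonic map $u$ is stable if $\frac{d^2}{dt^2}E_3^{\rm ext}(u_t)\big|_{t=0}\geq 0$ for all variations $u_t$ of $u$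 such that $u_t-u\in W_0^{3,2}(B^n,\mathbb{R}^{n+1})$, and unstable if it is not stable. *)

(* Defs.v *)
From HB Require Import structures.
From mathcomp Require Import all_boot all_order all_algebra.
From mathcomp Require Import all_classical all_reals all_analysis.

Set Implicit Arguments.
Unset Strict Implicit.
Unset Printing Implicit Defensive.

Import Order.TTheory GRing.Theory Num.Theory.
Import numFieldNormedType.Exports.

Local Open Scope classical_set_scope.
Local Open Scope ring_scope.

(** R^n is ['rV[R]_n].  Its topology is the library's (induced by the sup norm),
    its sigma-algebra is the product one, generated by the coordinates (this is
    the Borel sigma-algebra). *)

Definition rV_display : measure_display. Proof. exact. Qed.

Section measurable_rV.
Context {R : realType}.
Variable n : nat.

Definition rV_coord (i : 'I_n) (x : 'rV[R]_n) : measurableTypeR R := x ord0 i.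

Let rV_set0 : g_sigma_preimage rV_coord set0.
Proof. exact: sigma_algebra0. Qed.

Let rV_setC A : g_sigma_preimage rV_coord A -> g_sigma_preimage rV_coord (~` A).
Proof. exact: sigma_algebraC. Qed.

Let rV_bigcup (F : (set 'rV[R]_n)^nat) :
  (forall i, g_sigma_preimage rV_coord (F i)) ->
  g_sigma_preimage rV_coord (\bigcup_i (F i)).
Proof. exact: sigma_algebra_bigcup. Qed.

HB.instance Definition _ := @isMeasurable.Build rV_display
  'rV[R]_n (g_sigma_preimage rV_coord) rV_set0 rV_setC rV_bigcup.

End measurable_rV.

Section lebesgue_rV.
Context {R : realType}.

Lemma measurable_rV_coord n (i : 'I_n) :
  measurable_fun [set: 'rV[R]_n] (rV_coord i).
Proof.
move=> _ Y mY; rewrite setTI; apply: sub_sigma_algebra => /=.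
rewrite -bigcup_seq/=; exists i => /=; first by rewrite mem_index_enum.
by exists Y => //; rewrite setTI.
Qed.

Lemma measurable_fun_rV d (T : measurableType d) n (f : T -> 'rV[R]_n) :
  (forall i, measurable_fun [set: T] (rV_coord i \o f)) ->
  measurable_fun [set: T] f.
Proof.
move=> mf.
suff H : preimage_set_system setT f (g_sigma_preimage (@rV_coord R n))
    `<=` measurable.
  by move=> _ A mA; apply: H; exists A.
rewrite -g_sigma_preimage_comp.
apply: smallest_sub; first exact: sigma_algebra_measurable.
case: n f mf => [|n] f mf; first by rewrite big_ord0.
rewrite -bigcup_mkord_ord; apply: bigcup_sub => i Ii.
by move=> A [B mB <-]; exact: mf.
Qed.

Definition rV_cons n (p : measurableTypeR R * 'rV[R]_n) : 'rV[R]_n.+1 :=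
  row_mx (const_mx p.1 : 'rV[R]_1) p.2.

Lemma rV_cons0 n p : rV_cons p ord0 (ord0 : 'I_n.+1) = p.1.
Proof.
have -> : (ord0 : 'I_n.+1) = lshift n (ord0 : 'I_1) by exact/val_inj.
by apply: (etrans (row_mxEl _ _ _ _)); rewrite mxE.
Qed.

Lemma rV_consS n p (j : 'I_n) : rV_cons p ord0 (lift ord0 j) = p.2 ord0 j.
Proof.
have -> : lift ord0 j = rshift 1 j by exact/val_inj.
exact: row_mxEr.
Qed.

Lemma measurable_rV_cons n : measurable_fun setT (@rV_cons n).
Proof.
apply: measurable_fun_rV => i; case: (unliftP ord0 i) => [j ->|->].
  rewrite (_ : _ \o _ = rV_coord j \o snd).
    exact: measurableT_comp (measurable_rV_coord j) measurable_snd.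
  by apply/funext => p /=; rewrite /rV_coord rV_consS.
rewrite (_ : _ \o _ = fst); first exact: measurable_fst.
by apply/funext => p /=; rewrite /rV_coord rV_cons0.
Qed.

Definition rV_cons_measure n (m : {sigma_finite_measure set 'rV[R]_n -> \bar R})
    : set 'rV[R]_n.+1 -> \bar R :=
  pushforward (lebesgue_measure \x m)%E (@rV_cons n).

Section rV_cons_measure.
Variables (n : nat) (m : {sigma_finite_measure set 'rV[R]_n -> \bar R}).
Local Notation p := ((@lebesgue_measure R) \x m)%E.

Let rV_cons_measure0 : rV_cons_measure m set0 = 0%E.
Proof. by rewrite /rV_cons_measure /pushforward preimage_set0 measure0. Qed.

Let rV_cons_measure_ge0 A : (0 <= rV_cons_measure m A)%E.
Proof. exact: (measure_ge0 p). Qed.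

Let rV_cons_measure_additive : semi_sigma_additive (rV_cons_measure m).
Proof.
have mf := @measurable_rV_cons n.
exact: (@measure_semi_sigma_additive _ _ _
  (measure_function_pushforward__canonical__measure_function_Measure p mf)).
Qed.

HB.instance Definition _ := isMeasure.Build _ _ _ (rV_cons_measure m)
  rV_cons_measure0 rV_cons_measure_ge0 rV_cons_measure_additive.

Let rV_cons_measure_sigma_finite : sigma_finite setT (rV_cons_measure m).
Proof.
have /sigma_finiteP[F [FT ndF Foo]] := sigma_finiteT (@lebesgue_measure R).
have /sigma_finiteP[G [GT ndG Goo]] := sigma_finiteT m.
pose g (x : 'rV[R]_n.+1) : measurableTypeR R * 'rV[R]_n :=
  (x ord0 ord0, \row_j x ord0 (lift ord0 j)).
have mg : measurable_fun setT g.
  apply: measurable_fun_pair; first exact: (measurable_rV_coord ord0).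
  apply: measurable_fun_rV => i.
  rewrite (_ : _ \o _ = rV_coord (lift ord0 i)).
    exact: measurable_rV_coord.
  by apply/funext => x /=; rewrite /rV_coord mxE.
have gK q : g (rV_cons q) = q.
  case: q => a x; congr pair; first by rewrite rV_cons0.
  by apply/rowP => j; rewrite mxE rV_consS.
exists (fun k => g @^-1` (F k `*` G k)).
  apply/seteqP; split=> // x _.
  have [k _ Fk] : (\bigcup_k F k) (g x).1 by rewrite -FT.
  have [l _ Gl] : (\bigcup_k G k) (g x).2 by rewrite -GT.
  exists (maxn k l) => //; split.
    by move: Fk; exact/subsetPset/ndF/leq_maxl.
  by move: Gl; exact/subsetPset/ndG/leq_maxr.
move=> k; have [mF Fk] := Foo k; have [mG Gk] := Goo k; split.
  by rewrite -[X in measurable X]setTI; apply: mg => //; exact: measurableX.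
rewrite /rV_cons_measure /pushforward -comp_preimage.
rewrite (_ : g \o _ = id); last exact/funext.
by rewrite preimage_id product_measure1E// lte_mul_pinfty// ge0_fin_numE.
Qed.

HB.instance Definition _ := Measure_isSigmaFinite.Build _ _ _
  (rV_cons_measure m) rV_cons_measure_sigma_finite.

End rV_cons_measure.

Fixpoint lebesgue_rV n : {sigma_finite_measure set 'rV[R]_n -> \bar R} :=
  match n with
  | 0 => \d_(0 : 'rV[R]_0)
  | n'.+1 => rV_cons_measure (lebesgue_rV n')
  end.

Lemma lebesgue_rV_box n (a b : 'I_n -> R) : (forall i, a i <= b i) ->
  lebesgue_rV n [set x : 'rV[R]_n | forall i, a i < x ord0 i <= b i] =
  (\prod_i (b i - a i))%:E.
Proof.
elim: n a b => [|n IH] a b ab.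
  by rewrite big_ord0 /= diracE mem_set// => -[].
pose box := [set x : 'rV[R]_n |
  forall i, a (lift ord0 i) < x ord0 i <= b (lift ord0 i)].
have mbox : measurable box.
  have -> : box = \bigcap_(i in [set: 'I_n])
      (rV_coord i @^-1` `]a (lift ord0 i), b (lift ord0 i)]).
    apply/seteqP; split=> x /= H i.
      by move=> _; have := H i; rewrite /rV_coord /= in_itv.
    by have := H i I; rewrite /rV_coord /= in_itv.
  apply: fin_bigcap_measurable => // i _; rewrite -[X in measurable X]setTI.
  exact: measurable_rV_coord.
rewrite /= /rV_cons_measure /pushforward.
rewrite (_ : _ @^-1` _ = `]a ord0, b ord0]%classic `*` box); last first.
  apply/seteqP; split=> -[y x] /=.
    move=> H; split; first by have := H ord0; rewrite rV_cons0 /= in_itv.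
    by move=> i; have := H (lift ord0 i); rewrite rV_consS.
  rewrite in_itv /= => -[H1 H2] i.
  case: (unliftP ord0 i) => [j ->|->]; last by rewrite rV_cons0.
  by rewrite rV_consS; exact: H2.
rewrite product_measure1E// IH// big_ord_recl EFinM.
congr (_ * _)%E.
transitivity (@lebesgue_measure R `]a ord0, b ord0]%classic) => //.
rewrite lebesgue_measure_itv/= lte_fin.
case: ifPn => //; rewrite -leNgt => ba.
by rewrite (_ : b ord0 = a ord0) ?subrr//; apply/eqP; rewrite eq_le ba ab.
Qed.

End lebesgue_rV.

Section euclidean.
Context {R : realType}.

(** The norm [`|x|] carried by ['rV[R]_n] is the sup norm, hence this one. *)
Definition enorm n (x : 'rV[R]_n) : R := Num.sqrt (\sum_(i < n) x ord0 i ^+ 2).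

Definition unit_ball n : set 'rV[R]_n := [set x | enorm x < 1].

Definition unit_sphere n : set 'rV[R]_n := [set y | enorm y = 1].

Definition component n m (u : 'rV[R]_n -> 'rV[R]_m) (j : 'I_m) : 'rV[R]_n -> R :=
  fun x => u x ord0 j.

End euclidean.

Section sobolev.
Context {R : realType}.
Variable n : nat.
Implicit Types (f g : 'rV[R]_n -> R) (s : seq 'I_n).

Local Notation mu := (@lebesgue_rV R n).
Local Notation B := (@unit_ball R n).

Definition partial (i : 'I_n) f : 'rV[R]_n -> R := 'D_(delta_mx ord0 i) f.

(** [iter_partial [:: i; j; k] f] is [d_i d_j d_k f]; sequences of length [m]
    stand for the multi-indices of order [m]. *)
Definition iter_partial s f : 'rV[R]_n -> R := foldr partial f s.

Definition smooth f : Prop := forall s,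
  continuous (iter_partial s f) /\
  forall x i, derivable (iter_partial s f) x (delta_mx ord0 i).

Definition test_function f : Prop :=
  smooth f /\
  exists K : set 'rV[R]_n,
    [/\ compact K, K `<=` B & forall x, ~ K x -> f x = 0].

Definition locally_integrable_ball f : Prop :=
  measurable_fun B f /\
  forall K : set 'rV[R]_n, compact K -> K `<=` B ->
    (\int[mu]_(x in K) `|f x|%:E < +oo)%E.

Definition L2_ball f : Prop :=
  measurable_fun B f /\ (\int[mu]_(x in B) (f x ^+ 2)%:E < +oo)%E.

Definition weak_derivative s f g : Prop :=
  [/\ locally_integrable_ball f, locally_integrable_ball g &
    forall phi, test_function phi ->
      \int[mu]_(x in B) (f x * iter_partial s phi x) =
      (-1) ^+ size s * \int[mu]_(x in B) (g x * phi x)].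

(** A representative of the weak derivative (unique up to a null set), and [0]
    when there is none. *)
Definition weak_partial s f : 'rV[R]_n -> R :=
  xget (cst 0) [set g | weak_derivative s f g].

Definition weak_laplacian f : 'rV[R]_n -> R :=
  fun x => \sum_(k < n) weak_partial [:: k; k] f x.

(** [W^{k,2}(B^n)] *)
Definition sobolev (k : nat) f : Prop :=
  forall s, (size s <= k)%N -> exists2 g, weak_derivative s f g & L2_ball g.

Section maps.
Variable m : nat.
Implicit Types u v phi : 'rV[R]_n -> 'rV[R]_m.

Definition test_map phi : Prop := forall j, test_function (component phi j).

(** [W^{k,2}(B^n, R^m)] *)
Definition sobolev_map (k : nat) u : Prop :=
  forall j, sobolev k (component u j).

(** The square root of the sum over [l <= k] of the integrals of [|D^l u|^2],
    [|D^l u|] being the Euclidean norm of the tensor of derivatives of order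
    [l].  It is the [W^{k,2}] norm for [u] in [W^{k,2}]; outside, the integrals
    may be infinite and are then read as [0]. *)
Definition sobolev_norm (k : nat) u : R :=
  Num.sqrt (\sum_(j < m) \sum_(l < k.+1) \sum_(s : l.-tuple 'I_n)
    \int[mu]_(x in B) (weak_partial s (component u j) x ^+ 2)).

(** [W_0^{k,2}(B^n, R^m)], the closure of the test maps in [W^{k,2}] *)
Definition sobolev0_map (k : nat) u : Prop :=
  sobolev_map k u /\
  forall e : R, 0 < e -> exists2 phi, test_map phi & sobolev_norm k (u \- phi) < e.

(** [|nabla Delta u|^2] *)
Definition grad_laplacian_sqr u (x : 'rV[R]_n) : R :=
  \sum_(j < m) \sum_(i < n)
    weak_partial [:: i] (weak_laplacian (component u j)) x ^+ 2.

(** Only meaningful on [W^{3,2}], where the integral is finite. *)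
Definition E3ext u : R := \int[mu]_(x in B) grad_laplacian_sqr u x.

End maps.
End sobolev.

Section triharmonic.
Context {R : realType}.
Variable n : nat.
Implicit Types u v phi : 'rV[R]_n -> 'rV[R]_(n + 1).

(** [W^{k,2}(B^n, S^n)] *)
Definition sobolev_sphere (k : nat) u : Prop :=
  sobolev_map k u /\
  {ae lebesgue_rV n, forall x, unit_ball x -> unit_sphere (u x)}.

Definition nearest_point (y : 'rV[R]_(n + 1)) : 'rV[R]_(n + 1) :=
  (enorm y)^-1 *: y.

Definition sphere_variation u phi (t : R) : 'rV[R]_n -> 'rV[R]_(n + 1) :=
  fun x => nearest_point (u x + t *: phi x).

Definition extrinsic_triharmonic u : Prop :=
  sobolev_sphere 3 u /\
  forall phi, test_map phi ->
    is_derive (0 : R) (1 : R) (fun t => E3ext (sphere_variation u phi t)) 0.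

Definition minimizing u : Prop :=
  forall v, sobolev_sphere 3 v -> sobolev0_map 3 (u \- v) -> E3ext u <= E3ext v.

Definition second_derivative (f : R -> R) (t l : R) : Prop :=
  (\forall t' \near t, derivable f t' 1) /\ is_derive t (1 : R) (derive1 f) l.

Definition stable u : Prop :=
  forall phi, test_map phi ->
    (\forall t \near (0 : R), sobolev0_map 3 (sphere_variation u phi t \- u)) ->
    forall l, second_derivative (fun t => E3ext (sphere_variation u phi t)) 0 l -> 0 <= l.

Definition equator_map : 'rV[R]_n -> 'rV[R]_(n + 1) :=
  fun x => row_mx ((enorm x)^-1 *: x) 0.

End triharmonic.

Definition minimizing_extrinsic_triharmonic (R : realType) n
    (u : 'rV[R]_n -> 'rV[R]_(n + 1)) : Prop :=
  extrinsic_triharmonic u /\ minimizing u.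

Definition unstable_extrinsic_triharmonic (R : realType) n
    (u : 'rV[R]_n -> 'rV[R]_(n + 1)) : Prop :=
  extrinsic_triharmonic u /\ ~ stable u.

(* Main.v *)
Require Import Defs.
From HB Require Import structures.
From mathcomp Require Import all_boot all_order all_algebra.
From mathcomp Require Import all_classical all_reals all_analysis.
From mathcomp Require Import measurable_realfun ring lra.

Set Implicit Arguments.
Unset Strict Implicit.
Unset Printing Implicit Defensive.

Import Order.TTheory GRing.Theory Num.Theory.
Import numFieldNormedType.Exports.

Local Open Scope classical_set_scope.
Local Open Scope ring_scope.

(** Write [rho = 1 / |x|].  On the punctured ball the equator map satisfies
    [Delta^3 u = - lam rho^6 u] with [lam = 15 (n - 1) (n - 3) (n - 5)], and for
    [n >= 7] the singularity is weak enough for every integration by parts, so the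
    first variation of the energy, in the direction [phi - (u . phi) u], vanishes.
    If [v = u - phi] takes its values in the sphere, then [|phi|^2 = 2 u . phi] and
      [E(v) - E(u) = int |nabla Delta phi|^2 - lam int rho^6 |phi|^2];
    the right-hand side is also half the second variation for [phi = (0, eta)].
    Iterating weighted Hardy and Rellich inequalities bounds the first integral
    below by [c int rho^6 |phi|^2], [c = ((n - 2) / 2)^2 ((n - 6) (n + 2) / 4)^2],
    and [lam <= c] exactly when [n >= 12].  The constant [c] is sharp: for [n < 12]
    the radial functions [eta = |x|^(- (n - 6) / 2) F (e ln |x| + 2)] with a cutoff
    [F] and small [e] make the second variation negative.  In the minimality proof
    a competitor is only approximated by test maps, and the resulting error in
    [|phi|^2 = 2 u . phi] is absorbed by truncating the weight [rho^6]. *)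

(** * Symbols *)

Section line_derivative.
Context {R : realType} {V : normedModType R}.
Implicit Types (f g : V -> R) (x v : V).

(** Apart from the competitor [v] and the error made in approximating it, all functions are smooth
    off the origin with power bounds on their derivatives. One number suffices for bookkeeping: a
    degree, additive under products and raised by one by each derivative. As [rho ^+ 6] is
    integrable for n >= 7, products of total degree at most six are integrable, and integration by
    parts across the origin reduces by Fubini to lines parallel to an axis, almost all of which miss
    the origin. Bounds uniform in a parameter also give the t-derivatives of the energy. The
    obstacle to minimality is that [v] has weak derivatives only. It is written as u - phi - z with
    phi a test map and z small in the Sobolev norm; exact computations are made on u - phi, and z
    enters only through inequalities. The constant c becomes visible in the variable s = ln |x|: on
    functions |x|^(-(n - 6)/2) F(s) the operator - Delta^3 is, up to a power of |x|, an even
    polynomial in d/ds with constant term c, so a slowly varying F comes close to equality. *)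

Lemma is_derive_line f x v (d : R) :
  is_derive x v f d <-> is_derive (0 : R) (1 : R) (fun h : R => f (h *: v + x)) d.
Proof.
have E : 'D_v f x = 'D_(1 : R) (fun h : R => f (h *: v + x)) 0.
  rewrite /derive; set g1 := fun h => h^-1 *: _; set g2 := fun h => h^-1 *: _.
  suff -> : g1 = g2 by [].
  by rewrite funeqE /g1 /g2 => h /=; rewrite addr0 scale0r add0r [_%:A]mulr1.
split=> -[df Df]; apply: DeriveDef.
- by apply/(derivable1P f x v).1.
- by rewrite -E.
- by apply/(derivable1P f x v).2.
- by rewrite E.
Qed.

Lemma near_continuous f g x : (\forall y \near x, f y = g y) ->
  {for x, continuous f} -> {for x, continuous g}.
Proof.
move=> fg fc; have E : g x = f x by rewrite (nbhs_singleton fg).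
rewrite /prop_for /continuous_at E; apply: cvg_trans fc.
by apply: near_eq_cvg; apply: filterS fg.
Qed.

Lemma is_derive_chain (F : R -> R) f x v (a b : R) :
  is_derive x v f b -> is_derive (f x) (1 : R) F a ->
  is_derive x v (F \o f) (a * b).
Proof.
move=> /is_derive_line df dF; apply/is_derive_line.
apply: (@is_derive1_comp R F (fun h : R => f (h *: v + x)) 0 a b) => //.
by rewrite scale0r add0r.
Qed.

Lemma is_deriveM' f g x v (a b : R) : is_derive x v f a -> is_derive x v g b ->
  is_derive x v (fun y => f y * g y) (f x * b + a * g x).
Proof.
move=> df dg; apply: (is_derive_eq (is_deriveM df dg)).
by rewrite -[g x *: a]/(g x * a) mulrC [a * _]mulrC.
Qed.

Lemma is_deriveD' f g x v (a b : R) : is_derive x v f a -> is_derive x v g b ->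
  is_derive x v (fun y => f y + g y) (a + b).
Proof. by move=> df dg; exact: is_deriveD. Qed.

Lemma is_deriveV' f x v (a : R) : f x != 0 -> is_derive x v f a ->
  is_derive x v (fun y => (f y)^-1) (- a * ((f x)^-1 * (f x)^-1)).
Proof.
move=> fx0 [df <-]; apply: DeriveDef; first exact: derivableV.
by rewrite deriveV// scaleNr -[_ *: _]/(_ * _) -exprVn expr2 mulNr mulrC.
Qed.

End line_derivative.

Section symbols.
Context {R : realType} {V : normedModType R} {Dir : Type}.
Variables (dir : Dir -> V) (Omega : set V) (w : V -> R).
Hypothesis Omega_open : open Omega.
Hypothesis w_ge1 : forall x, Omega x -> 1 <= w x.

(* [w] plays the role of the inverse distance to the singular set: a symbol of
   order [m] and degree [k] has its derivatives of order [l <= m] bounded by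
   [w ^ (k + l)], uniformly in the parameter [t] ranging over [P]. *)
Fixpoint symbol {T : Type} (P : set T) (m k : nat) (g : T -> V -> R) : Prop :=
  [/\ exists C, forall t x, P t -> Omega x -> `|g t x| <= C * w x ^+ k,
      forall t x, P t -> Omega x -> {for x, continuous (g t)} &
      if m is m'.+1 then forall i,
        (forall t x, P t -> Omega x -> derivable (g t) x (dir i)) /\
        symbol P m' k.+1 (fun t => 'D_(dir i) (g t))
      else True].

Section fixed_parameters.
Context {T : Type} {P : set T}.
Implicit Types (g h : T -> V -> R) (m k l : nat).
Local Notation sym := (@symbol T P).

Lemma Omega_near x : Omega x -> \forall y \near x, Omega y.
Proof. by move=> Ox; exact: open_nbhs_nbhs. Qed.

Lemma near_Omega (f1 f2 : V -> R) x : Omega x ->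
  (forall y, Omega y -> f1 y = f2 y) -> \forall y \near x, f1 y = f2 y.
Proof. by move=> Ox fg; apply: filterS (Omega_near Ox) => y /fg. Qed.

Lemma symbol_bound m k g : sym m k g ->
  exists2 C, 0 <= C & forall t x, P t -> Omega x -> `|g t x| <= C * w x ^+ k.
Proof.
case: m => [|m] [[C gC] _ _]; exists `|C| => // t x Pt Ox.
  by rewrite (le_trans (gC _ _ Pt Ox))// ler_wpM2r ?ler_norm// exprn_ge0 ?(le_trans _ (w_ge1 Ox)).
by rewrite (le_trans (gC _ _ Pt Ox))// ler_wpM2r ?ler_norm// exprn_ge0 ?(le_trans _ (w_ge1 Ox)).
Qed.

Lemma symbol_cont m k g t x : sym m k g -> P t -> Omega x -> {for x, continuous (g t)}.
Proof. by case: m => [|m] [_ gc _] Pt Ox; exact: gc. Qed.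

Lemma symbol_derive m k g t x i : sym m.+1 k g -> P t -> Omega x ->
  is_derive x (dir i) (g t) ('D_(dir i) (g t) x).
Proof. by move=> [_ _ /(_ i)[+ _]] Pt Ox => /(_ _ _ Pt Ox); exact: derivableP. Qed.

Lemma symbolD1 m k g i : sym m.+1 k g -> sym m k.+1 (fun t => 'D_(dir i) (g t)).
Proof. by move=> [_ _ /(_ i)[]]. Qed.

Lemma symbol_ext m k g h :
  (forall t x, P t -> Omega x -> g t x = h t x) -> sym m k g -> sym m k h.
Proof.
elim: m k g h => [|m IH] k g h gh sg.
  case: sg => -[C gC] gc _; split=> //; first by exists C => t x Pt Ox; rewrite -gh// gC.
  move=> t x Pt Ox; apply: near_continuous (gc _ _ Pt Ox).
  exact: near_Omega (fun y => @gh t y Pt).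
case: sg => -[C gC] gc gd; split.
- by exists C => t x Pt Ox; rewrite -gh// gC.
- move=> t x Pt Ox; apply: near_continuous (gc _ _ Pt Ox).
  exact: near_Omega (fun y => @gh t y Pt).
- move=> i; have [gdi sdi] := gd i; split.
    move=> t x Pt Ox; apply: near_eq_derivable (gdi _ _ Pt Ox).
    exact: near_Omega (fun y => @gh t y Pt).
  apply: IH sdi => t x Pt Ox; apply: near_eq_derive.
  exact: near_Omega (fun y => @gh t y Pt).
Qed.

(** The recursive clause speaks of ['D_(dir i)], whereas calculations produce an explicit formula
    for the derivative; as [Omega] is open, the two can be exchanged at the next order. *)
Lemma symbolS_intro m k g :
  (exists C, forall t x, P t -> Omega x -> `|g t x| <= C * w x ^+ k) ->
  (forall t x, P t -> Omega x -> {for x, continuous (g t)}) ->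
  (forall i, exists2 d : T -> V -> R,
    (forall t x, P t -> Omega x -> is_derive x (dir i) (g t) (d t x)) &
    sym m k.+1 d) ->
  sym m.+1 k g.
Proof.
move=> gC gc gd; split=> // i; have [d dg sd] := gd i; split.
  by move=> t x Pt Ox; have [] := dg _ _ Pt Ox.
by apply: symbol_ext sd => t x Pt Ox; have [_ ->] := dg _ _ Pt Ox.
Qed.

Lemma symbol_degree m k l g : (k <= l)%N -> sym m k g -> sym m l g.
Proof.
move=> kl; elim: m k l kl g => [|m IH] k l kl g sg; have [C C0 gC] := symbol_bound sg.
  split=> //; last by move=> t x; exact: symbol_cont sg.
  exists C => t x Pt Ox; rewrite (le_trans (gC _ _ Pt Ox))// ler_wpM2l//.
  by rewrite ler_weXn2l ?w_ge1.
apply: symbolS_intro; last first.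
- move=> i; exists (fun t => 'D_(dir i) (g t)); first by move=> *; apply: symbol_derive sg _ _.
  by apply: (IH k.+1) => //; exact: symbolD1.
- by move=> t x; exact: symbol_cont sg.
exists C => t x Pt Ox; rewrite (le_trans (gC _ _ Pt Ox))// ler_wpM2l//.
by rewrite ler_weXn2l ?w_ge1.
Qed.

Lemma symbolW m k g : sym m.+1 k g -> sym m k g.
Proof.
elim: m k g => [|m IH] k g; first by case=> gC gc _; split.
move=> sg; apply: symbolS_intro; last first.
- move=> i; exists (fun t => 'D_(dir i) (g t)); first by move=> *; apply: symbol_derive sg _ _.
  by apply: IH; exact: symbolD1.
- by move=> t x; exact: symbol_cont sg.
- by have [C _ gC] := symbol_bound sg; exists C.
Qed.

Lemma symbol_order m l k g : (l <= m)%N -> sym m k g -> sym l k g.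
Proof.
move=> /subnK <-; elim: (m - l)%N => [|j IH]; first by rewrite add0n.
by rewrite addSn => /symbolW.
Qed.

Lemma symbolD m k g h : sym m k g -> sym m k h -> sym m k (fun t x => g t x + h t x).
Proof.
elim: m k g h => [|m IH] k g h sg sh.
  have [[C C0 gC] [D D0 hD]] := (symbol_bound sg, symbol_bound sh); split=> //.
    exists (C + D) => t x Pt Ox; rewrite (le_trans (ler_normD _ _))// mulrDl.
    by rewrite lerD ?gC ?hD.
  by move=> t x Pt Ox; apply: continuousD; [exact: symbol_cont sg _ _|exact: symbol_cont sh _ _].
apply: symbolS_intro.
- have [[C C0 gC] [D D0 hD]] := (symbol_bound sg, symbol_bound sh).
  exists (C + D) => t x Pt Ox; rewrite (le_trans (ler_normD _ _))// mulrDl.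
  by rewrite lerD ?gC ?hD.
- by move=> t x Pt Ox; apply: continuousD; [exact: symbol_cont sg _ _|exact: symbol_cont sh _ _].
move=> i; exists (fun t x => 'D_(dir i) (g t) x + 'D_(dir i) (h t) x).
  by move=> t x Pt Ox; apply: is_deriveD'; [exact: symbol_derive sg _ _|exact: symbol_derive sh _ _].
by apply: IH; exact: symbolD1.
Qed.

Lemma symbolM m k l g h : sym m k g -> sym m l h ->
  sym m (k + l) (fun t x => g t x * h t x).
Proof.
elim: m k l g h => [|m IH] k l g h sg sh.
  have [[C C0 gC] [D D0 hD]] := (symbol_bound sg, symbol_bound sh); split=> //.
    exists (C * D) => t x Pt Ox; rewrite normrM exprD mulrACA.
    by rewrite ler_pM ?gC ?hD.
  by move=> t x Pt Ox; apply: continuousM; [exact: symbol_cont sg _ _|exact: symbol_cont sh _ _].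
apply: symbolS_intro.
- have [[C C0 gC] [D D0 hD]] := (symbol_bound sg, symbol_bound sh).
  exists (C * D) => t x Pt Ox; rewrite normrM exprD mulrACA.
  by rewrite ler_pM ?gC ?hD.
- by move=> t x Pt Ox; apply: continuousM; [exact: symbol_cont sg _ _|exact: symbol_cont sh _ _].
move=> i; exists (fun t x => g t x * 'D_(dir i) (h t) x + 'D_(dir i) (g t) x * h t x).
  by move=> t x Pt Ox; apply: is_deriveM'; [exact: symbol_derive sg _ _|exact: symbol_derive sh _ _].
apply: symbolD.
  by rewrite -addnS; apply: IH; [exact: symbolW|exact: symbolD1].
by rewrite -addSn; apply: IH; [exact: symbolD1|exact: symbolW].
Qed.

Lemma symbolM00 m g h : sym m 0 g -> sym m 0 h -> sym m 0 (fun t x => g t x * h t x).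
Proof. exact: symbolM. Qed.

Lemma symbol_cst m k (c : T -> R) (C : R) : (forall t, P t -> `|c t| <= C) ->
  sym m k (fun t _ => c t).
Proof.
elim: m k c C => [|m IH] k c C cC.
  apply: (@symbol_degree _ 0) => //; split=> //.
    by exists C => t x Pt Ox; rewrite expr0 mulr1; exact: cC.
  by move=> t x _ _; exact: cst_continuous.
apply: symbolS_intro.
- exists C => t x Pt Ox; rewrite (le_trans (cC _ Pt))// ler_peMr ?exprn_ege1 ?w_ge1//.
  exact: le_trans (cC _ Pt).
- by move=> t x _ _; exact: cst_continuous.
- move=> i; exists (fun _ _ => 0); first by move=> t x _ _; exact: is_derive_cst.
  by apply: (IH _ (fun=> 0) 0) => t _; rewrite normr0.
Qed.

Lemma symbol_const m k (c : R) : sym m k (fun _ _ => c).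
Proof. exact: (@symbol_cst m k (fun=> c) `|c|). Qed.

Lemma symbolZ m k (c : R) g : sym m k g -> sym m k (fun t x => c * g t x).
Proof. by move=> sg; rewrite -[k]add0n; apply: symbolM sg; exact: symbol_const. Qed.

Lemma symbolN m k g : sym m k g -> sym m k (fun t x => - g t x).
Proof. by move=> /(symbolZ (-1)); apply: symbol_ext => t x _ _; rewrite mulN1r. Qed.

Lemma symbolB m k g h : sym m k g -> sym m k h -> sym m k (fun t x => g t x - h t x).
Proof. by move=> sg sh; apply: symbolD => //; exact: symbolN. Qed.

Lemma symbol_sum m k J (r : seq J) (Q : pred J) (g : J -> T -> V -> R) :
  (forall j, sym m k (g j)) -> sym m k (fun t x => \sum_(j <- r | Q j) g j t x).
Proof.
move=> sg; elim: r => [|j r IH].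
  by apply: symbol_ext (symbol_const m k 0) => t x _ _; rewrite big_nil.
have [Qj|Qj] := boolP (Q j).
  by apply: symbol_ext (symbolD (sg j) IH) => t x _ _; rewrite big_cons Qj.
by apply: symbol_ext IH => t x _ _; rewrite big_cons (negbTE Qj).
Qed.

Lemma symbolV m g (c : R) : 0 < c -> (forall t x, P t -> Omega x -> c <= g t x) ->
  sym m 0 g -> sym m 0 (fun t x => (g t x)^-1).
Proof.
move=> c0 gc; have g0 t x : P t -> Omega x -> 0 < g t x.
  by move=> Pt Ox; exact: lt_le_trans (gc _ _ Pt Ox).
have bnd : exists C, forall t x, P t -> Omega x -> `|(g t x)^-1| <= C * w x ^+ 0.
  exists c^-1 => t x Pt Ox; rewrite expr0 mulr1 gtr0_norm ?invr_gt0 ?g0//.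
  by rewrite lef_pV2 ?posrE ?g0// gc.
have cnt n : sym n 0 g ->
    forall t x, P t -> Omega x -> {for x, continuous (fun x => (g t x)^-1)}.
  move=> sg t x Pt Ox; apply: continuousV; first by rewrite gt_eqF ?g0.
  exact: symbol_cont sg _ _.
elim: m => [|m IH] sg; first by split=> //; exact: cnt sg.
apply: symbolS_intro => //; first exact: cnt sg.
move=> i; exists (fun t x => - 'D_(dir i) (g t) x * ((g t x)^-1 * (g t x)^-1)).
  move=> t x Pt Ox; apply: is_deriveV'; first by rewrite gt_eqF ?g0.
  exact: symbol_derive sg _ _.
rewrite -[X in sym m X]addn0; apply: symbolM; first exact/symbolN/symbolD1.
by apply: symbolM00; apply: IH; exact: symbolW.
Qed.

(** The derivative of g^(-1/2) is -1/2 g' (g^(-1/2))^3, which involves no new function besides g',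
    so the induction on the order closes. The uniform lower bound [c] keeps the degree at 0. *)
Lemma symbol_isqrt m g (c : R) : 0 < c -> (forall t x, P t -> Omega x -> c <= g t x) ->
  sym m 0 g -> sym m 0 (fun t x => (Num.sqrt (g t x))^-1).
Proof.
move=> c0 gc; have g0 t x : P t -> Omega x -> 0 < g t x.
  by move=> Pt Ox; exact: lt_le_trans (gc _ _ Pt Ox).
have bnd : exists C, forall t x, P t -> Omega x -> `|(Num.sqrt (g t x))^-1| <= C * w x ^+ 0.
  exists (Num.sqrt c)^-1 => t x Pt Ox; rewrite expr0 mulr1 ger0_norm ?invr_ge0 ?sqrtr_ge0//.
  by rewrite lef_pV2 ?posrE ?sqrtr_gt0 ?g0// ler_sqrt ?gc// ltW ?g0.
have cnt n : sym n 0 g ->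
    forall t x, P t -> Omega x -> {for x, continuous (fun x => (Num.sqrt (g t x))^-1)}.
  move=> sg t x Pt Ox; apply: continuousV; first by rewrite gt_eqF ?sqrtr_gt0 ?g0.
  apply: (@continuous_comp _ _ _ (g t) Num.sqrt); last exact: sqrt_continuous.
  exact: symbol_cont sg _ _.
elim: m => [|m IH] sg; first by split=> //; exact: cnt sg.
apply: symbolS_intro => //; first exact: cnt sg.
move=> i; exists (fun t x => (- 2^-1 * 'D_(dir i) (g t) x) *
    ((Num.sqrt (g t x))^-1 * ((Num.sqrt (g t x))^-1 * (Num.sqrt (g t x))^-1))).
  move=> t x Pt Ox; have s0 : Num.sqrt (g t x) != 0 by rewrite gt_eqF ?sqrtr_gt0 ?g0.
  have dg := @symbol_derive _ _ _ t x i sg Pt Ox.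
  have ds := is_derive_chain dg (is_derive1_sqrt (g0 _ _ Pt Ox)).
  have := is_deriveV' (f := Num.sqrt \o g t) s0 ds => /=.
  by move=> h; apply: DeriveDef; [case: h|case: h => _ ->; field].
rewrite -[X in sym m X]addn0; apply: symbolM; first exact/symbolZ/symbolD1.
by have := IH (symbolW sg) => s; do 2?[apply: symbolM00 => //].
Qed.

End fixed_parameters.

Lemma symbol_reparam T (P : set T) T' (P' : set T') (f : T' -> T) m k g :
  (forall t, P' t -> P (f t)) -> symbol P m k g -> symbol P' m k (fun t => g (f t)).
Proof.
move=> fP; elim: m k g => [|m IH] k g [[C gC] gc gd].
  split=> //; last by move=> t x /fP; exact: gc.
  by exists C => t x /fP; exact: gC.
split; first by exists C => t x /fP; exact: gC.
  by move=> t x /fP; exact: gc.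
move=> i; have [gdi gsi] := gd i; split; first by move=> t x /fP; exact: gdi.
exact: (IH _ _ gsi).
Qed.

End symbols.

Section symbol_restrict.
Context {R : realType} {V : normedModType R} {Dir : Type}.
Variables (dir : Dir -> V) (O1 O2 : set V) (w1 w2 : V -> R).
Hypothesis O12 : O2 `<=` O1.
Hypothesis w12 : forall x, O2 x -> 0 <= w1 x <= w2 x.

Lemma symbol_restrict T (P : set T) m k g :
  symbol dir O1 w1 P m k g -> symbol dir O2 w2 P m k g.
Proof.
have bnd k' g' : (exists C, forall t x, P t -> O1 x -> `|g' t x| <= C * w1 x ^+ k') ->
    exists C, forall t x, P t -> O2 x -> `|g' t x| <= C * w2 x ^+ k'.
  move=> [C gC]; exists `|C| => t x Pt Ox; have /andP[w0 w1w2] := w12 Ox.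
  rewrite (le_trans (gC _ _ Pt (O12 Ox)))// (le_trans (ler_wpM2r _ (ler_norm C))) ?exprn_ge0//.
  by rewrite ler_wpM2l// lerXn2r ?nnegrE// (le_trans w0).
elim: m k g => [|m IH] k g [gC gc gd].
  by split=> //; [exact: bnd|move=> t x Pt /O12; exact: gc].
split; [exact: bnd|by move=> t x Pt /O12; exact: gc|].
move=> i; have [gdi gsi] := gd i; split; last exact: IH.
by move=> t x Pt /O12; exact: gdi.
Qed.

End symbol_restrict.

Section symbol_comp.
Context {R : realType} {V : normedModType R} {Dir : Type}.
Variables (dir : Dir -> V) (Omega : set V) (w : V -> R).
Hypothesis Omega_open : open Omega.
Hypothesis w_ge1 : forall x, Omega x -> 1 <= w x.
Variable f : V -> R.

(* Bounded smooth functions of one real variable are the symbols on the line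
   with trivial weight. *)
Definition symbol1 (m : nat) (F : R -> R) : Prop :=
  symbol (fun _ : unit => 1 : R) setT (fun=> 1) [set: unit] m 0 (fun _ => F).

Lemma symbol1_le1 : forall x : R, [set: R] x -> 1 <= (fun=> 1 : R) x.
Proof. by []. Qed.

Lemma symbol1S m F : symbol1 m.+1 F -> symbol1 m (derive1 F).
Proof.
move=> /(symbolD1 tt); rewrite /symbol1.
have -> : (fun=> (derive1 F)) = (fun=> 'D_1 F) :> (unit -> R -> R).
  by apply/funext => _; apply/funext => x; rewrite derive1E.
move=> s.
(* With the weight identically 1 the degree carries no information, so the degree 1 acquired by
   differentiating can be reset to 0. *)
have aux m' G : forall k l, symbol (fun _ : unit => 1 : R) setT (fun=> 1) [set: unit] m' k G ->
    symbol (fun _ : unit => 1 : R) setT (fun=> 1) [set: unit] m' l G.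
  elim: m' G => [|m' IH] G k l [[C gC] gc gd].
    by split=> //; exists C => t x _ _; rewrite expr1n; have := gC t x I I; rewrite expr1n.
  split=> //; first by exists C => t x _ _; rewrite expr1n; have := gC t x I I; rewrite expr1n.
  by move=> i; have [gdi gsi] := gd i; split=> //; exact: IH gsi.
exact: aux s.
Qed.

Lemma symbol1_derive m F x : symbol1 m.+1 F -> is_derive x (1 : R) F ((derive1 F) x).
Proof. by move=> s; rewrite derive1E; exact: (symbol_derive tt s (t := tt)). Qed.

(** Bounds are asked of the derivatives of [f] and not of [f], so that the lemma covers the
    coordinates on the whole space and ln |x| near the origin, which are unbounded. *)
Lemma symbol_comp T (P : set T) m F : (forall m, symbol1 m F) ->
  (forall x, Omega x -> {for x, continuous f}) ->
  (forall i, exists2 d : V -> R,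
    (forall x, Omega x -> is_derive x (dir i) f (d x)) &
    forall m, symbol dir Omega w P m 1 (fun _ : T => d)) ->
  symbol dir Omega w P m 0 (fun _ : T => F \o f).
Proof.
move=> sF fc fd; elim: m F sF => [|m IH] F sF;
  have [C C0 FC] := symbol_bound symbol1_le1 (sF 0).
  split=> //.
    by exists C => t x _ _; rewrite expr0; have := FC tt (f x) I I; rewrite expr0.
  move=> t x _ Ox; apply: continuous_comp; first exact: fc.
  exact: (symbol_cont (sF 0) (t := tt)).
apply: symbolS_intro => //.
- by exists C => t x _ _; rewrite expr0; have := FC tt (f x) I I; rewrite expr0.
- move=> t x _ Ox; apply: continuous_comp; first exact: fc.
  exact: (symbol_cont (sF 0) (t := tt)).
move=> i; have [d fd' sd] := fd i; exists (fun _ x => (derive1 F) (f x) * d x).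
  move=> t x _ Ox; apply: is_derive_chain; first exact: fd'.
  exact: symbol1_derive (sF 1).
rewrite -[1%N]add0n; apply: symbolM => //.
by apply: IH => m'; exact: symbol1S.
Qed.

End symbol_comp.

(** * Lebesgue measure on R^n *)

Section euclidean_norm.
Context {R : realType} {n : nat}.
Implicit Types x y : 'rV[R]_n.

Lemma enorm_ge0 x : 0 <= enorm x.
Proof. exact: sqrtr_ge0. Qed.

Lemma sum_sqr_ge0 (I : Type) (r : seq I) (F : I -> R) :
  0 <= \sum_(i <- r) F i ^+ 2.
Proof. by apply: sumr_ge0 => i _; exact: sqr_ge0. Qed.

Lemma enorm_sqr x : enorm x ^+ 2 = \sum_(i < n) x ord0 i ^+ 2.
Proof. by rewrite sqr_sqrtr// sum_sqr_ge0. Qed.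

Lemma ler_coord_enorm x i : `|x ord0 i| <= enorm x.
Proof.
rewrite -sqrtr_sqr ler_wsqrtr// (bigD1 i)//= lerDl; apply: sumr_ge0 => j _.
exact: sqr_ge0.
Qed.

Lemma enorm0 : enorm (0 : 'rV[R]_n) = 0.
Proof. by rewrite /enorm big1 ?sqrtr0// => i _; rewrite mxE expr0n. Qed.

Lemma enorm_eq0 x : enorm x = 0 -> x = 0.
Proof.
move=> x0; apply/rowP => i; rewrite mxE; apply/eqP.
by rewrite -normr_le0 -x0 ler_coord_enorm.
Qed.

Lemma enorm_gt0 x : x != 0 -> 0 < enorm x.
Proof.
move=> x0; rewrite lt_neqAle enorm_ge0 andbT; apply: contra x0 => /eqP/esym.
by move=> /enorm_eq0 ->.
Qed.

Lemma continuous_enorm : continuous (@enorm R n).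
Proof.
move=> x; apply: (@continuous_comp _ _ _
  (fun y : 'rV[R]_n => \sum_(i < n) y ord0 i ^+ 2) Num.sqrt).
  elim: (index_enum 'I_n) => [|i s IH].
    have -> : (fun y : 'rV[R]_n => \sum_(i <- [::]) y ord0 i ^+ 2) = cst 0.
      by apply/funext => y; rewrite big_nil.
    exact: cst_continuous.
  have cx : {for x, continuous (fun y : 'rV[R]_n => y ord0 i)} by exact: coord_continuous.
  have -> : (fun y : 'rV[R]_n => \sum_(i <- i :: s) y ord0 i ^+ 2) =
      (fun y => y ord0 i * y ord0 i + \sum_(i <- s) y ord0 i ^+ 2).
    by apply/funext => y; rewrite big_cons.
  exact: continuousD (continuousM cx cx) IH.
exact: sqrt_continuous.
Qed.

Lemma open_unit_ball : open (@unit_ball R n).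
Proof.
rewrite /unit_ball (_ : [set x | _] = @enorm R n @^-1` [set y | y < 1]).
  by apply: open_comp => [x _|]; [exact: continuous_enorm|exact: open_lt].
by [].
Qed.

End euclidean_norm.

Section measurability_rV.
Context {R : realType}.

Definition open_box n (a b : 'I_n -> R) : set 'rV[R]_n :=
  [set x | forall i, a i < x ord0 i < b i].

Lemma measurable_coord_preimage n (i : 'I_n) (A : set (measurableTypeR R)) :
  measurable A -> measurable [set x : 'rV[R]_n | A (x ord0 i)].
Proof.
by move=> mA; have := measurable_rV_coord i measurableT mA; rewrite setTI.
Qed.

Lemma measurable_coord_itv n (i : 'I_n) (J : interval R) :
  measurable [set x : 'rV[R]_n | [set` J] (x ord0 i)].
Proof. by apply: measurable_coord_preimage; exact: measurable_itv. Qed.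

Lemma measurable_forall_ord n (P : 'I_n -> set 'rV[R]_n) :
  (forall i, measurable (P i)) -> measurable [set x | forall i, P i x].
Proof.
move=> mP; have -> : [set x | forall i, P i x] = \bigcap_(i in [set: 'I_n]) P i.
  by apply/seteqP; split=> x /= H i; [move=> _; exact: H|exact: H].
exact: fin_bigcap_measurable.
Qed.

Lemma measurable_open_box n (a b : 'I_n -> R) : measurable (open_box a b).
Proof.
apply: (measurable_forall_ord (P := fun i => [set x : 'rV[R]_n | a i < x ord0 i < b i])) => i.
have := @measurable_coord_itv n i `]a i, b i[.
by congr measurable; apply/seteqP; split=> x /=; rewrite in_itv.
Qed.

(** Rational corners leave countably many boxes. The box that lies in [A] is the closed one, so that
    a bump function supported in it is a test function when [A] is the unit ball. *)
Lemma open_box_nbhs n (A : set 'rV[R]_n) x : nbhs x A ->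
  exists ab : {ffun 'I_n -> rat * rat},
    open_box (fun i => ratr (ab i).1) (fun i => ratr (ab i).2) x /\
    [set y : 'rV[R]_n | forall i, ratr (ab i).1 <= y ord0 i <= ratr (ab i).2] `<=` A.
Proof.
move=> /nbhs_ballP[e /= e0 eA].
have Q i : exists q : rat * rat,
    x ord0 i - e < ratr q.1 < x ord0 i /\ x ord0 i < ratr q.2 < x ord0 i + e.
  have [q1] : exists q, ratr q \in `]x ord0 i - e, x ord0 i[.
    by apply: rat_in_itvoo; rewrite ltrBlDr ltrDl.
  have [q2] : exists q, ratr q \in `]x ord0 i, x ord0 i + e[.
    by apply: rat_in_itvoo; rewrite ltrDl.
  by rewrite !in_itv /= => ? ?; exists (q1, q2).
have [q qP] := choice Q.
exists [ffun i => q i]; split.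
  by move=> i; rewrite !ffunE; have [/andP[_ ->] /andP[-> _]] := qP i.
move=> y yb; apply: eA; split=> // i j; rewrite (ord1 i) => {i}.
have := yb j; rewrite !ffunE; have [/andP[a1 a2] /andP[a3 a4]] := qP j => /andP[b1 b2].
rewrite -ball_normE /= ltr_norml; apply/andP; split; lra.
Qed.

(** The sigma-algebra is generated by the coordinates, not by the open sets; an open set is
    recovered as the union of the rational boxes it contains, enumerated through [unpickle]. *)
Lemma open_measurable_rV n (A : set 'rV[R]_n) : open A -> measurable A.
Proof.
move=> oA.
pose box (ab : {ffun 'I_n -> rat * rat}) : set 'rV[R]_n :=
  open_box (fun i => ratr (ab i).1) (fun i => ratr (ab i).2).
have -> : A = \bigcup_(k in [set: nat])
    (if unpickle k is Some ab then if `[< box ab `<=` A >] then box ab else set0 else set0).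
  apply/seteqP; split=> x.
    move=> Ax; have [ab [abx abA]] := open_box_nbhs (open_nbhs_nbhs (conj oA Ax)).
    exists (pickle ab) => //; rewrite pickleK asboolT// => y yab; apply: abA => i.
    by have /andP[/ltW -> /ltW ->] := yab i.
  by move=> [k _]; case: unpickle => // ab; case: ifPn => // /asboolP; apply.
apply: bigcup_measurable => k _; case: unpickle => // ab.
by case: ifPn => // _; exact: measurable_open_box.
Qed.

Lemma closed_measurable_rV n (A : set 'rV[R]_n) : closed A -> measurable A.
Proof.
by rewrite -openC => /open_measurable_rV/measurableC; rewrite setCK.
Qed.

Lemma compact_measurable_rV n (A : set 'rV[R]_n) : compact A -> measurable A.
Proof.
move=> /compact_closed cA; apply: closed_measurable_rV; apply: cA.
exact: norm_hausdorff.
Qed.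

Lemma measurable_unit_ball n : measurable (@unit_ball R n).
Proof. by apply: open_measurable_rV; exact: open_unit_ball. Qed.

Lemma continuous_measurable_fun_rV n (D : set 'rV[R]_n) (f : 'rV[R]_n -> R) :
  open D -> (forall x, D x -> {for x, continuous f}) -> measurable_fun D f.
Proof.
move=> oD cf; apply: (measurability _ (measurable_realfun.RGenOInfty.measurableE R)).
move=> /= _ [_ [a ->]] <-; apply: open_measurable_rV.
rewrite openE => x [Dx fx]; rewrite /interior.
apply: filterI; first exact: open_nbhs_nbhs.
apply: cf => //; apply: open_nbhs_nbhs; split=> //.
Qed.

Lemma measurable_set0_rV n : measurable [set (0 : 'rV[R]_n)].
Proof.
apply: closed_measurable_rV; apply: accessible_closed_set1.
exact/hausdorff_accessible/norm_hausdorff.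
Qed.

(** Meant for functions singular at the origin: their value there changes a preimage by at most the
    measurable set {0}. *)
Lemma measurable_fun_punctured n (D : set 'rV[R]_n) (f : 'rV[R]_n -> R) :
  open D -> (forall x, D x -> x != 0 -> {for x, continuous f}) -> measurable_fun D f.
Proof.
move=> oD cf mD Y mY.
have m0 : measurable [set (0 : 'rV[R]_n)] := @measurable_set0_rV n.
have oD0 : open (D `&` ~` [set 0]).
  apply: openI => //; apply: closed_openC; apply: accessible_closed_set1.
  exact/hausdorff_accessible/norm_hausdorff.
have -> : D `&` f @^-1` Y = ((D `&` ~` [set 0]) `&` f @^-1` Y) `|`
    (D `&` f @^-1` Y `&` [set 0]).
  rewrite -setIA [~` _ `&` _]setIC setIA -setIUr.
  by rewrite setUC setUv setIT.
apply: measurableU.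
  have mf : measurable_fun (D `&` ~` [set 0]) f.
    apply: continuous_measurable_fun_rV => // x [Dx x0]; apply: cf => //.
    exact/eqP.
  exact: mf (open_measurable_rV oD0) _ mY.
have [Y0|Y0] := pselect ((D `&` f @^-1` Y) 0).
  by rewrite (_ : _ `&` _ = [set 0])//; apply/seteqP; split=> [x []//|x ->].
rewrite (_ : _ `&` _ = set0)//; apply/seteqP; split=> [x [+ x0]|//].
by rewrite x0.
Qed.

Lemma lebesgue_rV_set0 n : lebesgue_rV n.+1 [set (0 : 'rV[R]_n.+1)] = 0%E.
Proof.
apply/eqP; rewrite eq_le measure_ge0 andbT; apply/lee_addgt0Pr => e e0; rewrite add0e.
(* The half-open box ]-e, 0] x ]-1, 0]^n contains the origin, since its upper faces belong to it,
   and has volume [e]. *)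
pose a : 'I_n.+1 -> R := fun i => if i == ord0 then - e else -1.
pose b : 'I_n.+1 -> R := fun=> 0.
have ab i : a i <= b i by rewrite /a /b; case: ifP => _; lra.
have E : \prod_i (b i - a i) = e.
  rewrite big_ord_recl /a /b eqxx opprK add0r big1 ?mulr1// => i _.
  by rewrite /= opprK add0r.
have := lebesgue_rV_box ab; rewrite E => <-.
apply: le_measure.
- by rewrite inE; exact: measurable_set0_rV.
- rewrite inE; apply: (measurable_forall_ord (P := fun i => [set x : 'rV[R]_n.+1 | a i < x ord0 i <= b i])) => i.
  have := @measurable_coord_itv n.+1 i `]a i, b i].
  by congr measurable; apply/seteqP; split=> x /=; rewrite in_itv.
- by move=> _ -> i; rewrite mxE lexx andbT /a; case: ifP => _; lra.
Qed.

Lemma lebesgue_rV_cube_lty n (c : R) : 0 <= c ->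
  lebesgue_rV n [set x : 'rV[R]_n | forall i, - c < x ord0 i <= c] = ((2 * c) ^+ n)%:E.
Proof.
move=> c0; rewrite lebesgue_rV_box => [|i]; last by lra.
by rewrite prodr_const card_ord; congr (_ ^+ _)%:E; ring.
Qed.

Lemma measurable_cube n (c : R) :
  measurable [set x : 'rV[R]_n | forall i, - c < x ord0 i <= c].
Proof.
apply: (measurable_forall_ord (P := fun i => [set x : 'rV[R]_n | - c < x ord0 i <= c])) => i.
have := @measurable_coord_itv n i `](- c), c].
by congr measurable; apply/seteqP; split=> x /=; rewrite in_itv.
Qed.

Lemma lebesgue_rV_ball_lty n : (lebesgue_rV n (@unit_ball R n) < +oo)%E.
Proof.
apply: (@le_lt_trans _ _ (lebesgue_rV n [set x : 'rV[R]_n | forall i, - 1 < x ord0 i <= 1])).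
  apply: le_measure; rewrite ?inE; [exact: measurable_unit_ball|exact: measurable_cube|].
  move=> x /= x1 i; have := le_lt_trans (ler_coord_enorm x i) x1.
  by rewrite ltr_norml => /andP[-> /ltW].
by rewrite lebesgue_rV_cube_lty// ltry.
Qed.

End measurability_rV.

Section line_integrals.
Context {R : realType}.
Local Notation leb := (@lebesgue_measure R).

Lemma integral_derive_compact (G g : R -> R) (c : R) : 0 < c ->
  (forall s, is_derive s (1 : R) G (g s)) -> continuous g ->
  (forall s, c <= `|s| -> G s = 0 /\ g s = 0) ->
  (\int[leb]_s (g s)%:E = 0)%E.
Proof.
move=> c0 dG cg Gc.
have cG : continuous G.
  by move=> s; apply: differentiable_continuous; apply/derivable1_diffP; have [] := dG s.
transitivity (\int[leb]_(s in `[(- c)%R, c%R]) (g s)%:E)%E.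
  rewrite [RHS]integral_mkcond; apply: eq_integral => s _; rewrite patchE.
  case: ifPn => //; rewrite notin_setE /= in_itv /= => /negP sc.
  have [|_ ->//] := Gc s.
  by rewrite leNgt ltr_norml; apply: contra sc => /andP[/ltW -> /ltW ->].
rewrite (@continuous_FTC2 _ g G (- c) c).
- have [|-> _] := Gc c; [by rewrite ger0_norm ?lexx ?ltW|].
  have [|-> _] := Gc (- c); [by rewrite normrN ger0_norm ?lexx ?ltW|].
  by rewrite sube0.
- lra.
- exact: continuous_subspaceT.
- split.
  + by move=> x _; have [] := dG x.
  + exact/cvg_at_right_filter/cG.
  + exact/cvg_at_left_filter/cG.
- by move=> x _; rewrite derive1E; have [_ ->] := dG x.
Qed.

Section cons.
Context {n : nat}.
Implicit Types f : 'rV[R]_n.+1 -> R.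
Local Notation mu := (@lebesgue_rV R n).
Local Notation muS := (@lebesgue_rV R n.+1).

Lemma integrable_rV_cons f : muS.-integrable setT (EFin \o f) ->
  (leb \x mu)%E.-integrable setT (EFin \o (f \o @rV_cons R n)).
Proof.
move=> /integrableP[mf foo]; apply/integrableP; split.
  apply/measurable_EFinP; apply: measurableT_comp (@measurable_rV_cons R n).
  exact/measurable_EFinP.
apply: le_lt_trans foo.
have mf' : measurable_fun setT (abse \o (EFin \o f)) by exact: measurableT_comp.
have := @ge0_integral_pushforward _ _ _ _ _ _ (@measurable_rV_cons R n) (leb \x mu)%E setT
  _ measurableT mf' (fun y _ => abse_ge0 _).
rewrite preimage_setT => <-; rewrite le_eqVlt; apply/orP; left; apply/eqP/esym.
exact: (eq_measure_integral
  (measure_function_pushforward__canonical__measure_function_Measure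
    (leb \x mu)%E (@measurable_rV_cons R n))).
Qed.

Lemma integral_rV_cons f : muS.-integrable setT (EFin \o f) ->
  (\int[muS]_x (f x)%:E = \int[(leb \x mu)]_p (f (rV_cons p))%:E)%E.
Proof.
move=> fi; have fi' := integrable_rV_cons fi; move/integrableP : (fi) => [mf foo].
have := @integral_pushforward _ _ _ _ _ _ (@measurable_rV_cons R n) (leb \x mu)%E setT
  (EFin \o f) mf.
rewrite preimage_setT => /(_ fi' measurableT) <-.
exact: (eq_measure_integral
  (measure_function_pushforward__canonical__measure_function_Measure
    (leb \x mu)%E (@measurable_rV_cons R n))).
Qed.

Lemma rV_consE (a : R) (y : 'rV[R]_n) :
  rV_cons (a, y) = rV_cons (0, y) + a *: delta_mx ord0 ord0.
Proof.
apply/rowP => i; rewrite [RHS]mxE [X in _ + X]mxE [X in _ * X]mxE; case: (unliftP ord0 i) => [j ->|->].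
  by rewrite !rV_consS /= mulr0 addr0.
by rewrite !rV_cons0 /= add0r mulr1.
Qed.

Lemma rV_cons_line (a s : R) (y : 'rV[R]_n) (j : 'I_n) :
  rV_cons (a, y + s *: delta_mx ord0 j) =
  rV_cons (a, y) + s *: delta_mx ord0 (lift ord0 j).
Proof.
apply/rowP => i; rewrite [RHS]mxE [X in _ = _ + X]mxE [X in _ = _ + _ * X]mxE.
case: (unliftP ord0 i) => [k ->|->].
  by rewrite !rV_consS /= !mxE /= (inj_eq lift_inj).
by rewrite !rV_cons0 /= mulr0 addr0.
Qed.

End cons.

Definition line n (i : 'I_n) (x : 'rV[R]_n) (s : R) := x + s *: delta_mx ord0 i.

(** Fubini, one coordinate at a time: the measure is built by adding a first coordinate, so the
    first direction is integrated innermost, and any other direction is left to the induction on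
    almost every slice. *)
Lemma integral_line0 n (i : 'I_n) (f : 'rV[R]_n -> R) :
  (lebesgue_rV n).-integrable setT (EFin \o f) ->
  (forall x : 'rV[R]_n, \int[leb]_s (f (line i x s))%:E = 0)%E ->
  (\int[lebesgue_rV n]_x (f x)%:E = 0)%E.
Proof.
elim: n i f => [[]//|n IH] i f fi f0; rewrite integral_rV_cons//.
have fi' := integrable_rV_cons fi.
case: (unliftP ord0 i) f0 => [j ->|->] f0.
  rewrite -(integral12_prod_meas1 fi').
  have ae0 : {ae leb, forall a, setT a -> fubini_F (lebesgue_rV n)
      (EFin \o (f \o @rV_cons R n)) a = 0%E}.
    apply: filterS (ae_integrable1 fi') => a /= fai _.
    rewrite /fubini_F /=; apply: (IH j (fun y => f (rV_cons (a, y)))) => // y.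
    by rewrite -[RHS](f0 (rV_cons (a, y))); apply: eq_integral => s _; rewrite /line rV_cons_line.
  rewrite (ae_eq_integral (cst 0%E)) ?integral0//.
  exact: (measurable_fubini_F fi').
rewrite -(integral21_prod_meas1 fi') (eq_integral (cst 0%E)) ?integral0// => y _.
rewrite /fubini_G /= -[RHS](f0 (rV_cons (0, y))); apply: eq_integral => a _.
by rewrite /line -rV_consE.
Qed.

(** Only lines that miss the origin are available. In the first direction almost every line
    qualifies, as {0} is null for the remaining coordinates; in another direction almost every slice
    has a nonzero first coordinate, and then all its lines qualify. *)
Lemma integral_line0_punctured n (i : 'I_n.+2) (f : 'rV[R]_n.+2 -> R) :
  (lebesgue_rV n.+2).-integrable setT (EFin \o f) ->
  (forall x : 'rV[R]_n.+2, (exists2 k, k != i & x ord0 k != 0%R) ->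
    \int[leb]_s (f (line i x s))%:E = 0)%E ->
  (\int[lebesgue_rV n.+2]_x (f x)%:E = 0)%E.
Proof.
move=> fi f0; rewrite integral_rV_cons//.
have fi' := integrable_rV_cons fi.
case: (unliftP ord0 i) f0 => [j ->|->] f0.
  rewrite -(integral12_prod_meas1 fi').
  have ae0 : {ae leb, forall a, setT a -> fubini_F (lebesgue_rV n.+1)
      (EFin \o (f \o @rV_cons R n.+1)) a = 0%E}.
    have aen0 : {ae leb, forall a : R, a != 0}.
      exists [set 0]; split => //; first exact: lebesgue_measure_set1.
      by move=> a /= /negP; rewrite negbK => /eqP.
    apply: filterS2 (ae_integrable1 fi') aen0 => a fai a0 _.
    rewrite /fubini_F /=; apply: (integral_line0 (i := j) (f := fun y => f (rV_cons (a, y)))) => // y.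
    rewrite -[RHS](f0 (rV_cons (a, y))); first by apply: eq_integral => s _; rewrite /line rV_cons_line.
    by exists ord0 => //; rewrite rV_cons0.
  rewrite (ae_eq_integral (cst 0%E)) ?integral0//.
  exact: (measurable_fubini_F fi').
rewrite -(integral21_prod_meas1 fi').
have ae0 : {ae lebesgue_rV n.+1, forall y : 'rV[R]_n.+1, setT y ->
    fubini_G leb (EFin \o (f \o @rV_cons R n.+1)) y = 0%E}.
  have aen0 : {ae lebesgue_rV n.+1, forall y : 'rV[R]_n.+1, y != 0}.
    exists [set 0]; split; [exact: measurable_set0_rV|exact: lebesgue_rV_set0|].
    by move=> a /= /negP; rewrite negbK => /eqP.
  apply: filterS aen0 => y y0 _.
  rewrite /fubini_G /= -[RHS](f0 (rV_cons (0, y))).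
    by apply: eq_integral => a _; rewrite /line -rV_consE.
  have /existsP[k yk] : [exists k, y ord0 k != 0].
    apply: contraR y0; rewrite negb_exists => /forallP y0.
    by apply/eqP/rowP => k; rewrite mxE; apply/eqP; move: (y0 k); rewrite negbK.
  by exists (lift ord0 k); rewrite ?rV_consS// eq_sym neq_lift.
rewrite (ae_eq_integral (cst 0%E)) ?integral0//.
exact: (measurable_fubini_G fi').
Qed.

End line_integrals.

(** * Integrability of |x|^-6 near the origin *)

Section riesz.
Context {R : realType}.

Lemma sum_geometric_half (z : R) N : 0 <= z <= 2^-1 -> \sum_(k < N) z ^+ k <= 2.
Proof.
move=> /andP[z0 z2]; suff : \sum_(k < N) z ^+ k <= 2 * (1 - z ^+ N).
  by move=> /le_trans; apply; have := exprn_ge0 N z0; lra.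
elim: N => [|N IH]; first by rewrite big_ord0 expr0 subrr mulr0.
rewrite big_ord_recr /= (le_trans (lerD IH (lexx _)))// exprS.
have := exprn_ge0 N z0; nra.
Qed.

Lemma dyadic (r : R) : 0 < r < 1 -> exists k : nat, 2^-1 ^+ k.+1 <= r < 2^-1 ^+ k.
Proof.
move=> /andP[r0 r1].
have ex : exists k, (2^-1 : R) ^+ k.+1 <= r.
  have [m rm] : exists m : nat, r^-1 < m%:R.
    by exists (Num.bound r^-1); rewrite archi_boundP// invr_ge0 ltW.
  exists m; rewrite exprVn -[leRHS]invrK lef_pV2 ?posrE ?exprn_gt0 ?invr_gt0//.
  rewrite (le_trans (ltW rm))// -natrX ler_nat (leq_trans (ltnW (@ltn_expl 2 m _)))//.
  by rewrite leq_exp2l.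
exists (ex_minn ex); case: ex_minnP => k rk kmin; rewrite rk /=.
case: k kmin rk => [|k] kmin rk; first by rewrite expr0.
by rewrite ltNge; apply/negP => /kmin; rewrite ltnn.
Qed.

(** Dyadic shells: where 2^-(k+1) <= |x| < 2^-k the integrand is at most 64 * 64^k, and the shell
    lies in a cube of volume 2^n * 2^(-kn). The resulting geometric series has ratio 64 * 2^-n,
    which is at most 1/2 exactly when n >= 7. *)
Lemma integrable_riesz n : (7 <= n)%N ->
  (\int[lebesgue_rV n]_(x in @unit_ball R n) ((enorm x)^-1 ^+ 6)%:E < +oo)%E.
Proof.
move=> n7; pose q : R := 2^-1.
have q0 : 0 < q by rewrite /q invr_gt0.
pose cube k := [set x : 'rV[R]_n | forall i, - q ^+ k < x ord0 i <= q ^+ k].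
pose d k : R := 64 * 64 ^+ k.
pose F k (x : 'rV[R]_n) : \bar R := (d k * \1_(cube k) x)%:E.
have mcube k : measurable (cube k) by exact: measurable_cube.
have mF k : measurable_fun setT (F k).
  by apply/measurable_EFinP; apply: measurable_funM.
have d0 k : 0 <= d k by rewrite mulr_ge0 ?exprn_ge0.
have F0 k x : (0 <= F k x)%E by rewrite lee_fin mulr_ge0.
apply: (@le_lt_trans _ _ (\int[lebesgue_rV n]_x (\sum_(k <oo) F k x))%E).
  rewrite integral_mkcond.
  apply: ge0_le_integral => //.
  - by move=> x _; rewrite patchE; case: ifP => // _; rewrite lee_fin exprn_ge0 ?invr_ge0 ?enorm_ge0.
  - apply/(measurable_restrictT _ (@measurable_unit_ball R n)).
    apply/measurable_EFinP; apply: measurable_fun_punctured; first exact: open_unit_ball.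
    move=> x _ x0; apply: (@continuous_comp _ _ _ (fun x : 'rV[R]_n => (enorm x)^-1)
      (fun y : R => y ^+ 6)); last exact: exprn_continuous.
    by apply: continuousV; [rewrite gt_eqF ?enorm_gt0|exact: continuous_enorm].
  - by apply: ge0_emeasurable_sum.
  - move=> x _; rewrite patchE; case: ifPn => [|_]; last exact: nneseries_ge0.
    rewrite inE /unit_ball /= => x1.
    (* At the origin the integrand is 0, because 0^-1 = 0; elsewhere a single term of the series
       dominates it. *)
    have [->|x0] := eqVneq x 0.
      by rewrite enorm0 invr0 expr0n /=; exact: nneseries_ge0.
    have [|k /andP[k1 k2]] := @dyadic (enorm x); first by rewrite enorm_gt0.
    apply: le_trans (nneseries_lim_ge k.+1 (fun n _ _ => F0 n x)).
    rewrite big_nat_recr//= (@le_trans _ _ (F k x))//; last first.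
      by rewrite leeDr//; apply: sume_ge0.
    have xc : cube k x.
      move=> i; have := le_lt_trans (ler_coord_enorm x i) k2.
      by rewrite ltr_norml => /andP[-> /ltW].
    rewrite /F lee_fin indicE mem_set// mulr1 /d -exprS.
    rewrite (_ : 64 = 2 ^+ 6 :> R) -?exprM; last by rewrite -natrX.
    rewrite mulnC exprM lerXn2r ?nnegrE ?invr_ge0 ?enorm_ge0 ?exprn_ge0//.
    by rewrite -[leRHS]invrK lef_pV2 ?posrE ?enorm_gt0 ?invr_gt0 ?exprn_gt0// -exprVn.
rewrite integral_nneseries//.
apply: (@le_lt_trans _ _ (64 * 2 ^+ n * 2)%:E); last exact: ltry.
apply: lime_le; first by apply: is_cvg_nneseries => *; exact: integral_ge0.
apply: nearW => N; rewrite big_mkord.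
have E k : (\int[lebesgue_rV n]_x F k x)%E = (64 * 2 ^+ n * (64 * q ^+ n) ^+ k)%:E.
  rewrite /F; under eq_integral do rewrite EFinM.
  rewrite ge0_integralZl_EFin//; last by apply/measurable_EFinP.
  rewrite integral_indic// setIT.
  transitivity ((d k)%:E * ((2 * q ^+ k) ^+ n)%:E)%E.
    by congr (_ * _)%E; apply: lebesgue_rV_cube_lty; rewrite exprn_ge0// ltW.
  by rewrite -EFinM /d !exprMn -!exprM [(n * k)%N]mulnC; congr (_%:E); ring.
under eq_bigr do rewrite E.
rewrite sumEFin lee_fin -mulr_sumr ler_wpM2l ?mulr_ge0 ?exprn_ge0//.
apply: sum_geometric_half; rewrite mulr_ge0 ?exprn_ge0 ?(ltW q0)//=.
apply: (@le_trans _ _ (64 * q ^+ 7)); last by rewrite /q; lra.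
by rewrite ler_wpM2l// ler_wiXn2l ?(ltW q0)// /q; lra.
Qed.

End riesz.

(** * Integration by parts across the origin *)

Section punctured_ball.
Context {R : realType} {n : nat}.
Implicit Types (f g : 'rV[R]_n -> R) (x y : 'rV[R]_n) (i j : 'I_n).
Local Notation B := (@unit_ball R n).

Definition axis i : 'rV[R]_n := delta_mx ord0 i.
Definition rho x : R := (enorm x)^-1.
Definition pball : set 'rV[R]_n := [set x | B x /\ x != 0].
(** Derivatives of order l <= m are O(|x|^-(k + l)) on the punctured ball; nothing is asked at the
    origin or outside the ball. The unit type is the trivial parameter space. *)
Definition psymbol m k f := symbol axis pball rho [set: unit] m k (fun=> f).

Lemma open_pball : open pball.
Proof.
rewrite (_ : pball = B `&` ~` [set 0]).
  apply: openI; first exact: open_unit_ball.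
  apply: closed_openC; apply: accessible_closed_set1.
  exact/hausdorff_accessible/norm_hausdorff.
by apply/seteqP; split=> x [xB /eqP x0].
Qed.

Lemma rho_ge1 x : pball x -> 1 <= rho x.
Proof.
by move=> [xB x0]; rewrite /rho invf_ge1 ?enorm_gt0// ltW.
Qed.

Lemma rho_gt0 x : pball x -> 0 < rho x.
Proof. by move=> xB; exact: lt_le_trans (rho_ge1 xB). Qed.

Lemma rho_ge0 x : 0 <= rho x.
Proof. by rewrite invr_ge0 enorm_ge0. Qed.

Lemma psymbol_bound m k f : psymbol m k f ->
  exists2 C, 0 <= C & forall x, pball x -> `|f x| <= C * rho x ^+ k.
Proof.
move=> /(symbol_bound rho_ge1)[C C0 fC]; exists C => // x.
by apply: (fC tt).
Qed.

Lemma psymbol_cont m k f x : psymbol m k f -> pball x -> {for x, continuous f}.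
Proof. by move=> sf xB; exact: (symbol_cont sf (t := tt)). Qed.

Lemma psymbol_derive m k f x i : psymbol m.+1 k f -> pball x ->
  is_derive x (axis i) f (partial i f x).
Proof. by move=> sf xB; exact: (symbol_derive i sf (t := tt)). Qed.

Lemma psymbol_partial m k f i : psymbol m.+1 k f -> psymbol m k.+1 (partial i f).
Proof. exact: (symbolD1 i). Qed.

Lemma psymbol_ext m k f g : (forall x, pball x -> f x = g x) ->
  psymbol m k f -> psymbol m k g.
Proof. by move=> fg; apply: (symbol_ext open_pball) => -[] x _; exact: fg. Qed.

Lemma psymbolM m k l f g : psymbol m k f -> psymbol m l g ->
  psymbol m (k + l) (fun x => f x * g x).
Proof. rewrite /psymbol => sf sg; exact: (symbolM open_pball rho_ge1 sf sg). Qed.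

Lemma psymbolW m k f : psymbol m.+1 k f -> psymbol m k f.
Proof. rewrite /psymbol => sf; exact: (symbolW open_pball rho_ge1 sf). Qed.

Lemma psymbol_order m l k f : (l <= m)%N -> psymbol m k f -> psymbol l k f.
Proof. rewrite /psymbol => lm sf; exact: (symbol_order open_pball rho_ge1 lm sf). Qed.

Lemma psymbol_degree m k l f : (k <= l)%N -> psymbol m k f -> psymbol m l f.
Proof. rewrite /psymbol => kl sf; exact: (symbol_degree open_pball rho_ge1 kl sf). Qed.

Lemma psymbolD m k f g : psymbol m k f -> psymbol m k g ->
  psymbol m k (fun x => f x + g x).
Proof. rewrite /psymbol => sf sg; exact: (symbolD open_pball rho_ge1 sf sg). Qed.

Lemma psymbolB m k f g : psymbol m k f -> psymbol m k g ->
  psymbol m k (fun x => f x - g x).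
Proof. rewrite /psymbol => sf sg; exact: (symbolB open_pball rho_ge1 sf sg). Qed.

Lemma psymbolN m k f : psymbol m k f -> psymbol m k (fun x => - f x).
Proof. rewrite /psymbol => sf; exact: (symbolN open_pball rho_ge1 sf). Qed.

Lemma psymbolZ m k c f : psymbol m k f -> psymbol m k (fun x => c * f x).
Proof. rewrite /psymbol => sf; exact: (symbolZ open_pball rho_ge1 c sf). Qed.

Lemma psymbol_const m k (c : R) : psymbol m k (fun=> c).
Proof. exact: (symbol_const _ open_pball rho_ge1). Qed.

Lemma psymbol_sum m k (f : 'I_n -> 'rV[R]_n -> R) :
  (forall i, psymbol m k (f i)) -> psymbol m k (fun x => \sum_i f i x).
Proof. by move=> sf; exact: (symbol_sum open_pball rho_ge1). Qed.

Lemma partial_ext f g i x : (forall y, pball y -> f y = g y) -> pball x ->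
  partial i f x = partial i g x.
Proof.
by move=> fg xB; apply: near_eq_derive; exact: (near_Omega open_pball).
Qed.

Lemma measurable_psymbol m k f : psymbol m k f -> measurable_fun B f.
Proof.
move=> sf; apply: measurable_fun_punctured; first exact: open_unit_ball.
by move=> x xB x0; apply: psymbol_cont sf _.
Qed.

End punctured_ball.

Section line_shift.
Context {R : realType} {n : nat}.

Lemma is_derive_along (G : 'rV[R]_n -> R) (x : 'rV[R]_n) i s d :
  is_derive (line i x s) (axis i) G d ->
  is_derive s (1 : R) (fun s => G (line i x s)) d.
Proof.
move=> /is_derive_line h.
have h2 : is_derive (s - s) (1 : R) (fun h : R => G (h *: axis i + line i x s)) d.
  by rewrite subrr.
have h1 : is_derive s (1 : R) (fun s' => s' - s) (1 : R).
  by apply: is_derive_eq; rewrite ?subr0.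
have := is_derive_chain h1 h2; rewrite mulr1.
congr is_derive; apply/funext => s' /=; congr G.
by rewrite /line /axis scalerBl addrCA subrK.
Qed.

Lemma continuous_line (x : 'rV[R]_n) i : continuous (line i x).
Proof.
move=> s; apply: (@continuousD _ _ _ (cst x) (fun s : R => s *: delta_mx ord0 i)).
  exact: cst_continuous.
exact: scalel_continuous.
Qed.

Lemma integral_line0_ge2 i (f : 'rV[R]_n -> R) : (1 < n)%N ->
  (lebesgue_rV n).-integrable setT (EFin \o f) ->
  (forall x : 'rV[R]_n, (exists2 k, k != i & x ord0 k != 0%R) ->
    \int[@lebesgue_measure R]_s (f (line i x s))%:E = 0)%E ->
  (\int[lebesgue_rV n]_x (f x)%:E = 0)%E.
Proof.
case: n i f => [//|[//|n']] i f _; exact: integral_line0_punctured.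
Qed.

End line_shift.

Section integration_by_parts.
Context {R : realType} {n : nat}.
Hypothesis n7 : (7 <= n)%N.
Implicit Types (f g : 'rV[R]_n -> R) (x y : 'rV[R]_n) (i j : 'I_n).
Local Notation mu := (@lebesgue_rV R n).
Local Notation B := (@unit_ball R n).

Let mB : measurable B := @measurable_unit_ball R n.

Lemma ae_pball : {ae mu, forall x, B x -> pball x}.
Proof.
exists [set 0]; split; first exact: measurable_set0_rV.
  by move: n7; case: (n) => // n' _; exact: lebesgue_rV_set0.
by move=> x /= /not_implyP[xB] /not_andP[//|/negP]; rewrite negbK => /eqP.
Qed.

Lemma Rintegral_pball f g : measurable_fun B f -> measurable_fun B g ->
  (forall x, pball x -> f x = g x) ->
  \int[mu]_(x in B) f x = \int[mu]_(x in B) g x.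
Proof.
move=> mf mg fg; congr fine; apply: ae_eq_integral => //; try exact/measurable_EFinP.
by apply: filterS ae_pball => x xB /xB /fg /= ->.
Qed.

Lemma integrable_rho6 : mu.-integrable B (EFin \o (fun x => rho x ^+ 6)).
Proof.
apply/integrableP; split.
  apply/measurable_EFinP; apply: measurable_fun_punctured; first exact: open_unit_ball.
  move=> x _ x0; apply: (@continuous_comp _ _ _ (fun x : 'rV[R]_n => (enorm x)^-1)
    (fun y : R => y ^+ 6)); last exact: exprn_continuous.
  by apply: continuousV; [rewrite gt_eqF ?enorm_gt0|exact: continuous_enorm].
apply: le_lt_trans (integrable_riesz n7); rewrite le_eqVlt; apply/orP; left.
by apply/eqP; apply: eq_integral => x _ /=; rewrite ger0_norm// exprn_ge0// rho_ge0.
Qed.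

Lemma integrable_psymbol m k f : (k <= 6)%N -> psymbol m k f ->
  mu.-integrable B (EFin \o f).
Proof.
move=> k6 /(psymbol_degree k6) sf.
have [C C0 fC] := psymbol_bound sf.
(* The bound says nothing at the origin; there [f] is replaced by 0, so that the domination by
   [C * rho x ^+ 6] holds on the whole ball. *)
pose g x := if x == 0 then 0 else f x.
have fg x : pball x -> f x = g x by move=> [_ /negbTE x0]; rewrite /g x0.
have mf := measurable_psymbol sf.
have mg := measurable_psymbol (psymbol_ext fg sf).
have : mu.-integrable B (EFin \o g).
  apply: (le_integrable mB _ _ (integrableZl mB C integrable_rho6)).
    exact/measurable_EFinP.
  move=> x xB; rewrite [X in (_ <= `|X|)%E]/= -EFinM /= lee_fin /g; case: eqVneq => [_|x0].
    by rewrite normr0.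
  by rewrite (le_trans (fC _ _))// ler_norm.
move=> /integrableP[_ gi]; apply/integrableP; split; first exact/measurable_EFinP.
apply: le_lt_trans gi; rewrite le_eqVlt; apply/orP; left; apply/eqP.
apply: ge0_ae_eq_integral => //.
- by apply: measurableT_comp => //; exact/measurable_EFinP.
- by apply: measurableT_comp => //; exact/measurable_EFinP.
by apply: filterS ae_pball => x xB /xB /fg /= ->.
Qed.

Lemma Rintegral_psymbol_eq k m f g : psymbol m k f -> (forall x, pball x -> f x = g x) ->
  \int[mu]_(x in B) f x = \int[mu]_(x in B) g x.
Proof.
move=> sf fg; apply: (Rintegral_pball _ _ fg); first exact: measurable_psymbol sf.
apply: measurable_psymbol.
exact: psymbol_ext fg sf.
Qed.

(** The set [K] may contain the origin, so [f] may be singular inside its support. Along a line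
    missing the origin the extension of [f] by 0 is C^1 with compact support, and its derivative
    integrates to 0; degree 5 makes [partial i f] integrable, which Fubini requires. *)
Lemma integral_partial_eq0 f i (K : set 'rV[R]_n) : psymbol 1 5 f ->
  compact K -> K `<=` B -> (forall x, pball x -> ~ K x -> f x = 0) ->
  \int[mu]_(x in B) partial i f x = 0.
Proof.
move=> sf cK KB f0.
have sdf := psymbol_partial i sf.
have oKc : open (~` K).
  by apply: closed_openC; apply: compact_closed => //; exact: norm_hausdorff.
pose G x := if `[< pball x >] then f x else 0.
pose g x := if `[< pball x >] then partial i f x else 0.
have fG x : pball x -> f x = G x by move=> xB; rewrite /G asboolT.
have dg x : pball x -> partial i f x = g x by move=> xB; rewrite /g asboolT.
have G0 x : x != 0 -> ~ K x -> G x = 0.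
  by move=> x0 Kx; rewrite /G; case: ifP => // /asboolP xB; exact: f0.
have near0 x : x != 0 -> ~ K x -> \forall y \near x, y != 0 /\ ~ K y.
  move=> x0 Kx; have oK : open (~` K `&` ~` [set 0]).
    apply: openI => //; apply: closed_openC; apply: accessible_closed_set1.
    exact/hausdorff_accessible/norm_hausdorff.
  have nK : open_nbhs x (~` K `&` ~` [set 0]).
    by split=> //; split=> // /eqP; apply/negP.
  by apply: filterS (open_nbhs_nbhs nK) => y [Ky /eqP y0]; split => //; apply/eqP.
have g0 x : x != 0 -> ~ K x -> g x = 0.
  move=> x0 Kx; rewrite /g; case: ifP => // /asboolP xB.
  rewrite /partial (@near_eq_derive _ _ _ _ (cst 0)) ?derive_cst//.
  apply: filterS2 (near0 _ x0 Kx) (Omega_near open_pball xB) => y [y0 Ky] yB.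
  exact: f0.
have dG x : x != 0 -> is_derive x (axis i) G (g x).
  move=> x0; have [Kx|Kx] := pselect (K x).
    have xB : pball x by split => //; exact: KB.
    apply: (@near_eq_is_derive _ _ _ f); first exact: near_Omega open_pball _ _ _ xB fG.
    by rewrite -dg//; exact: psymbol_derive sf xB.
  rewrite g0//; apply: (near_eq_is_derive _ (is_derive_cst (0 : R) x (axis i))).
  by apply: filterS (near0 _ x0 Kx) => y [y0 Ky]; rewrite G0.
have cg x : x != 0 -> {for x, continuous g}.
  move=> x0; have [Kx|Kx] := pselect (K x).
    have xB : pball x by split => //; exact: KB.
    apply: (@near_continuous _ _ (partial i f)); first exact: near_Omega open_pball _ _ _ xB dg.
    exact: psymbol_cont sdf xB.
  apply: (@near_continuous _ _ (cst 0)); last exact: cst_continuous.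
  by apply: filterS (near0 _ x0 Kx) => y [y0 Ky]; rewrite g0.
have sg : psymbol 0 6 g := psymbol_ext dg sdf.
have outB x : ~ B x -> G x = 0 /\ g x = 0.
  by move=> xB; rewrite /G /g asboolF// => -[].
have ig : mu.-integrable setT (EFin \o g).
  have := integrable_psymbol (leqnn 6) sg.
  rewrite integrable_mkcond//; congr integrable; apply/funext => x; rewrite patchE.
  by case: ifPn => //; rewrite notin_setE => /outB[_ /= ->].
rewrite (Rintegral_psymbol_eq sdf dg) /Rintegral.
rewrite integral_mkcond [X in fine X](_ : _ = 0%E)//.
transitivity (\int[mu]_x (g x)%:E)%E.
  apply: eq_integral => x _; rewrite patchE; case: ifPn => //.
  by rewrite notin_setE => /outB[_ /= ->].
have line0 x : (exists2 k, k != i & x ord0 k != 0) ->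
    (\int[@lebesgue_measure R]_s (g (line i x s))%:E = 0)%E.
  move=> [k ki xk].
  have ln0 s : line i x s != 0.
    apply: contra xk => /eqP /rowP /(_ k); rewrite !mxE eqxx /= (negbTE ki) mulr0 addr0.
    by move=> ->.
  (* For |s| >= |x_i| + 1 the i-th coordinate of the point is at least 1 in absolute value, so the
     point is outside the ball. *)
  apply: (@integral_derive_compact _ (fun s => G (line i x s)) _ (`|x ord0 i| + 1)).
  - by rewrite ltr_wpDl.
  - by move=> s; apply: is_derive_along; exact: dG.
  - move=> s; apply: continuous_comp; [exact: continuous_line|exact: cg].
  - move=> s sx; apply: outB => /(le_lt_trans (ler_coord_enorm _ i)).
    rewrite !mxE !eqxx mulr1; apply/negP; rewrite -leNgt.
    have := ler_normB (x ord0 i + s) (x ord0 i).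
    rewrite (_ : x ord0 i + s - x ord0 i = s); [lra|ring].
exact: (integral_line0_ge2 (ltnW (ltnW (ltnW (ltnW (ltnW n7))))) ig line0).
Qed.

Lemma partialM m k l f g i x : psymbol m.+1 k f -> psymbol m.+1 l g -> pball x ->
  partial i (fun y => f y * g y) x = f x * partial i g x + partial i f x * g x.
Proof.
move=> sf sg xB.
by have [_ <-] := is_deriveM' (psymbol_derive i sf xB) (psymbol_derive i sg xB).
Qed.

Lemma integral_partial_by_parts k l f g i (K : set 'rV[R]_n) : (k + l <= 5)%N ->
  psymbol 1 k f -> psymbol 1 l g ->
  compact K -> K `<=` B -> (forall x, pball x -> ~ K x -> g x = 0) ->
  \int[mu]_(x in B) (f x * partial i g x) = - \int[mu]_(x in B) (partial i f x * g x).
Proof.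
move=> kl sf sg cK KB g0; apply/eqP; rewrite -addr_eq0; apply/eqP.
have sfg := psymbolM sf sg.
have s1 := psymbolM (psymbolW sf) (psymbol_partial i sg).
have s2 := psymbolM (psymbol_partial i sf) (psymbolW sg).
rewrite addnS in s1; rewrite addSn in s2.
rewrite -RintegralD//; [|exact: integrable_psymbol s1|exact: integrable_psymbol s2].
rewrite -(integral_partial_eq0 i (psymbol_degree kl sfg) cK KB); last first.
  by move=> x xB Kx; rewrite g0// mulr0.
apply/esym; apply: (Rintegral_psymbol_eq (psymbol_partial i sfg)) => x xB.
exact: partialM sf sg xB.
Qed.

End integration_by_parts.

(** * Test functions and the fundamental lemma *)

Section quadratic_remainder.
Context {R : realType}.

(** A derivative read off a quadratic remainder. This serves where no differentiation rule applies:
    [flat] at 0, and integrals depending on a parameter. *)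
Lemma is_derive_quadratic (f : R -> R) (s d C e : R) : 0 < e ->
  (forall h, `|h| < e -> `|f (s + h) - f s - h * d| <= C * h ^+ 2) ->
  is_derive s (1 : R) f d.
Proof.
move=> e0 fC.
have cv : h^-1 *: (f (h *: 1 + s) - f s) @[h --> (0 : R)^'] --> d.
  apply/cvgrPdist_le => r r0.
  have D0 : 0 < `|C| + 1 by rewrite ltr_wpDl.
  have m0 : 0 < Num.min e (r / (`|C| + 1)) by rewrite lt_min e0 divr_gt0.
  near=> h.
  have h0 : h != 0 by near: h; exact: nbhs_dnbhs_neq.
  have hm : `|h| < Num.min e (r / (`|C| + 1)).
    by near: h; apply: dnbhs0_lt.
  move: hm; rewrite lt_min => /andP[he hr].
  have := fC h he; rewrite [h *: 1]mulr1 [h + s]addrC.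
  have -> : d - h^-1 *: (f (s + h) - f s) = - h^-1 * (f (s + h) - f s - h * d).
    by rewrite -[_ *: _]/(_ * _); field.
  rewrite normrM normrN normfV => H.
  rewrite ler_pdivrMl ?normr_gt0//; apply: le_trans H _.
  rewrite -real_normK ?num_real// expr2 mulrA [_ * `|h|]mulrC ler_wpM2l//.
  rewrite (le_trans (ler_wpM2r _ (ler_norm C)))// mulrC.
  move: hr; rewrite ltr_pdivlMr// mulrDr mulr1 => /ltW; apply: le_trans.
  by rewrite lerDl.
apply: DeriveDef; first by apply/cvg_ex; exists d.
exact/cvg_lim.
Unshelve. all: by end_near. Qed.

Lemma exprn_le_expR k (y : R) : 0 <= y -> y ^+ k <= k%:R ^+ k * expR y.
Proof.
case: k => [|k] y0; first by rewrite !expr0 mul1r (le_trans _ (expR_ge1Dx _))// lerDl.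
have k0 : (0 : R) < k.+1%:R by rewrite ltr0n.
have h1 : y / k.+1%:R <= expR (y / k.+1%:R).
  by apply: le_trans (expR_ge1Dx _); rewrite lerDr.
have : (y / k.+1%:R) ^+ k.+1 <= expR (y / k.+1%:R) ^+ k.+1.
  by rewrite lerXn2r// nnegrE ?divr_ge0 ?expR_ge0// ltW.
rewrite -expRM_natr divfK ?gt_eqF// expr_div_n ler_pdivrMr ?exprn_gt0//.
by rewrite mulrC.
Qed.

End quadratic_remainder.

Lemma is_deriveX' {R : realType} {V : normedModType R} (f : V -> R) x v (d : R) k :
  is_derive x v f d -> is_derive x v (fun y => f y ^+ k.+1) (k.+1%:R * f x ^+ k * d).
Proof.
move=> df; elim: k => [|k IH]; first by rewrite expr0 mulr1 mul1r.
have -> : (fun y => f y ^+ k.+2) = (fun y => f y * f y ^+ k.+1).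
  by apply/funext => y; rewrite exprS.
apply: (is_derive_eq (is_deriveM' df IH)).
by rewrite -[k.+2%:R]natr1 !exprS; ring.
Qed.

Section flat_function.
Context {R : realType}.

(* [flat 0] is the standard smooth function [exp (- 1 / x)] vanishing on the
   half line [x <= 0]; the other [flat k] span its derivatives. *)
Definition flat (k : nat) (x : R) : R :=
  if 0 < x then x^-1 ^+ k * expR (- x^-1) else 0.

Lemma flat_ge0 k x : 0 <= flat k x.
Proof.
by rewrite /flat; case: ifP => // x0; rewrite mulr_ge0 ?expR_ge0// exprn_ge0// invr_ge0 ltW.
Qed.

Lemma flat_eq0 k x : x <= 0 -> flat k x = 0.
Proof. by move=> x0; rewrite /flat ltNge x0. Qed.

Lemma flat_le k x : flat k x <= k%:R ^+ k.
Proof.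
rewrite /flat; case: ifPn => [x0|_]; last by rewrite exprn_ge0.
rewrite expRN ler_pdivrMr ?expR_gt0//; apply: exprn_le_expR.
by rewrite invr_ge0 ltW.
Qed.

(** For positive x, [flat k x] is x^2 times [flat k.+2 x], and the latter is bounded. This quadratic
    contact gives the zero derivative at 0. *)
Lemma flat_le_sqr k x : flat k x <= k.+2%:R ^+ k.+2 * x ^+ 2.
Proof.
rewrite {1}/flat; case: ifPn => [x0|_]; last by rewrite mulr_ge0 ?sqr_ge0// exprn_ge0.
have := flat_le k.+2 x; rewrite /flat x0 => H.
rewrite -ler_pdivrMr ?exprn_gt0//; apply: le_trans H; rewrite le_eqVlt; apply/orP; left.
apply/eqP; rewrite !exprS; field; lra.
Qed.

Lemma is_derive_flat k (x : R) :
  is_derive x (1 : R) (flat k) (flat k.+2 x - k%:R * flat k.+1 x).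
Proof.
have [x0|x0|->] := ltgtP x 0.
- rewrite /flat ltNge (ltW x0) /= mulr0 subr0.
  apply: (near_eq_is_derive _ (is_derive_cst (0 : R) x (1 : R))).
  by near=> y; rewrite ltNge ltW//=; near: y; exact: lt_nbhsl.
- have dinv : is_derive x (1 : R) (fun y : R => y^-1) (- x^-1 ^+ 2).
    have := is_deriveV' (f := id) _ (is_derive_id x (1 : R)); rewrite gt_eqF// => /(_ isT).
    by rewrite mulN1r -expr2.
  have dexp : is_derive x (1 : R) (fun y : R => expR (- y^-1)) (expR (- x^-1) * x^-1 ^+ 2).
    have := is_derive_chain (is_deriveN dinv) (is_derive_expR (- x^-1)).
    by rewrite opprK.
  have dX : is_derive x (1 : R) (fun y : R => y^-1 ^+ k) (- (k%:R * x^-1 ^+ k.+1)).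
    case: k => [|k]; first by rewrite mul0r oppr0; exact: is_derive_cst.
    by apply: (is_derive_eq (is_deriveX' k dinv)); rewrite !exprS; ring.
  have := is_deriveM' dX dexp.
  move=> h; have /near_eq_is_derive /(_ h) : \forall y \near x,
      y^-1 ^+ k * expR (- y^-1) = flat k y.
    by near=> y; rewrite /flat ifT//; near: y; exact: lt_nbhsr.
  by move/is_derive_eq; apply; rewrite /flat x0 !exprS; ring.
- apply: (@is_derive_quadratic _ _ _ _ (k.+2%:R ^+ k.+2) 1) => // h _.
  have f0 j : flat j 0 = 0 by exact: flat_eq0.
  rewrite !f0 mulr0 !subr0 mulr0 subr0 add0r.
  by rewrite ger0_norm ?flat_ge0// flat_le_sqr.
Unshelve. all: by end_near. Qed.

Lemma symbol1_flat m k : symbol1 m (flat k).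
Proof.
have bnd k' : exists C, forall (t : unit) x, setT t -> setT x ->
    `|flat k' x| <= C * (1 : R) ^+ 0.
  by exists (k'%:R ^+ k') => _ x _ _; rewrite ger0_norm ?flat_ge0// mulr1 flat_le.
have cnt k' (x : R) : {for x, continuous (flat k')}.
  apply: differentiable_continuous; apply/derivable1_diffP.
  by have [] := is_derive_flat k' x.
have oT := @openT R; have w1 := @symbol1_le1 R.
elim: m k => [|m IH] k; first by split => // t x _ _; exact: cnt.
apply: symbolS_intro => //.
move=> _; exists (fun _ x => flat k.+2 x - k%:R * flat k.+1 x).
  by move=> _ x _ _; exact: is_derive_flat.
apply: (symbol_degree oT w1 (leq0n 1)).
by apply: symbolB => //; [exact: IH|apply: symbolZ => //; exact: IH].
Qed.

Lemma flat0_cvg (c : R) : 0 < c -> flat 0 (k%:R * c) @[k --> \oo] --> (1 : R).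
Proof.
move=> c0.
have h : (fun k : nat => expR (- (k.+1%:R * c)^-1)) @ \oo --> (1 : R).
  rewrite -[X in _ --> X]expR0; apply: continuous_cvg; first exact: continuous_expR.
  have : (fun k => k.+1%:R^-1 * c^-1) @ \oo --> 0 * c^-1.
    by apply: cvgM; [exact: cvg_harmonic|exact: cvg_cst].
  move=> /cvgN; rewrite mul0r oppr0; apply: cvg_trans; apply: near_eq_cvg.
  by apply: nearW => k; rewrite /= invfM.
rewrite -cvg_shiftS; apply: cvg_trans h; apply: near_eq_cvg.
by apply: nearW => k; rewrite /= /flat mulr_gt0 ?ltr0n// expr0 mul1r.
Unshelve. all: by end_near. Qed.

Lemma flat0_le1 x : flat 0 x <= 1.
Proof. by have := flat_le 0 x; rewrite expr0. Qed.

Lemma flat_gt0 k x : 0 < x -> 0 < flat k x.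
Proof. by move=> x0; rewrite /flat x0 mulr_gt0 ?expR_gt0// exprn_gt0// invr_gt0. Qed.

End flat_function.

Section test_functions.
Context {R : realType} {n : nat}.
Implicit Types (f g phi : 'rV[R]_n -> R) (x y : 'rV[R]_n) (i j : 'I_n).
Local Notation B := (@unit_ball R n).

(* Symbols on the whole space with trivial weight: all derivatives up to order
   [m] are bounded. *)
Definition bsymbol m f :=
  symbol axis setT (fun=> 1 : R) [set: unit] m 0 (fun=> f).

Let oT : open [set: 'rV[R]_n] := openT.
Let w1 (x : 'rV[R]_n) : [set: 'rV[R]_n] x -> 1 <= (fun=> 1 : R) x.
Proof. by []. Qed.

Lemma bsymbol_psymbol m f : bsymbol m f -> psymbol m 0 f.
Proof.
by apply: symbol_restrict => // x xB; rewrite ler01 rho_ge1.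
Qed.

Lemma bsymbol_smooth f : (forall m, bsymbol m f) -> smooth f.
Proof.
move=> sf.
have si s : forall m, symbol axis setT (fun=> 1 : R) [set: unit] m (size s)
    (fun=> iter_partial s f).
  elim: s => [|i s IH] m /=; first exact: sf.
  exact: (symbolD1 i (IH m.+1)).
move=> s; split=> [x|x i].
  by apply: (symbol_cont (si s 0) (t := tt)).
by have [+ _] := symbol_derive i (si s 1) (t := tt) (x := x) I I.
Qed.

Lemma partial_test phi i : test_function phi -> test_function (partial i phi).
Proof.
move=> [sphi [K [cK KB phi0]]]; split.
  move=> s; have := sphi (rcons s i); rewrite /iter_partial foldr_rcons.
  by [].
exists K; split=> // x Kx.
rewrite /partial (@near_eq_derive _ _ _ _ (cst 0)) ?derive_cst//.
have oKc : open (~` K).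
  by apply: closed_openC; apply: compact_closed => //; exact: norm_hausdorff.
by apply: filterS (open_nbhs_nbhs (conj oKc Kx)) => y; exact: phi0.
Qed.

Lemma test_bsymbol m phi : test_function phi -> bsymbol m phi.
Proof.
have bnd phi' : test_function phi' -> exists C, forall (t : unit) x, setT t -> setT x ->
    `|phi' x| <= C * (1 : R) ^+ 0.
  move=> [sphi [K [cK KB phi0]]].
  have [cphi _] := sphi [::].
  have : compact (phi' @` K).
    by apply: continuous_compact => //; exact: continuous_subspaceT.
  move=> /compact_bounded[M [_ HM]]; exists (`|M| + 1) => _ x _ _; rewrite mulr1.
  have M1 : 0 < `|M| + 1 by rewrite ltr_wpDl.
  have [Kx|Kx] := pselect (K x); last by rewrite phi0// normr0 ltW.
  by apply: HM; [rewrite (le_lt_trans (ler_norm M))// ltrDl|exists x].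
elim: m phi => [|m IH] phi tphi.
  split; [exact: bnd| |by []].
  by move=> _ x _ _; have [+ _] := tphi.1 [::]; exact.
apply: symbolS_intro => //; first exact: bnd.
  by move=> _ x _ _; have [+ _] := tphi.1 [::]; exact.
move=> i; exists (fun _ => partial i phi).
  by move=> _ x _ _; have [_ d] := tphi.1 [::]; apply: derivableP; exact: d.
by apply: (symbol_degree oT w1 (leq0n 1)); apply: IH; exact: partial_test.
Qed.

Lemma test_psymbol m phi : test_function phi -> psymbol m 0 phi.
Proof. by move=> /(test_bsymbol m)/bsymbol_psymbol. Qed.

Lemma bsymbolM m f g : bsymbol m f -> bsymbol m g -> bsymbol m (fun x => f x * g x).
Proof. by rewrite /bsymbol => sf sg; exact: (symbolM00 oT w1 sf sg). Qed.

Lemma bsymbol_comp_coord m F i : (forall m, symbol1 m F) ->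
  bsymbol m (fun x => F (x ord0 i)).
Proof.
move=> sF; apply: (symbol_comp (f := fun x : 'rV[R]_n => x ord0 i) oT w1 _ sF).
  by move=> x _; exact: coord_continuous.
move=> j; exists (fun=> (j == i)%:R) => [x _|m']; last exact: symbol_const.
apply/is_derive_line.
have -> : (fun h : R => (h *: axis j + x) ord0 i) =
    (fun h : R => (j == i)%:R * h + x ord0 i).
  by apply/funext => h; rewrite !mxE eqxx /= eq_sym mulrC.
apply: is_derive_eq; rewrite addr0 -[_ *: _]/(_ * _) mulr1.
by [].
Qed.

Definition closed_box (a b : 'I_n -> R) : set 'rV[R]_n :=
  [set x | forall i, a i <= x ord0 i <= b i].

Lemma compact_closed_box (a b : 'I_n -> R) : compact (closed_box a b).
Proof.
have := @rV_compact R n (fun i => `[a i, b i]%classic) (fun i => @segment_compact R (a i) (b i)).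
by congr compact; apply/seteqP; split=> x /= H i; have := H i; rewrite /= in_itv.
Qed.

(** Since [flat 0] tends to 1 at infinity, these functions converge to the indicator of the open box
    as [k] grows, while vanishing outside one fixed closed box. *)
Definition box_bump (a b : 'I_n -> R) (k : R) x : R :=
  \prod_i (flat 0 (k * (x ord0 i - a i)) * flat 0 (k * (b i - x ord0 i))).

Lemma symbol1_affine F m (c d : R) : (forall m, symbol1 m F) ->
  symbol1 m (fun y : R => F (c * y + d)).
Proof.
move=> sF.
apply: (@symbol_comp _ R unit (fun=> 1 : R) setT (fun=> 1 : R) (@openT R) (@symbol1_le1 R)
  (fun y : R => c * y + d) unit setT m F) => [//||].
- move=> y _; apply: (@continuousD _ _ _ (fun y : R => c * y) (cst d)).
    by apply: continuousM; [exact: cst_continuous|exact: id].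
  exact: cst_continuous.
- move=> _; exists (fun=> c) => [y _|m']; last exact: (symbol_const _ (@openT R)).
  by apply: is_derive_eq; rewrite addr0 -[_ *: _]/(_ * _) mulr1.
Qed.

Lemma symbol1_flat_affine m (c d : R) : symbol1 m (fun y : R => flat 0 (c * y + d)).
Proof. by apply: symbol1_affine => m'; exact: symbol1_flat. Qed.

Lemma box_bump_test a b (k : R) : 0 <= k -> closed_box a b `<=` B ->
  test_function (box_bump a b k).
Proof.
move=> k0 abB; split.
  apply: bsymbol_smooth => m; rewrite /box_bump.
  elim: (index_enum 'I_n) => [|i s IH].
    apply: (symbol_ext oT) (symbol_const _ oT w1 m 0 (1 : R)) => _ x _ _.
    by rewrite big_nil.
  have sa : bsymbol m (fun x => flat 0 (k * (x ord0 i - a i))).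
    apply: (symbol_ext oT) (bsymbol_comp_coord m i (fun m => symbol1_flat_affine m k (- (k * a i)))).
    by move=> _ x _ _; congr flat; ring.
  have sb : bsymbol m (fun x => flat 0 (k * (b i - x ord0 i))).
    apply: (symbol_ext oT) (bsymbol_comp_coord m i (fun m => symbol1_flat_affine m (- k) (k * b i))).
    by move=> _ x _ _; congr flat; ring.
  apply: (symbol_ext oT) (bsymbolM (bsymbolM sa sb) IH) => _ x _ _.
  by rewrite big_cons.
exists (closed_box a b); split => //; first exact: compact_closed_box.
move=> x /= /existsNP[i /negP]; rewrite negb_and -!ltNge => abx.
rewrite /box_bump (bigD1 i)//=; case/orP: abx => abx.
  by rewrite flat_eq0 ?mul0r// mulr_ge0_le0// subr_le0 ltW.
by rewrite [X in _ * X * _]flat_eq0 ?mulr0 ?mul0r// mulr_ge0_le0// subr_le0 ltW.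
Qed.

Lemma box_bump_itv a b k x : 0 <= box_bump a b k x <= 1.
Proof.
rewrite /box_bump; elim: (index_enum 'I_n) => [|i s /andP[IH0 IH1]].
  by rewrite big_nil ler01 lexx.
by rewrite big_cons !mulr_ge0 ?flat_ge0//= !mulr_ile1 ?mulr_ge0 ?flat_ge0 ?flat0_le1.
Qed.

Lemma box_bump_cvg a b x :
  box_bump a b k%:R x @[k --> \oo] --> (\1_(open_box a b) x : R).
Proof.
have [xab|xab] := pselect (open_box a b x).
  rewrite indicE mem_set// /box_bump; elim: (index_enum 'I_n) => [|i s IH].
    by under eq_fun do rewrite big_nil; exact: cvg_cst.
  have /andP[ax xb] := xab i.
  have A : flat 0 (k%:R * (x ord0 i - a i)) * flat 0 (k%:R * (b i - x ord0 i))
      @[k --> \oo] --> (1 * 1 : R).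
    by apply: cvgM; apply: flat0_cvg; rewrite subr_gt0.
  under eq_fun do rewrite big_cons.
  have E : (true%:R : R) = 1 * 1 * true%:R by rewrite !mul1r.
  by rewrite [X in nbhs X]E; exact: cvgM A IH.
rewrite indicE memNset//=.
move: xab => /existsNP[i /negP]; rewrite negb_and -!leNgt => abx.
rewrite (_ : (fun k : nat => _) = cst 0); first exact: cvg_cst.
apply/funext => k; rewrite /box_bump (bigD1 i)//=; case/orP: abx => abx.
  by rewrite flat_eq0 ?mul0r// mulr_ge0_le0// subr_le0.
by rewrite [X in _ * X * _]flat_eq0 ?mulr0 ?mul0r// mulr_ge0_le0// subr_le0.
Qed.

End test_functions.

Section fundamental_lemma.
Context {R : realType} {n : nat}.
Implicit Types (f g phi : 'rV[R]_n -> R) (x y : 'rV[R]_n) (i j : 'I_n).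
Local Notation mu := (@lebesgue_rV R n).
Local Notation B := (@unit_ball R n).

Let mB : measurable B := @measurable_unit_ball R n.

Definition boxes : set (set 'rV[R]_n) := [set A | exists a b, A = open_box a b].

Lemma measurable_boxes : @measurable _ 'rV[R]_n = <<s boxes>>.
Proof.
apply/seteqP; split; last first.
  apply: smallest_sub; first exact: sigma_algebra_measurable.
  by move=> _ [a [b ->]]; exact: measurable_open_box.
apply: smallest_sub; first exact: smallest_sigma_algebra.
move=> A; rewrite -bigcup_seq => -[i _ [Y mY <-]].
have : @measurable_fun _ _ (g_sigma_algebraType boxes) (measurableTypeR R) setT (rV_coord i).
  apply: (measurability _ (measurable_realfun.RGenOInfty.measurableE R)).
  move=> /= _ [_ [c ->]] <-; rewrite setTI.
  pose F (k : nat) : set 'rV[R]_n :=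
    open_box (fun j => if j == i then c else - k%:R) (fun=> k%:R).
  have -> : rV_coord i @^-1` `]c, +oo[ = \bigcup_k F k.
    apply/seteqP; split=> x /=; rewrite ?in_itv/= ?andbT; last first.
      by move=> [k _ /(_ i)]; rewrite eqxx /rV_coord => /andP[].
    move=> cx; pose M := \sum_j `|x ord0 j|.
    have xM j : `|x ord0 j| <= M.
      by rewrite /M (bigD1 j)//= lerDl sumr_ge0.
    have [k kM] : exists k : nat, M < k%:R.
      by exists (Num.bound M); rewrite archi_boundP// sumr_ge0.
    exists k => // j; have := le_lt_trans (xM j) kM.
    rewrite ltr_norml => /andP[? ->]; rewrite andbT; case: eqP => // ->.
    exact: cx.
  apply: bigcupT_measurable => k; apply: sub_sigma_algebra.
  by exists (fun j => if j == i then c else - k%:R), (fun=> k%:R).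
by move=> /(_ measurableT _ mY).
Qed.

Lemma boxes_setI : setI_closed boxes.
Proof.
move=> _ _ [a [b ->]] [c [d ->]].
exists (fun i => Num.max (a i) (c i)), (fun i => Num.min (b i) (d i)).
apply/seteqP; split=> x /=.
  move=> [ab cd] i; rewrite gt_max lt_min.
  by have /andP[-> ->] := ab i; have /andP[-> ->] := cd i.
move=> H; split=> i; have := H i; rewrite gt_max lt_min.
  by move=> /andP[/andP[-> _] /andP[-> _]].
by move=> /andP[/andP[_ ->] /andP[_ ->]].
Qed.

Lemma test_continuous phi : test_function phi -> continuous phi.
Proof. by move=> [/(_ [::])[]]. Qed.

Lemma test_measurable phi : test_function phi -> measurable_fun B phi.
Proof.
move=> tphi; apply: continuous_measurable_fun_rV; first exact: open_unit_ball.
by move=> x _; exact: test_continuous.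
Qed.

Lemma integrable_mul_test f phi : locally_integrable_ball f -> test_function phi ->
  mu.-integrable B (EFin \o (fun x => f x * phi x)).
Proof.
move=> [mf fK] tphi; have mphi := test_measurable tphi.
have [C C0 phiC] := symbol_bound (fun _ _ => lexx _) (test_bsymbol 0 tphi).
have [_ [K [cK KB phi0]]] := tphi.
have mK : measurable K := compact_measurable_rV cK.
apply/integrableP; split; first by apply/measurable_EFinP; exact: measurable_funM.
rewrite (_ : (\int[mu]_(x in B) _)%E = (\int[mu]_(x in K) `|(f x * phi x)%:E|)%E); last first.
  rewrite -[in RHS](setIidr KB) integral_mkcondr; apply: eq_integral => x _ /=.
  by rewrite patchE; case: ifPn => //; rewrite notin_setE => /phi0 ->; rewrite mulr0 normr0.
apply: (@le_lt_trans _ _ (C%:E * \int[mu]_(x in K) `|f x|%:E)%E); last first.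
  by apply: lte_mul_pinfty => //; exact: fK.
have mfK : measurable_fun K f by apply: measurable_funS mf.
rewrite -ge0_integralZl_EFin//; last first.
  by apply/measurable_EFinP; exact: measurableT_comp.
apply: ge0_le_integral => //.
- apply: measurableT_comp => //; apply/measurable_EFinP; apply: measurable_funM => //.
  exact: measurable_funS mphi.
- by apply/measurable_EFinP; apply: measurable_funM => //; exact: measurableT_comp.
- move=> x Kx; rewrite /= lee_fin normrM mulrC ler_wpM2r//.
  by have := phiC tt x I I; rewrite expr0 mulr1.
Qed.

(** The box bumps are tested against [g]. Dominated convergence applies because they stay below 1
    and vanish outside one compact box, on which [g] is integrable. *)
Lemma integral_box_eq0 g (a b : 'I_n -> R) : locally_integrable_ball g ->
  (forall phi, test_function phi -> \int[mu]_(x in B) (g x * phi x) = 0) ->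
  closed_box a b `<=` B -> (\int[mu]_(x in open_box a b) (g x)%:E = 0)%E.
Proof.
move=> lg gphi abB; have [mg gK] := lg.
have tb k := box_bump_test (ler0n _ k) abB.
have cQ := @compact_closed_box R n a b.
have mQ := compact_measurable_rV cQ.
have QI : open_box a b `<=` closed_box a b.
  by move=> x xab i; have /andP[/ltW -> /ltW ->] := xab i.
have mO := @measurable_open_box R n a b.
have ig : mu.-integrable B (EFin \o (fun x => `|g x| * \1_(closed_box a b) x)).
  apply/integrableP; split.
    by apply/measurable_EFinP; apply: measurable_funM => //; exact: measurableT_comp.
  apply: le_lt_trans (gK _ cQ abB).
  rewrite -[X in (_ <= \int[_]_(x in X) _)%E](setIidr abB) integral_mkcondr.
  rewrite le_eqVlt; apply/orP; left; apply/eqP; apply: eq_integral => x _ /=.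
  rewrite patchE indicE; case: ifP => _; first by rewrite mulr1 normr_id.
  by rewrite mulr0 normr0.
have mf k : measurable_fun B (fun x => (g x * box_bump a b k%:R x)%:E).
  by have /integrableP[] := integrable_mul_test lg (tb k).
have mf0 : measurable_fun B (fun x => (g x * \1_(open_box a b) x)%:E).
  by apply/measurable_EFinP; apply: measurable_funM.
have cv : {ae mu, forall x, B x ->
    (g x * box_bump a b k%:R x)%:E @[k --> \oo] --> (g x * \1_(open_box a b) x)%:E}.
  apply: aeW => x xB; apply: cvg_EFin; first exact: nearW.
  by apply: cvgM; [exact: cvg_cst|exact: box_bump_cvg].
have dom : {ae mu, forall x k, B x ->
    (`|(g x * box_bump a b k%:R x)%:E| <= (EFin \o (fun x => `|g x| * \1_(closed_box a b) x)%R) x)%E}.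
  apply: aeW => x k xB; rewrite lee_fin normrM ler_wpM2l//.
  have /andP[b0 b1] := box_bump_itv a b k%:R x.
  rewrite ger0_norm// indicE; have [//|xQ] := boolP (x \in closed_box a b).
  move: xQ; rewrite notin_setE => /= /existsNP[i /negP]; rewrite negb_and -!ltNge => abx.
  rewrite /box_bump (bigD1 i)//=; case/orP: abx => abx.
    by rewrite flat_eq0 ?mul0r// mulr_ge0_le0// subr_le0 ltW.
  by rewrite [X in _ * X * _]flat_eq0 ?mulr0 ?mul0r// mulr_ge0_le0// subr_le0 ltW.
have [_ _] := dominated_convergence mB mf mf0 cv ig dom.
rewrite (_ : (fun k => _) = cst 0%E); last first.
  apply/funext => k; have fin := integrable_fin_num mB (integrable_mul_test lg (tb k)).
  by rewrite /= -[LHS](fineK fin) [X in X%:E](gphi _ (tb k)).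
move=> c0; transitivity (\int[mu]_(x in B) (g x * \1_(open_box a b) x)%:E)%E.
  rewrite -{1}(setIidr (subset_trans QI abB)).
  rewrite integral_mkcondr; apply: eq_integral => x _; rewrite patchE indicE.
  by case: ifP => _; rewrite ?mulr1 ?mulr0.
by apply: cvg_unique c0 _; [exact: ereal_hausdorff|exact: cvg_cst].
Qed.

(** Boxes are stable under intersection and generate the sigma-algebra, so a Dynkin argument extends
    the vanishing of the integral of [g] to all measurable subsets of the box, which forces g = 0
    almost everywhere there. *)
Lemma fundamental_box g (a b : 'I_n -> R) : locally_integrable_ball g ->
  (forall phi, test_function phi -> \int[mu]_(x in B) (g x * phi x) = 0) ->
  closed_box a b `<=` B -> {ae mu, forall x, open_box a b x -> g x = 0}.
Proof.
move=> lg gphi abB; have [mg gK] := lg.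
have QI : open_box a b `<=` closed_box a b.
  by move=> x xab i; have /andP[/ltW -> /ltW ->] := xab i.
have mO := @measurable_open_box R n a b.
have ig : mu.-integrable (open_box a b) (EFin \o g).
  have cQ := @compact_closed_box R n a b; have mQ := compact_measurable_rV cQ.
  apply: (integrableS mQ mO QI); apply/integrableP; split.
    by apply/measurable_EFinP; exact: measurable_funS mg.
  exact: gK.
have dyn S : measurable S -> (\int[mu]_(x in S `&` open_box a b) (g x)%:E = 0)%E.
  move=> mS; have : <<s boxes>> S by rewrite -measurable_boxes.
  apply: (dynkin_induction (P := fun S => (\int[mu]_(x in S `&` open_box a b) (g x)%:E = 0)%E)
    measurable_boxes boxes_setI) => //.
  - by rewrite setTI; exact: integral_box_eq0.
  - move=> _ [c [d ->]].
    have [a' [b' [E a'b']]] : exists a' b', open_box c d `&` open_box a b = open_box a' b' /\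
        forall i, a i <= a' i /\ b' i <= b i.
      exists (fun i => Num.max (a i) (c i)), (fun i => Num.min (b i) (d i)); split; last first.
        by move=> i; rewrite le_max ge_min !lexx.
      apply/seteqP; split=> x /=.
        move=> [cd ab] i; rewrite gt_max lt_min.
        by have /andP[-> ->] := ab i; have /andP[-> ->] := cd i.
      move=> H; split=> i; have := H i; rewrite gt_max lt_min.
        by move=> /andP[/andP[_ ->] /andP[_ ->]].
      by move=> /andP[/andP[-> _] /andP[-> _]].
    rewrite E; apply: integral_box_eq0 => // x xab; apply: abB => i.
    have [aa bb] := a'b' i; have /andP[xa xb] := xab i.
    by rewrite (le_trans aa xa) (le_trans xb bb).
  - move=> A mA A0.
    have OE : open_box a b = (A `&` open_box a b) `|` (~` A `&` open_box a b).
      by rewrite -setIUl setUv setTI.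
    have := integral_box_eq0 lg gphi abB; rewrite {1}OE integral_setU.
    - by rewrite A0 add0e.
    - exact: measurableI.
    - by apply: measurableI => //; exact: measurableC.
    - by rewrite -OE; have /integrableP[] := ig.
    - by rewrite disj_set2E; apply/eqP; rewrite setIACA setICr set0I.
  - move=> F mF tF F0; rewrite setI_bigcupl integral_bigcup//.
    + by rewrite eseries0.
    + exact: trivIset_setIr.
    + by move=> k; exact: measurableI.
    + rewrite -setI_bigcupl; apply: integrableS ig => //.
      by apply: measurableI => //; exact: bigcupT_measurable.
have h := integral_ae_eq mO ig (measurable_cst 0%E).
have : ae_eq mu (open_box a b) (EFin \o g) (cst 0%E).
  apply: h => E EO mE; rewrite integral0 -[RHS](dyn E mE).
  by rewrite (setIidl EO).
by apply: filterS => x /= gx /gx [->].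
Qed.

Lemma fundamental_lemma g : locally_integrable_ball g ->
  (forall phi, test_function phi -> \int[mu]_(x in B) (g x * phi x) = 0) ->
  {ae mu, forall x, B x -> g x = 0}.
Proof.
move=> lg gphi.
pose lo (ab : {ffun 'I_n -> rat * rat}) i : R := ratr (ab i).1.
pose hi (ab : {ffun 'I_n -> rat * rat}) i : R := ratr (ab i).2.
(* Countably many rational boxes, numbered by [pickle], cover the ball, so the exceptional null sets
   can be united. *)
pose A (k : nat) x : Prop := if unpickle k is Some ab then
  closed_box (lo ab) (hi ab) `<=` B -> open_box (lo ab) (hi ab) x -> g x = 0 else True.
have aeA : {ae mu, forall x k, A k x}.
  apply/ae_foralln => k; rewrite /A; case: unpickle => [ab|]; last exact: aeW.
  have [abB|abB] := pselect (closed_box (lo ab) (hi ab) `<=` B); last by apply: aeW.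
  by apply: filterS (fundamental_box lg gphi abB) => x gx _.
apply: filterS aeA => x gA xB.
have nB : nbhs x B by apply: open_nbhs_nbhs; split => //; exact: open_unit_ball.
have [ab [abx abB]] := @open_box_nbhs R n B x nB.
by have := gA (pickle ab); rewrite /A pickleK; apply.
Qed.

End fundamental_lemma.

(** * Weak derivatives and the energy *)

Section weak_derivatives.
Context {R : realType} {n : nat}.
Implicit Types (f g h phi : 'rV[R]_n -> R) (x y : 'rV[R]_n) (i j : 'I_n).
Local Notation mu := (@lebesgue_rV R n).
Local Notation B := (@unit_ball R n).
Local Notation ae_B f g := {ae mu, forall x, B x -> f x = g x}.

Let mB : measurable B := @measurable_unit_ball R n.

Lemma Rintegral_ae f g : measurable_fun B f -> measurable_fun B g -> ae_B f g ->
  \int[mu]_(x in B) f x = \int[mu]_(x in B) g x.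
Proof.
move=> mf mg fg; congr fine; apply: ae_eq_integral => //; try exact/measurable_EFinP.
by apply: filterS fg => x + xB => /(_ xB) /= ->.
Qed.

Lemma locally_integrableD f g : locally_integrable_ball f -> locally_integrable_ball g ->
  locally_integrable_ball (fun x => f x + g x).
Proof.
move=> [mf fK] [mg gK]; split; first exact: measurable_funD.
move=> K cK KB; have mK := compact_measurable_rV cK.
have [mf' mg'] := (measurable_funS mB KB mf, measurable_funS mB KB mg).
have H := lte_add_pinfty (fK K cK KB) (gK K cK KB).
apply: le_lt_trans H; rewrite -ge0_integralD//; last 2 first.
- by apply/measurable_EFinP; exact: measurableT_comp.
- by apply/measurable_EFinP; exact: measurableT_comp.
apply: ge0_le_integral => //.
- by apply/measurable_EFinP; apply: measurableT_comp => //; exact: measurable_funD.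
- apply: emeasurable_funD; apply/measurable_EFinP; exact: measurableT_comp.
- by move=> x _; rewrite -EFinD lee_fin ler_normD.
Qed.

Lemma locally_integrableZ c f : locally_integrable_ball f ->
  locally_integrable_ball (fun x => c * f x).
Proof.
move=> [mf fK]; split; first exact: measurable_funM.
move=> K cK KB; have mK := compact_measurable_rV cK.
have mf' := measurable_funS mB KB mf.
under eq_integral do rewrite normrM EFinM.
rewrite ge0_integralZl_EFin//; last first.
  by apply/measurable_EFinP; exact: measurableT_comp.
by apply: lte_mul_pinfty => //; exact: fK.
Qed.

Lemma locally_integrable_cst (c : R) : locally_integrable_ball (fun _ : 'rV[R]_n => c).
Proof.
split=> // K cK KB; have mK := compact_measurable_rV cK.
rewrite integral_cst//; apply: lte_mul_pinfty => //.
apply: (@le_lt_trans _ _ (mu B)); last exact: lebesgue_rV_ball_lty.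
by apply: le_measure; rewrite ?inE.
Qed.

Lemma integrable_locally f : mu.-integrable B (EFin \o f) -> locally_integrable_ball f.
Proof.
move=> /integrableP[mf foo]; split; first exact/measurable_EFinP.
move=> K cK KB; have mK := compact_measurable_rV cK.
apply: le_lt_trans foo; apply: ge0_subset_integral => //.
by apply/measurable_EFinP; apply: measurableT_comp => //; exact/measurable_EFinP.
Qed.

Lemma iter_partial_test s phi : test_function phi -> test_function (iter_partial s phi).
Proof. by elim: s => [//|i s IH] tphi /=; apply: partial_test; exact: IH. Qed.

Lemma weak_derivative_unique s f g1 g2 :
  weak_derivative s f g1 -> weak_derivative s f g2 -> ae_B g1 g2.
Proof.
move=> [lf lg1 e1] [_ lg2 e2].
have lN := locally_integrableZ (-1) lg2.
have : ae_B (fun x => g1 x + -1 * g2 x) (cst 0).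
  apply: fundamental_lemma; first exact: locally_integrableD.
  move=> phi tphi; have i1 := integrable_mul_test lg1 tphi; have i2 := integrable_mul_test lg2 tphi.
  rewrite (_ : \int[mu]_(x in B) _ = \int[mu]_(x in B) (g1 x * phi x - g2 x * phi x)).
    rewrite RintegralB//; apply/eqP; rewrite subr_eq0; apply/eqP.
    have := e1 _ tphi; rewrite e2// => /(mulfI _) -> //.
    by rewrite signr_eq0.
  by congr Rintegral; apply/funext => x; ring.
by apply: filterS => x H xB; have := H xB; rewrite /= mulN1r => /eqP; rewrite subr_eq0 => /eqP.
Qed.

Lemma weak_derivativeD s f1 f2 g1 g2 : weak_derivative s f1 g1 -> weak_derivative s f2 g2 ->
  weak_derivative s (fun x => f1 x + f2 x) (fun x => g1 x + g2 x).
Proof.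
move=> [lf1 lg1 e1] [lf2 lg2 e2]; split; try exact: locally_integrableD.
move=> phi tphi; have tsphi := iter_partial_test s tphi.
under eq_Rintegral do rewrite mulrDl.
under [in RHS]eq_Rintegral do rewrite mulrDl.
by rewrite !RintegralD// ?mulrDr ?e1 ?e2//; exact: integrable_mul_test.
Qed.

Lemma weak_derivativeZ s c f g : weak_derivative s f g ->
  weak_derivative s (fun x => c * f x) (fun x => c * g x).
Proof.
move=> [lf lg e]; split; try exact: locally_integrableZ.
move=> phi tphi; have tsphi := iter_partial_test s tphi.
under eq_Rintegral do rewrite -mulrA.
under [in RHS]eq_Rintegral do rewrite -mulrA.
by rewrite !RintegralZl// ?e//; [ring|exact: integrable_mul_test|exact: integrable_mul_test].
Qed.

Lemma weak_derivativeB s f1 f2 g1 g2 : weak_derivative s f1 g1 -> weak_derivative s f2 g2 ->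
  weak_derivative s (fun x => f1 x - f2 x) (fun x => g1 x - g2 x).
Proof.
move=> h1 /(weak_derivativeZ (-1)) h2; have := weak_derivativeD h1 h2.
by congr weak_derivative; apply/funext => x; rewrite mulN1r.
Qed.

Lemma weak_derivative0 s : weak_derivative s (fun _ : 'rV[R]_n => 0) (fun _ => 0).
Proof.
split; try exact: locally_integrable_cst.
move=> phi tphi; under eq_Rintegral do rewrite mul0r.
by under [in RHS]eq_Rintegral do rewrite mul0r; rewrite Rintegral_cst// mul0r mulr0.
Qed.

Lemma weak_derivative_sum s (F G : 'I_n -> 'rV[R]_n -> R) :
  (forall k, weak_derivative s (F k) (G k)) ->
  weak_derivative s (fun x => \sum_k F k x) (fun x => \sum_k G k x).
Proof.
move=> FG; elim: (index_enum 'I_n) => [|k r IH].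
  have := weak_derivative0 s.
  by congr weak_derivative; apply/funext => x; rewrite big_nil.
have := weak_derivativeD (FG k) IH.
by congr weak_derivative; apply/funext => x; rewrite big_cons.
Qed.

Lemma weak_partialP s f g : weak_derivative s f g -> weak_derivative s f (weak_partial s f).
Proof. by move=> fg; apply: (xgetPex (cst 0)); exists g. Qed.

Lemma weak_partial_ae s f g : weak_derivative s f g -> ae_B (weak_partial s f) g.
Proof. by move=> fg; exact: weak_derivative_unique (weak_partialP fg) fg. Qed.

(** Testing the derivative [k; k] with d_i phi is testing [k; k; i] with phi, because [iter_partial]
    applies the last index of the list first. *)
Lemma weak_derivative_comp k i f g h : weak_derivative [:: k; k] f g ->
  weak_derivative [:: k; k; i] f h -> weak_derivative [:: i] g h.
Proof.
move=> [lf lg e1] [_ lh e2]; split => // phi tphi.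
have := e1 _ (partial_test i tphi); rewrite /= expr2 mulrNN !mul1r => <-.
by have := e2 _ tphi; rewrite /= => ->; rewrite !exprS expr0; ring.
Qed.

Definition lap f x := \sum_k partial k (partial k f) x.
Definition gradlap i f := partial i (lap f).

(** The energy differentiates [weak_laplacian], a sum of chosen representatives. For [f] in W^{3,2}
    that derivative is rewritten, off a null set, as a sum of third weak derivatives of [f], which
    can be computed. *)
Lemma weak_gradlap_ae f i (H : 'I_n -> 'rV[R]_n -> R) : sobolev 3 f ->
  (forall k, weak_derivative [:: k; k; i] f (H k)) ->
  weak_derivative [:: i] (weak_laplacian f) (weak_partial [:: i] (weak_laplacian f)) /\
  ae_B (weak_partial [:: i] (weak_laplacian f)) (fun x => \sum_k H k x).
Proof.
move=> sf fH.
have w2 k : weak_derivative [:: k; k] f (weak_partial [:: k; k] f).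
  by have [//|g fg _] := sf [:: k; k]; exact: weak_partialP fg.
have w1 : weak_derivative [:: i] (weak_laplacian f) (fun x => \sum_k H k x).
  by apply: weak_derivative_sum => k; exact: weak_derivative_comp (w2 k) (fH k).
by split; [exact: weak_partialP w1|exact: weak_partial_ae].
Qed.

Section psymbols.
Hypothesis n7 : (7 <= n)%N.

(** Derivatives leave the test function one by one, starting with the outermost, which therefore
    acts first on [f]: hence the reversed list. The condition [k + size s <= 6] keeps the products
    integrable, and with that the origin contributes nothing. *)
Lemma psymbol_weak_derivative s m k f : (size s <= m)%N -> (k + size s <= 6)%N ->
  psymbol m k f -> weak_derivative s f (iter_partial (rev s) f).
Proof.
elim: s m k f => [|i s IH] m k f sm ks sf.
  have lf : locally_integrable_ball f.
    by apply/integrable_locally/(integrable_psymbol n7 _ sf); rewrite addn0 in ks.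
  by split=> // phi tphi; rewrite expr0 mul1r.
case: m sm sf => // m sm sf.
rewrite rev_cons /iter_partial foldr_rcons -/(iter_partial _ _).
have sdf := psymbol_partial i sf.
have k5 : (k.+1 + size s <= 6)%N by rewrite addSnnS.
have [ldf lg e] := IH m k.+1 _ sm k5 sdf.
have lf : locally_integrable_ball f.
  apply/integrable_locally/(integrable_psymbol n7 _ sf).
  by rewrite (leq_trans _ ks)// leq_addr.
split=> // phi tphi; have tsphi := iter_partial_test s tphi.
have [_ [K [cK KB phi0]]] := tsphi.
rewrite /= (integral_partial_by_parts n7 i (k := k) (l := 0) (K := K)) ?e ?exprS ?mulN1r ?mulNr//.
- by rewrite addn0 (leq_trans _ (_ : (k + size s <= 5)%N)) ?leq_addr// -ltnS -addnS.
- exact: psymbol_order sf.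
- exact: test_psymbol.
- by move=> x _; exact: phi0.
Qed.

Lemma psymbol_L2 m k f : (k <= 3)%N -> psymbol m k f -> L2_ball f.
Proof.
move=> k3 sf; split; first exact: measurable_psymbol sf.
have k6 : (k + k <= 6)%N by rewrite (leq_add k3 k3).
have /integrableP[_] := integrable_psymbol n7 k6 (psymbolM sf sf).
apply: le_lt_trans; rewrite le_eqVlt; apply/orP; left; apply/eqP.
by apply: eq_integral => x _; rewrite /= -expr2 ger0_norm ?sqr_ge0.
Qed.

Lemma psymbol_iter_partial s m k f : (size s <= m)%N -> psymbol m k f ->
  psymbol (m - size s) (k + size s) (iter_partial s f).
Proof.
elim: s m => [|i s IH] m sm sf /=; first by rewrite subn0 addn0.
rewrite addnS; apply: psymbol_partial.
by rewrite subnSK//; apply: IH => //; exact: ltnW.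
Qed.

Lemma psymbol_sobolev m f : (3 <= m)%N -> psymbol m 0 f -> sobolev 3 f.
Proof.
move=> m3 sf s s3; exists (iter_partial (rev s) f).
  apply: (psymbol_weak_derivative (k := 0) _ _ sf); first exact: leq_trans s3 m3.
  by rewrite add0n (leq_trans s3).
apply: (psymbol_L2 (k := 0 + size (rev s)) (m := m - size (rev s))).
  by rewrite size_rev.
by apply: psymbol_iter_partial => //; rewrite size_rev (leq_trans s3).
Qed.

Lemma psymbol_lap m k f : psymbol m.+2 k f -> psymbol m k.+2 (lap f).
Proof. by move=> sf; apply: psymbol_sum => i; do 2!apply: psymbol_partial. Qed.

Lemma psymbol_gradlap m k f i : psymbol m.+3 k f -> psymbol m k.+3 (gradlap i f).
Proof. by move=> sf; apply: psymbol_partial; exact: psymbol_lap. Qed.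

Lemma partial_sum m k (F : 'I_n -> 'rV[R]_n -> R) i x :
  (forall j, psymbol m.+1 k (F j)) -> pball x ->
  partial i (fun y => \sum_j F j y) x = \sum_j partial i (F j) x.
Proof.
move=> sF xB.
suff : is_derive x (axis i) (fun y => \sum_j F j y) (\sum_j partial i (F j) x) by case.
elim: (index_enum 'I_n) => [|j r IH].
  rewrite big_nil (_ : (fun y => _) = cst 0); first exact: is_derive_cst.
  by apply/funext => y; rewrite big_nil.
rewrite big_cons (_ : (fun y => _) = (fun y => F j y + \sum_(l <- r) F l y)).
  by apply: is_deriveD' => //; exact: psymbol_derive (sF j) xB.
by apply/funext => y; rewrite big_cons.
Qed.

Lemma gradlapE f i x : psymbol 3 0 f -> pball x ->
  gradlap i f x = \sum_k partial i (partial k (partial k f)) x.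
Proof.
move=> sf xB; apply: (partial_sum (m := 0) (k := 2)) => // j.
by do 2!apply: psymbol_partial.
Qed.

Lemma weak_gradlap_psymbol f i : psymbol 3 0 f ->
  measurable_fun B (weak_partial [:: i] (weak_laplacian f)) /\
  ae_B (weak_partial [:: i] (weak_laplacian f)) (gradlap i f).
Proof.
move=> sf; have [[_ [mw _] _] wE] := @weak_gradlap_ae f i _ (psymbol_sobolev (leqnn 3) sf)
  (fun k => psymbol_weak_derivative (k := 0) (s := [:: k; k; i]) (leqnn 3) (isT : 0 + 3 <= 6)%N sf).
split=> //.
apply: filterS2 wE (ae_pball n7) => x H xp xB; rewrite H//.
by rewrite gradlapE//; exact: xp.
Qed.

End psymbols.

End weak_derivatives.

(** * The energy of symbols as a quadratic form *)

Section energy.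
Context {R : realType} {n : nat}.
Hypothesis n7 : (7 <= n)%N.
Local Notation mu := (@lebesgue_rV R n).
Local Notation B := (@unit_ball R n).
Implicit Types f g : 'rV[R]_n -> R.
Let mB : measurable B := @measurable_unit_ball R n.

Lemma ae_forall_ord d (T : measurableType d) (m : {measure set T -> \bar R}) p
    (Q : 'I_p -> T -> Prop) :
  (forall i, {ae m, forall x, Q i x}) -> {ae m, forall x, forall i, Q i x}.
Proof.
move=> aeQ; have H (k : nat) : {ae m, forall x, if insub k is Some i then Q i x else True}.
  by case: insub => [i|]; [exact: aeQ|exact: aeW].
by have := ae_foralln H; apply: filterS => x Hx i; have := Hx i; rewrite valK.
Qed.

Lemma measurable_sum_sqr p (h : 'I_p -> 'I_n -> 'rV[R]_n -> R) :
  (forall j i, measurable_fun B (h j i)) ->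
  measurable_fun B (fun x => \sum_(j < p) \sum_(i < n) h j i x ^+ 2).
Proof.
move=> mh; apply: measurable_sum => j; apply: measurable_sum => i.
exact: measurable_funX.
Qed.

Lemma E3ext_ae p (u : 'rV[R]_n -> 'rV[R]_p) (h : 'I_p -> 'I_n -> 'rV[R]_n -> R) :
  (forall j i, measurable_fun B (weak_partial [:: i] (weak_laplacian (component u j)))) ->
  (forall j i, measurable_fun B (h j i)) ->
  (forall j i, {ae mu, forall x, B x ->
    weak_partial [:: i] (weak_laplacian (component u j)) x = h j i x}) ->
  E3ext u = \int[mu]_(x in B) \sum_(j < p) \sum_(i < n) h j i x ^+ 2.
Proof.
move=> mw mh wh; apply: Rintegral_ae; try exact: measurable_sum_sqr.
have := ae_forall_ord (fun j => ae_forall_ord (wh j)).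
apply: filterS => x H xB; apply: eq_bigr => j _; apply: eq_bigr => i _.
by rewrite H.
Qed.

(* [ball_int] and [T3] are locked because comparing the energies of two
   syntactically close functions would otherwise unfold the whole integral. *)
Fact ball_int_key : unit. Proof. by []. Qed.
Definition ball_int := locked_with ball_int_key
  (fun f : 'rV[R]_n -> R => \int[mu]_(x in B) f x).

Lemma ball_intE (f : 'rV[R]_n -> R) : ball_int f = \int[mu]_(x in B) f x.
Proof. by rewrite /ball_int unlock. Qed.

Fact T3_key : unit. Proof. by []. Qed.
Definition T3 := locked_with T3_key (fun f g : 'rV[R]_n -> R =>
  ball_int (fun x => \sum_(i < n) gradlap i f x * gradlap i g x)).

Lemma T3E (f g : 'rV[R]_n -> R) :
  T3 f g = ball_int (fun x => \sum_(i < n) gradlap i f x * gradlap i g x).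
Proof. by rewrite /T3 unlock. Qed.

Lemma psymbol_T3 f g : psymbol 3 0 f -> psymbol 3 0 g ->
  psymbol 0 6 (fun x => \sum_(i < n) gradlap i f x * gradlap i g x).
Proof.
by move=> sf sg; apply: psymbol_sum => i; apply: (psymbolM (k := 3) (l := 3));
  exact: psymbol_gradlap.
Qed.

Lemma Rintegral_sum p m k (F : 'I_p -> 'rV[R]_n -> R) : (k <= 6)%N ->
  (forall j, psymbol m k (F j)) ->
  \int[mu]_(x in B) (\sum_j F j x) = \sum_j \int[mu]_(x in B) F j x.
Proof.
move=> k6 sF.
suff : mu.-integrable B (EFin \o (fun x => \sum_j F j x)) /\
  \int[mu]_(x in B) (\sum_j F j x) = \sum_j \int[mu]_(x in B) F j x by case.
elim: (index_enum 'I_p) => [|j r [IH1 IH2]].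
  under [X in EFin \o X]eq_fun do rewrite big_nil.
  under eq_Rintegral do rewrite big_nil.
  rewrite big_nil Rintegral_cst// mul0r; split=> //.
  exact: integrable0.
under [X in EFin \o X]eq_fun do rewrite big_cons.
under eq_Rintegral do rewrite big_cons.
have ij := integrable_psymbol n7 k6 (sF j).
rewrite big_cons RintegralD// IH2; split=> //.
exact: (integrableD mB ij IH1).
Qed.

Lemma E3ext_psymbol p (u : 'rV[R]_n -> 'rV[R]_p) :
  (forall j, psymbol 3 0 (component u j)) ->
  E3ext u = \sum_(j < p) T3 (component u j) (component u j).
Proof.
move=> su; rewrite (E3ext_ae (h := fun j i => gradlap i (component u j))).
- rewrite (Rintegral_sum (m := 0) (leqnn 6)); last first.
    move=> j; apply: (psymbol_ext _ (psymbol_T3 (su j) (su j))) => x _ /=.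
    by apply: eq_bigr => i _; rewrite expr2.
  apply: eq_bigr => j _; rewrite T3E ball_intE; apply: eq_Rintegral => x _ /=.
  by apply: eq_bigr => i _; rewrite expr2.
- by move=> j i; have [] := weak_gradlap_psymbol n7 i (su j).
- by move=> j i; apply: measurable_psymbol (psymbol_gradlap i (su j)).
- by move=> j i; have [] := weak_gradlap_psymbol n7 i (su j).
Qed.

End energy.

(** * Radial calculus *)

Lemma partial_val {R : realType} {n : nat} (f : 'rV[R]_n -> R) i x d :
  is_derive x (axis i) f d -> partial i f x = d.
Proof. by case. Qed.

(** * Linearity of the integral and Green's formulas *)

Section integral_linearity.
Context {R : realType} {n : nat}.
Hypothesis n7 : (7 <= n)%N.
Implicit Types (f g : 'rV[R]_n -> R) (x y : 'rV[R]_n) (i j : 'I_n).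
Local Notation B := (@unit_ball R n).
Let mB : measurable B := @measurable_unit_ball R n.

Lemma ball_int_eq m f g : psymbol m 6 f -> (forall x, pball x -> f x = g x) ->
  ball_int f = ball_int g.
Proof. by move=> sf fg; rewrite !ball_intE; exact: Rintegral_psymbol_eq sf fg. Qed.

Lemma ball_intD m p f g : psymbol m 6 f -> psymbol p 6 g ->
  ball_int (fun x => f x + g x) = ball_int f + ball_int g.
Proof.
by move=> sf sg; rewrite !ball_intE; apply: RintegralD => //; [exact: integrable_psymbol sf|exact: integrable_psymbol sg].
Qed.

Lemma ball_intZ m c f : psymbol m 6 f -> ball_int (fun x => c * f x) = c * ball_int f.
Proof. by move=> sf; rewrite !ball_intE; apply: RintegralZl => //; exact: integrable_psymbol sf. Qed.

Lemma ball_intN m f : psymbol m 6 f -> ball_int (fun x => - f x) = - ball_int f.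
Proof.
move=> sf; rewrite -mulN1r -(ball_intZ _ sf); congr ball_int.
by apply/funext => x; rewrite mulN1r.
Qed.

Lemma ball_intB m p f g : psymbol m 6 f -> psymbol p 6 g ->
  ball_int (fun x => f x - g x) = ball_int f - ball_int g.
Proof.
by move=> sf sg; rewrite -(ball_intN sg); apply: (ball_intD sf (psymbolN sg)).
Qed.

Lemma ball_int_sum p m (F : 'I_p -> 'rV[R]_n -> R) : (forall j : 'I_p, psymbol m 6 (F j)) ->
  ball_int (fun x => \sum_j F j x) = \sum_j ball_int (F j).
Proof.
move=> sF; rewrite ball_intE (Rintegral_sum n7 (leqnn 6) sF).
by apply: eq_bigr => j _; rewrite ball_intE.
Qed.

Lemma ball_int_ge0 m f : psymbol m 6 f -> (forall x, pball x -> 0 <= f x) ->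
  0 <= ball_int f.
Proof.
move=> sf f0; rewrite (@ball_int_eq _ _ (fun x => if x == 0 then 0 else f x) sf).
  by rewrite ball_intE; apply: Rintegral_ge0 => x xB; case: eqVneq => // x0; exact: f0.
by move=> x [_ /negbTE ->].
Qed.

Lemma ball_int_le m p f g : psymbol m 6 f -> psymbol p 6 g ->
  (forall x, pball x -> f x <= g x) -> ball_int f <= ball_int g.
Proof.
move=> sf sg fg; rewrite -subr_ge0 -(ball_intB sg sf).
apply: (@ball_int_ge0 0); last by move=> x xB; rewrite subr_ge0 fg.
by apply: psymbolB; [exact: psymbol_order sg|exact: psymbol_order sf].
Qed.

Lemma partial_supp f i (K : set 'rV[R]_n) : compact K ->
  (forall x, pball x -> ~ K x -> f x = 0) ->
  forall x, pball x -> ~ K x -> partial i f x = 0.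
Proof.
move=> cK f0 x xB Kx.
have oKc : open (~` K).
  by apply: closed_openC; apply: compact_closed => //; exact: norm_hausdorff.
rewrite /partial (@near_eq_derive _ _ _ _ (cst 0)) ?derive_cst//.
by apply: filterS2 (open_nbhs_nbhs (conj oKc Kx)) (Omega_near open_pball xB) => y Ky yB; exact: f0.
Qed.

Variable K : set 'rV[R]_n.
Hypotheses (cK : compact K) (KB : K `<=` B).

(** Compact support is asked of [g] alone, and both functions may be singular at the origin: k + l
    <= 4 leaves room for the two derivatives within the integrable degree 6. *)
Lemma green_left k l f g : (k + l <= 4)%N -> psymbol 2 k f -> psymbol 1 l g ->
  (forall x, pball x -> ~ K x -> g x = 0) ->
  \sum_i ball_int (fun x => partial i f x * partial i g x) = - ball_int (fun x => lap f x * g x).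
Proof.
move=> kl sf sg g0.
have s i : psymbol 0 6 (fun x => partial i (partial i f) x * g x).
  apply: psymbol_degree (psymbolM (psymbol_partial i (psymbol_partial i sf)) (psymbolW sg)).
  by rewrite !addSn !ltnS.
rewrite (eq_bigr (fun i => - ball_int (fun x => partial i (partial i f) x * g x))); last first.
  move=> i _; rewrite !ball_intE; apply: (integral_partial_by_parts n7 i _ (psymbol_partial i sf) sg cK KB g0).
  by rewrite addSn ltnS.
rewrite sumrN -(ball_int_sum s); congr (- ball_int _).
by apply/funext => x; rewrite /lap mulr_suml.
Qed.

Lemma green_right k l f g : (k + l <= 4)%N -> psymbol 1 k f -> psymbol 2 l g ->
  (forall x, pball x -> ~ K x -> g x = 0) ->
  ball_int (fun x => f x * lap g x) = - \sum_i ball_int (fun x => partial i f x * partial i g x).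
Proof.
move=> kl sf sg g0.
have s i : psymbol 0 6 (fun x => f x * partial i (partial i g) x).
  apply: psymbol_degree (psymbolM (psymbolW sf) (psymbol_partial i (psymbol_partial i sg))).
  by rewrite !addnS !ltnS.
rewrite -sumrN (eq_bigr (fun i => ball_int (fun x => f x * partial i (partial i g) x))).
  rewrite -(ball_int_sum s); congr ball_int.
  by apply/funext => x; rewrite /lap mulr_sumr.
move=> i _; apply/esym; rewrite !ball_intE; apply: (integral_partial_by_parts n7 i _ sf (psymbol_partial i sg) cK KB).
  by rewrite addnS ltnS.
exact: partial_supp.
Qed.

Lemma lap_supp f : (forall x, pball x -> ~ K x -> f x = 0) ->
  forall x, pball x -> ~ K x -> lap f x = 0.
Proof.
move=> f0 x xB Kx; rewrite /lap big1// => i _.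
by apply: (partial_supp i cK (partial_supp i cK f0)).
Qed.

(** Three integrations by parts, each on products of total degree 6. All derivatives end on [f], and
    [g] is never differentiated more than three times. *)
Lemma T3_lap3 f g : psymbol 6 0 f -> psymbol 3 0 g ->
  (forall x, pball x -> ~ K x -> g x = 0) ->
  T3 f g = - ball_int (fun x => lap (lap (lap f)) x * g x).
Proof.
move=> sf sg g0.
have slf := psymbol_lap sf; have sllf := psymbol_lap slf.
have slg := psymbol_lap sg.
rewrite T3E; have -> : ball_int (fun x => \sum_i gradlap i f x * gradlap i g x) =
    \sum_i ball_int (fun x => partial i (lap f) x * partial i (lap g) x).
  rewrite -(ball_int_sum (m := 0))// => i; apply: (psymbolM (k := 3) (l := 3)).
    by apply: psymbol_gradlap; exact: psymbol_order sf.
  exact: psymbol_gradlap.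
have E1 := green_left (k := 2) (l := 2) isT (psymbol_order (isT : 2 <= 4)%N slf) slg (lap_supp g0).
have E2 := green_right (k := 4) (l := 0) isT (psymbol_order (isT : 1 <= 2)%N sllf)
  (psymbol_order (isT : 2 <= 3)%N sg) g0.
have E3 := green_left (k := 4) (l := 0) isT sllf (psymbol_order (isT : 1 <= 3)%N sg) g0.
by rewrite E1 E2 opprK E3.
Qed.

End integral_linearity.

Section radial_calculus.
Context {R : realType} {n : nat}.
Hypothesis n7 : (7 <= n)%N.
Implicit Types (f g : 'rV[R]_n -> R) (x y : 'rV[R]_n) (i j : 'I_n).
Local Notation B := (@unit_ball R n).

Definition unitv i x : R := x ord0 i * rho x.
(** The i-th component of the radial field |x|^-k x/|x|, the multiplier in the Hardy type
    inequalities below. *)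
Definition runitv k i x : R := rho x ^+ k * unitv i x.

Lemma rho_enorm x : pball x -> rho x * enorm x = 1.
Proof. by move=> [_ x0]; rewrite mulVf// gt_eqF ?enorm_gt0. Qed.

Lemma sum_unitv_sqr x : pball x -> \sum_i unitv i x ^+ 2 = 1.
Proof.
move=> xB; rewrite -[RHS](expr1n _ 2) -(rho_enorm xB) exprMn enorm_sqr mulr_sumr.
by apply: eq_bigr => i _; rewrite exprMn mulrC.
Qed.

Lemma unitv_le1 i x : pball x -> `|unitv i x| <= 1.
Proof.
move=> xB; rewrite -(rho_enorm xB) normrM mulrC ger0_norm ?rho_ge0//.
by rewrite ler_wpM2l ?rho_ge0 ?ler_coord_enorm.
Qed.

Lemma is_derive_coord i j x : is_derive x (axis j) (fun x : 'rV[R]_n => x ord0 i) ((j == i)%:R : R).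
Proof.
apply/is_derive_line.
have -> : (fun h : R => (h *: axis j + x) ord0 i) =
    (fun h : R => (j == i)%:R * h + x ord0 i).
  by apply/funext => h; rewrite !mxE eqxx /= eq_sym mulrC.
by apply: is_derive_eq; rewrite addr0 -[_ *: _]/(_ * _) mulr1.
Qed.

Lemma is_derive_rho j x : pball x ->
  is_derive x (axis j) (@rho R n) (- unitv j x * rho x ^+ 2).
Proof.
move=> [_ x0]; have e0 := enorm_gt0 x0.
have dq : is_derive x (axis j) (fun y : 'rV[R]_n => \sum_i y ord0 i ^+ 2) (2 * x ord0 j).
  rewrite (_ : 2 * x ord0 j = \sum_i (i == j)%:R * (2 * x ord0 i)); last first.
    rewrite (bigD1 j)//= eqxx mul1r big1 ?addr0// => i /negbTE ->.
    by rewrite mul0r.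
  elim: (index_enum 'I_n) => [|i r IH].
    rewrite big_nil (_ : (fun y => _) = cst 0); first exact: is_derive_cst.
    by apply/funext => y; rewrite big_nil.
  rewrite big_cons (_ : (fun y => _) = (fun y : 'rV[R]_n => y ord0 i ^+ 2 + \sum_(l <- r) y ord0 l ^+ 2)).
    apply: is_deriveD' => //; apply: (is_derive_eq (is_deriveX' 1 (is_derive_coord i j x))).
    by rewrite expr1 eq_sym mulrC.
  by apply/funext => y; rewrite big_cons.
have q0 : 0 < \sum_i x ord0 i ^+ 2 by rewrite -enorm_sqr exprn_gt0.
have dn := is_derive_chain dq (is_derive1_sqrt q0).
have /(is_deriveV' (f := @enorm R n)) : is_derive x (axis j) (@enorm R n) ((2 * enorm x)^-1 * (2 * x ord0 j)) := dn.
rewrite gt_eqF// => /(_ isT) H; apply: (is_derive_eq H).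
rewrite /unitv /rho; field; lra.
Qed.

Lemma is_derive_unitv i j x : pball x ->
  is_derive x (axis j) (unitv i) (((j == i)%:R - unitv i x * unitv j x) * rho x).
Proof.
move=> xB; apply: (is_derive_eq (is_deriveM' (is_derive_coord i j x) (is_derive_rho j xB))).
by rewrite /unitv; ring.
Qed.

(** A joint induction, since the derivatives of [rho] and of [unitv i] are polynomials in both. *)
Lemma psymbol_rho_unitv m : psymbol m 1 (@rho R n) /\ forall i, psymbol m 0 (unitv i).
Proof.
have cr x : pball x -> {for x, continuous (@rho R n)}.
  move=> [_ x0]; apply: continuousV; first by rewrite gt_eqF ?enorm_gt0.
  exact: continuous_enorm.
have cu i x : pball x -> {for x, continuous (unitv i)}.
  by move=> xB; apply: continuousM; [exact: coord_continuous|exact: cr].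
have br : exists C, forall (t : unit) x, setT t -> pball x -> `|rho x| <= C * rho x ^+ 1.
  by exists 1 => _ x _ _; rewrite mul1r expr1 ger0_norm ?rho_ge0.
have bu i : exists C, forall (t : unit) x, setT t -> pball x -> `|unitv i x| <= C * rho x ^+ 0.
  by exists 1 => _ x _ xB; rewrite mul1r expr0 unitv_le1.
elim: m => [|m [IHr IHu]].
  by split=> [|i]; (split; [try exact: br; exact: bu|move=> _ x _; try exact: cr; exact: cu|by []]).
split=> [|i].
  apply: (symbolS_intro open_pball) => //; first by move=> _ x _; exact: cr.
  move=> j; exists (fun _ x => - unitv j x * rho x ^+ 2); first by move=> _ x _; exact: is_derive_rho.
  have := psymbolM (psymbolN (IHu j)) (psymbolM IHr IHr).
  by apply: psymbol_ext => x _; rewrite expr2.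
apply: (symbolS_intro open_pball) => //; first by move=> _ x _; exact: cu.
move=> j; exists (fun _ x => ((j == i)%:R - unitv i x * unitv j x) * rho x).
  by move=> _ x _; exact: is_derive_unitv.
apply: (psymbolM (k := 0)) => //; apply: psymbolB; first exact: psymbol_const.
exact: (psymbolM (k := 0)).
Qed.

Lemma psymbol_rho m : psymbol m 1 (@rho R n).
Proof. exact: (psymbol_rho_unitv m).1. Qed.

Lemma psymbol_unitv m i : psymbol m 0 (unitv i).
Proof. exact: (psymbol_rho_unitv m).2. Qed.

Lemma psymbol_rhoX m k : psymbol m k (fun x => rho x ^+ k).
Proof.
elim: k => [|k IH].
  by apply: psymbol_ext (psymbol_const m 0 1) => x _; rewrite expr0.
by apply: psymbol_ext (psymbolM (psymbol_rho m) IH) => x _; rewrite exprS.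
Qed.

Lemma psymbol_runitv m k i : psymbol m k (runitv k i).
Proof. by rewrite -[k in psymbol m k]addn0; exact: psymbolM (psymbol_rhoX m k) (psymbol_unitv m i). Qed.

Lemma is_derive_rhoX k j x : pball x ->
  is_derive x (axis j) (fun x => rho x ^+ k) (- k%:R * runitv k.+1 j x).
Proof.
move=> xB; case: k => [|k].
  rewrite oppr0 mul0r; exact: is_derive_cst.
apply: (is_derive_eq (is_deriveX' k (is_derive_rho j xB))).
by rewrite /runitv !exprS expr0; ring.
Qed.

Lemma is_derive_runitv k i j x : pball x ->
  is_derive x (axis j) (runitv k i)
    (rho x ^+ k.+1 * ((j == i)%:R - k.+1%:R * (unitv i x * unitv j x))).
Proof.
move=> xB; apply: (is_derive_eq (is_deriveM' (is_derive_rhoX k j xB) (is_derive_unitv i j xB))).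
by rewrite /runitv -natr1 !exprS; ring.
Qed.

Lemma div_runitv k x : pball x ->
  \sum_i partial i (runitv k i) x = (n%:R - 1 - k%:R) * rho x ^+ k.+1.
Proof.
move=> xB; rewrite (eq_bigr (fun i => rho x ^+ k.+1 - rho x ^+ k.+1 * k.+1%:R * unitv i x ^+ 2)).
  rewrite sumrB -mulr_sumr sum_unitv_sqr// sumr_const card_ord -natr1 -mulr_natl.
  by ring.
by move=> i _; rewrite (partial_val (is_derive_runitv k i i xB)) (_ : (i == i)%:R = 1 :> R) ?eqxx//; ring.
Qed.

(** On |x|^s x_j/|x| the Laplacian multiplies by s(s + n - 2) - (n - 1) and lowers the homogeneity
    by two, x_j/|x| being a spherical harmonic of degree one. For s = -k the factor is -(k + 1)(n -
    1 - k). *)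
Lemma lap_runitv k j x : pball x ->
  lap (runitv k j) x = - (k.+1%:R * (n%:R - 1 - k%:R)) * runitv k.+2 j x.
Proof.
move=> xB; pose h i y := (i == j)%:R * rho y ^+ k.+1 - k.+1%:R * (unitv j y * runitv k.+1 i y).
have hE i y : pball y -> partial i (runitv k j) y = h i y.
  by move=> yB; rewrite (partial_val (is_derive_runitv k j i yB)) /h /runitv; ring.
have dh i : partial i (partial i (runitv k j)) x =
   (i == j)%:R * (- k.+1%:R * runitv k.+2 i x) -
   k.+1%:R * (unitv j x * partial i (runitv k.+1 i) x +
     ((i == j)%:R - unitv j x * unitv i x) * rho x * runitv k.+1 i x).
  rewrite (partial_ext i (hE i) xB).
  have d1 := is_deriveM' (is_derive_cst ((i == j)%:R : R) x (axis i)) (is_derive_rhoX k.+1 i xB).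
  have d2 := is_deriveM' (is_derive_unitv j i xB) (psymbol_derive i (psymbol_runitv 1 k.+1 i) xB).
  have d3 := is_deriveM' (is_derive_cst (- k.+1%:R : R) x (axis i)) d2.
  have -> : h i = (fun y => cst (i == j)%:R y * rho y ^+ k.+1 + cst (- k.+1%:R) y * (unitv j y * runitv k.+1 i y)).
    by apply/funext => y; rewrite /h /= mulNr.
  by rewrite (partial_val (is_deriveD' d1 d3)) /cst /=; ring.
rewrite /lap (eq_bigr _ (fun i _ => dh i)) sumrB -mulr_sumr big_split /= -!mulr_sumr.
rewrite (bigD1 j)//= eqxx mul1r big1 ?addr0; last by move=> i /negbTE ->; rewrite mul0r.
rewrite div_runitv//.
have -> : \sum_i ((i == j)%:R - unitv j x * unitv i x) * rho x * runitv k.+1 i x = 0.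
  rewrite (eq_bigr (fun i => (i == j)%:R * (rho x ^+ k.+2 * unitv i x) -
      rho x ^+ k.+2 * unitv j x * unitv i x ^+ 2)); last first.
    by move=> i _; rewrite /runitv !exprS; ring.
  rewrite sumrB -mulr_sumr sum_unitv_sqr// (bigD1 j)//= eqxx mul1r big1 ?addr0 ?mulr1 ?subrr//.
  by move=> i /negbTE ->; rewrite mul0r.
by rewrite /runitv -!natr1; ring.
Qed.

(* The eigenvalue of [- rho ^- 6 * lap ^ 3] on [x / |x|], see [lap3_unitv]. *)
Definition lam : R := 15 * (n%:R - 1) * (n%:R - 3) * (n%:R - 5).

Lemma lap_ext f g x : (forall y, pball y -> f y = g y) -> pball x -> lap f x = lap g x.
Proof.
move=> fg xB; apply: eq_bigr => i _; apply: partial_ext => // y yB.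
exact: partial_ext.
Qed.

Lemma lapZ m k c f x : psymbol m.+2 k f -> pball x -> lap (fun y => c * f y) x = c * lap f x.
Proof.
move=> sf xB; rewrite /lap mulr_sumr; apply: eq_bigr => i _.
have H p l g y : psymbol p.+1 l g -> pball y -> partial i (fun y => c * g y) y = c * partial i g y.
  move=> sg yB; have := is_deriveM' (is_derive_cst c y (axis i)) (psymbol_derive i sg yB).
  by move=> [_ E]; rewrite /cst /= mul0r addr0 in E.
rewrite (@partial_ext _ _ _ (fun y => c * partial i f y))//; last by move=> y; exact: H sf.
exact: H (psymbol_partial i sf) xB.
Qed.

(** The degrees 0, 2, 4 met on the way contribute the factors -(n - 1), -3(n - 3), -5(n - 5). *)
Lemma lap3_unitv j x : pball x -> lap (lap (lap (unitv j))) x = - lam * rho x ^+ 6 * unitv j x.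
Proof.
move=> xB.
have E0 y : pball y -> unitv j y = runitv 0 j y by rewrite /runitv expr0 mul1r.
pose c k : R := - (k.+1%:R * (n%:R - 1 - k%:R)).
have E1 y : pball y -> lap (unitv j) y = c 0%N * runitv 2 j y.
  by move=> yB; rewrite (lap_ext E0)// lap_runitv.
have E2 y : pball y -> lap (lap (unitv j)) y = c 0%N * c 2 * runitv 4 j y.
  by move=> yB; rewrite (lap_ext E1)// (lapZ _ (psymbol_runitv 2 2 j))// lap_runitv// mulrA.
rewrite (lap_ext E2)// (lapZ _ (psymbol_runitv 2 4 j))// lap_runitv//.
by rewrite /c /lam /runitv; ring.
Qed.

Section compact_support.
Variable K : set 'rV[R]_n.
Hypotheses (cK : compact K) (KB : K `<=` B).

Lemma T3_unitv j f : psymbol 3 0 f -> (forall x, pball x -> ~ K x -> f x = 0) ->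
  T3 (unitv j) f = lam * ball_int (fun x => rho x ^+ 6 * (unitv j x * f x)).
Proof.
move=> sf f0; rewrite (T3_lap3 n7 cK KB (psymbol_unitv 6 j) sf f0).
have s6 : psymbol 0 6 (fun x => rho x ^+ 6 * (unitv j x * f x)).
  apply: (psymbolM (k := 6) (l := 0)); first exact: psymbol_rhoX.
  by apply: (psymbolM (k := 0) (l := 0)); [exact: psymbol_unitv|exact: psymbol_order sf].
rewrite -(ball_intZ n7 _ s6) -(ball_intN n7 (m := 0)).
  apply: (ball_int_eq n7 (m := 0)) => [|x xB]; last by rewrite lap3_unitv//; ring.
  apply: psymbolN; apply: (psymbol_ext (f := fun x => - lam * (rho x ^+ 6 * (unitv j x * f x)))).
    by move=> x xB; rewrite lap3_unitv//; ring.
  exact: psymbolZ.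
apply: (psymbol_ext (f := fun x => - lam * (rho x ^+ 6 * (unitv j x * f x)))).
  by move=> x xB; rewrite lap3_unitv//; ring.
exact: psymbolZ.
Qed.

Lemma radial_divergence k l f : (k + l <= 5)%N -> psymbol 1 l f ->
  (forall x, pball x -> ~ K x -> f x = 0) ->
  ball_int (fun x => \sum_i runitv k i x * partial i f x) =
  - (n%:R - 1 - k%:R) * ball_int (fun x => rho x ^+ k.+1 * f x).
Proof.
move=> kl sf f0.
have s1 i : psymbol 0 6 (fun x => runitv k i x * partial i f x).
  apply: (psymbol_degree _ (psymbolM (psymbol_runitv 0 k i) (psymbol_partial i sf))).
  by rewrite addnS ltnS.
have s2 i : psymbol 0 6 (fun x => partial i (runitv k i) x * f x).
  apply: (psymbol_degree _ (psymbolM (psymbol_partial i (psymbol_runitv 1 k i)) (psymbolW sf))).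
  by rewrite addSn ltnS.
have s3 : psymbol 0 6 (fun x => rho x ^+ k.+1 * f x).
  apply: (psymbol_degree _ (psymbolM (psymbol_rhoX 0 k.+1) (psymbolW sf))).
  by rewrite addSn ltnS.
rewrite (ball_int_sum n7 s1).
rewrite (eq_bigr (fun i => - ball_int (fun x => partial i (runitv k i) x * f x))); last first.
  by move=> i _; rewrite !ball_intE; exact: (integral_partial_by_parts n7 i kl (psymbol_runitv 1 k i) sf cK KB f0).
rewrite sumrN -(ball_int_sum n7 s2) mulNr -(ball_intZ n7 _ s3); congr (- _).
apply: (ball_int_eq n7 (m := 0)); first exact: psymbol_sum.
by move=> x xB; rewrite -mulr_suml div_runitv// mulrA.
Qed.

End compact_support.

End radial_calculus.

(** * Weighted Hardy and Rellich inequalities *)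

Section hardy_rellich.
Context {R : realType} {n : nat}.
Hypothesis n7 : (7 <= n)%N.
Implicit Types (f g : 'rV[R]_n -> R) (x y : 'rV[R]_n) (i j : 'I_n).
Local Notation B := (@unit_ball R n).
Variable K : set 'rV[R]_n.
Hypotheses (cK : compact K) (KB : K `<=` B).

(** The divergence identity applied to f^2. It evaluates the radial cross terms that appear when a
    square is expanded in the next two inequalities. *)
Lemma radial_sqr k f : (k <= 5)%N -> psymbol 1 0 f ->
  (forall x, pball x -> ~ K x -> f x = 0) ->
  2 * ball_int (fun x => \sum_i runitv k i x * (f x * partial i f x)) =
  - (n%:R - 1 - k%:R) * ball_int (fun x => rho x ^+ k.+1 * f x ^+ 2).
Proof.
move=> k5 sf f0.
have sff : psymbol 1 0 (fun x => f x * f x) by exact: (psymbolM (k := 0) (l := 0)).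
have ff0 x : pball x -> ~ K x -> f x * f x = 0 by move=> xB Kx; rewrite f0// mulr0.
have kk : (k + 0 <= 5)%N by rewrite addn0.
have := radial_divergence n7 cK KB kk sff ff0.
have -> : (fun x => rho x ^+ k.+1 * (f x * f x)) = (fun x => rho x ^+ k.+1 * f x ^+ 2).
  by apply/funext => x; rewrite expr2.
move=> <-.
have s i : psymbol 0 6 (fun x => runitv k i x * (f x * partial i f x)).
  apply: (psymbol_degree _ (psymbolM (psymbol_runitv 0 k i)
    (psymbolM (psymbolW sf) (psymbol_partial i sf)))).
  by rewrite add0n addn1 ltnS.
rewrite -(ball_intZ n7 _ (psymbol_sum s)).
apply: (ball_int_eq n7 (m := 0)); first by apply: psymbolZ; exact: psymbol_sum.
move=> x xB; rewrite mulr_sumr; apply: eq_bigr => i _.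
by rewrite (partialM i sf sf xB); ring.
Qed.

(** Expand the nonnegative integral of |x|^(-2k) |grad f + b f x/|x|^2|^2. By [radial_sqr] the cross
    term is -2 b^2 times the integral on the left when b = (n - 2 - 2k)/2, and b^2 of it remains. *)
Lemma weighted_hardy k f : (k.*2 <= 4)%N -> psymbol 1 0 f ->
  (forall x, pball x -> ~ K x -> f x = 0) ->
  ((n%:R - 2 - k.*2%:R) / 2) ^+ 2 * ball_int (fun x => rho x ^+ k.*2.+2 * f x ^+ 2) <=
  ball_int (fun x => \sum_i rho x ^+ k.*2 * partial i f x ^+ 2).
Proof.
move=> k4 sf f0; set b := (_ / 2).
have sP i : psymbol 0 6 (fun x => rho x ^+ k.*2 * partial i f x ^+ 2).
  apply: (psymbol_degree (k := k.*2 + (1 + 1))); first by rewrite addn2 !ltnS.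
  apply: psymbolM; first exact: psymbol_rhoX.
  by apply: (psymbol_ext _ (psymbolM (psymbol_partial i sf) (psymbol_partial i sf))).
have sQ i : psymbol 0 6 (fun x => runitv k.*2.+1 i x * (f x * partial i f x)).
  apply: (psymbol_degree _ (psymbolM (psymbol_runitv 0 k.*2.+1 i)
    (psymbolM (psymbolW sf) (psymbol_partial i sf)))).
  by rewrite add0n addn1 !ltnS.
have sS : psymbol 0 6 (fun x => rho x ^+ k.*2.+2 * f x ^+ 2).
  apply: (psymbol_degree _ (psymbolM (psymbol_rhoX 0 k.*2.+2) (psymbol_ext _ (psymbolM (psymbolW sf) (psymbolW sf))))).
    by rewrite !addn0 !ltnS.
  by move=> x _; rewrite expr2.
have k5 : (k.*2.+1 <= 5)%N by rewrite ltnS.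
have hQ := radial_sqr k5 sf f0.
have : 0 <= ball_int (fun x => \sum_i rho x ^+ k.*2 * partial i f x ^+ 2 +
    ((2 * b) * \sum_i runitv k.*2.+1 i x * (f x * partial i f x) +
     b ^+ 2 * (rho x ^+ k.*2.+2 * f x ^+ 2))).
  apply: (ball_int_ge0 n7 (m := 0)).
    apply: psymbolD; first exact: psymbol_sum.
    by apply: psymbolD; apply: psymbolZ => //; exact: psymbol_sum.
  move=> x xB.
  rewrite (_ : _ + _ = \sum_i rho x ^+ k.*2 * (partial i f x + b * (rho x * unitv i x * f x)) ^+ 2).
    apply: sumr_ge0 => i _; rewrite mulr_ge0 ?sqr_ge0// exprn_ge0//; exact: rho_ge0.
  have -> : rho x ^+ k.*2.+2 * f x ^+ 2 = \sum_i rho x ^+ k.*2.+2 * f x ^+ 2 * unitv i x ^+ 2.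
    by rewrite -mulr_sumr sum_unitv_sqr// mulr1.
  rewrite !mulr_sumr -!big_split /=; apply: eq_bigr => i _.
  by rewrite /runitv !exprS; ring.
rewrite (ball_intD n7 (m := 0) (p := 0)); [|exact: psymbol_sum|]; last first.
  by apply: psymbolD; apply: psymbolZ => //; exact: psymbol_sum.
rewrite (ball_intD n7 (m := 0) (p := 0)); [|by apply: psymbolZ; exact: psymbol_sum|exact: psymbolZ].
rewrite (ball_intZ n7 _ sS) (ball_intZ n7 _ (psymbol_sum sQ)) mulrAC hQ.
rewrite (_ : n%:R - 1 - k.*2.+1%:R = 2 * b); last by rewrite /b -natr1; field.
by set P := ball_int _; set S := ball_int _; lra.
Qed.

(** Expand the integral of (rho lap f + c rho^3 f)^2. Integration by parts turns the cross term into
    a weighted Dirichlet integral and a radial term; the Hardy inequality with k = 2 and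
    [radial_sqr] bound their combination below by c = ((n - 6)/2)^2 + 2(n - 6) times the integral of
    rho^6 f^2. *)
Lemma weighted_rellich f : psymbol 2 0 f -> (forall x, pball x -> ~ K x -> f x = 0) ->
  ((n%:R - 6) * (n%:R + 2) / 4) ^+ 2 * ball_int (fun x => rho x ^+ 6 * f x ^+ 2) <=
  ball_int (fun x => rho x ^+ 2 * lap f x ^+ 2).
Proof.
move=> sf f0; set c := (_ / 4).
have n7r : (7 : R) <= n%:R by rewrite (ler_nat R 7).
have c0 : 0 <= c by rewrite /c; apply: divr_ge0 => //; apply: mulr_ge0; lra.
have sf1 := psymbolW sf; have sf0 := psymbolW sf1; have slf := psymbol_lap sf.
have sS : psymbol 0 6 (fun x => rho x ^+ 6 * f x ^+ 2).
  by apply: (psymbolM (k := 6) (l := 0)); [exact: psymbol_rhoX|apply: psymbol_ext (psymbolM (k := 0) (l := 0) sf0 sf0)].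
have sX : psymbol 0 6 (fun x => rho x ^+ 4 * f x * lap f x).
  by apply: (psymbolM (k := 4) (l := 2)) => //; apply: (psymbolM (k := 4) (l := 0)) => //; exact: psymbol_rhoX.
have sL : psymbol 0 6 (fun x => rho x ^+ 2 * lap f x ^+ 2).
  by apply: (psymbolM (k := 2) (l := 4)); [exact: psymbol_rhoX|apply: psymbol_ext (psymbolM (k := 2) (l := 2) slf slf)].
have sP i : psymbol 0 6 (fun x => rho x ^+ 4 * partial i f x ^+ 2).
  apply: (psymbolM (k := 4) (l := 2)); first exact: psymbol_rhoX.
  by apply: psymbol_ext (psymbolM (psymbolW (psymbol_partial i sf)) (psymbolW (psymbol_partial i sf))).
have sQ i : psymbol 0 6 (fun x => runitv 5 i x * (f x * partial i f x)).
  apply: (psymbolM (k := 5) (l := 1)); first exact: psymbol_runitv.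
  by apply: (psymbolM (k := 0) (l := 1)) => //; exact/psymbolW/psymbol_partial.
have hH := weighted_hardy (k := 2) isT sf1 f0.
have hQ := radial_sqr (k := 5) isT sf1 f0.
have sr : psymbol 1 4 (fun x => rho x ^+ 4 * f x).
  by apply: (psymbolM (k := 4) (l := 0)) => //; exact: psymbol_rhoX.
have hX := green_right n7 cK KB (k := 4) (l := 0) isT sr sf f0.
have hX2 : ball_int (fun x => rho x ^+ 4 * f x * lap f x) =
    - (ball_int (fun x => \sum_i rho x ^+ 4 * partial i f x ^+ 2) -
       4 * ball_int (fun x => \sum_i runitv 5 i x * (f x * partial i f x))).
  rewrite hX; congr (- _); rewrite -(ball_intZ n7 _ (psymbol_sum sQ)).
  rewrite -(ball_intB n7 (m := 0) (p := 0)); [|exact: psymbol_sum|by apply: psymbolZ; exact: psymbol_sum].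
  rewrite -(ball_int_sum n7 (m := 0)).
    apply: (ball_int_eq n7 (m := 0)).
      apply: psymbol_sum => i; apply: (psymbolM (k := 5) (l := 1)).
        exact: psymbol_partial.
      exact/psymbolW/psymbol_partial.
    move=> x xB; rewrite mulr_sumr -sumrB; apply: eq_bigr => i _.
    rewrite (partialM i (psymbol_rhoX 1 4) sf1 xB) (partial_val (is_derive_rhoX 4 i xB)).
    by rewrite /runitv; ring.
  move=> i; apply: (psymbolM (k := 5) (l := 1)); first exact: psymbol_partial.
  exact/psymbolW/psymbol_partial.
have : 0 <= ball_int (fun x => rho x ^+ 2 * lap f x ^+ 2 +
    ((2 * c) * (rho x ^+ 4 * f x * lap f x) + c ^+ 2 * (rho x ^+ 6 * f x ^+ 2))).
  apply: (ball_int_ge0 n7 (m := 0)).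
    by apply: psymbolD => //; apply: psymbolD; exact: psymbolZ.
  move=> x xB; rewrite (_ : _ + _ = (rho x * lap f x + c * (rho x ^+ 3 * f x)) ^+ 2) ?sqr_ge0//.
  by ring.
rewrite (ball_intD n7 (m := 0) (p := 0)) => [|//|]; last by apply: psymbolD; exact: psymbolZ.
rewrite (ball_intD n7 (m := 0) (p := 0)); [|exact: psymbolZ|exact: psymbolZ].
rewrite (ball_intZ n7 _ sS) (ball_intZ n7 _ sX) hX2.
move: hH hQ; rewrite /=.
set P := ball_int (fun x => \sum_i rho x ^+ 4 * _).
set Q := ball_int (fun x => \sum_i runitv _ _ _ * _).
set S := ball_int (fun x => rho x ^+ 6 * _); set L := ball_int _.
move=> hH hQ hL.
have S0 : 0 <= S.
  by apply: (ball_int_ge0 n7 sS) => x xB; rewrite mulr_ge0 ?sqr_ge0// exprn_ge0// rho_ge0.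
have cE : ((n%:R - 2 - 4) / 2) ^+ 2 + 2 * (n%:R - 6) = c :> R by rewrite /c; field.
have hP : c * S <= P - 4 * Q.
  have -> : 4 * Q = 2 * (2 * Q) by ring.
  by rewrite hQ -cE; move: hH; set a := (_ ^+ 2); lra.
have := ler_wpM2l c0 hP; lra.
Qed.

Definition hardy_rellich_constant : R :=
  ((n%:R - 2) / 2) ^+ 2 * ((n%:R - 6) * (n%:R + 2) / 4) ^+ 2.

(** Unweighted Hardy for [lap f], then weighted Rellich for [f]. The Laplacian of a general symbol
    has degree 2, beyond the reach of [weighted_hardy]; the assumption on [lap f] is met by test
    functions, which are smooth at the origin. *)
Lemma hardy_rellich f : psymbol 3 0 f -> psymbol 1 0 (lap f) ->
  (forall x, pball x -> ~ K x -> f x = 0) ->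
  hardy_rellich_constant * ball_int (fun x => rho x ^+ 6 * f x ^+ 2) <= T3 f f.
Proof.
move=> sf slf f0.
have h1 := weighted_hardy (k := 0) isT slf (lap_supp cK f0).
have h2 := weighted_rellich (psymbolW sf) f0.
have -> : T3 f f = ball_int (fun x => \sum_i rho x ^+ 0 * partial i (lap f) x ^+ 2).
  rewrite T3E; congr ball_int; apply/funext => x; apply: eq_bigr => i _.
  by rewrite expr0 mul1r expr2.
apply: le_trans h1; rewrite /hardy_rellich_constant subr0 -[leLHS]mulrA.
by apply: ler_wpM2l => //; exact: sqr_ge0.
Qed.

Lemma lam_le_hardy_rellich_constant : (12 <= n)%N -> @lam R n <= hardy_rellich_constant.
Proof.
move=> n12; rewrite /lam /hardy_rellich_constant.
have -> : n%:R = (n - 12)%:R + 12 :> R by rewrite -natrD subnK.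
set m : R := (n - 12)%:R; have m0 : 0 <= m by rewrite ler0n.
(* With n = m + 12, the inequality (m + 11)(m + 9) < (m + 10)^2 brings out the factor (m + 10)^2
   that the other side also contains. *)
apply: (@le_trans _ _ (15 * (m + 10) ^+ 2 * (m + 7))).
  have -> : 15 * (m + 12 - 1) * (m + 12 - 3) * (m + 12 - 5) =
    15 * (m + 10) ^+ 2 * (m + 7) - 15 * (m + 7) by ring.
  by rewrite gerBl; lra.
have -> : ((m + 12 - 2) / 2) ^+ 2 * ((m + 12 - 6) * (m + 12 + 2) / 4) ^+ 2 =
  (m + 10) ^+ 2 * ((m * m + 20 * m + 84) / 8) ^+ 2 by field.
rewrite mulrAC mulrC ler_wpM2l ?sqr_ge0//.
(* The tangent at m = 0, with value 84/8 and slope 20/8; its square already dominates 15(m + 7). *)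
have h : 105 / 10 + 25 / 10 * m <= (m * m + 20 * m + 84) / 8.
  have := mulr_ge0 m0 m0; lra.
apply: (@le_trans _ _ ((105 / 10 + 25 / 10 * m) ^+ 2)).
  have := mulr_ge0 m0 m0; rewrite expr2; lra.
rewrite lerXn2r// nnegrE; have := mulr_ge0 m0 m0; lra.
Qed.

Lemma hardy_rellich_constant_lt_lam : (7 <= n < 12)%N -> hardy_rellich_constant < @lam R n.
Proof.
rewrite /lam /hardy_rellich_constant => /andP[n7' n12].
have : n \in [:: 7; 8; 9; 10; 11]%N by apply: (_ : forall k, (6 < k)%N -> (k < 12)%N -> k \in [:: 7; 8; 9; 10; 11]%N) n7' n12;
    do 12![case=> //].
by rewrite !inE => /orP[|/orP[|/orP[|/orP[]]]] /eqP ->; lra.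
Qed.

End hardy_rellich.

(** * Minimality *)

Section energy_form.
Context {R : realType} {n : nat}.
Hypothesis n7 : (7 <= n)%N.
Implicit Types (f g h : 'rV[R]_n -> R) (x y : 'rV[R]_n) (i : 'I_n) (c : R).

Lemma partial_lin m k c f g i x : psymbol m.+1 k f -> psymbol m.+1 k g -> pball x ->
  partial i (fun y => f y + c * g y) x = partial i f x + c * partial i g x.
Proof.
move=> sf sg xB.
have dg := is_deriveM' (is_derive_cst c x (axis i)) (psymbol_derive i sg xB).
by rewrite (partial_val (is_deriveD' (psymbol_derive i sf xB) dg)) /cst mul0r addr0.
Qed.

Lemma lap_lin m k c f g x : psymbol m.+2 k f -> psymbol m.+2 k g -> pball x ->
  lap (fun y => f y + c * g y) x = lap f x + c * lap g x.
Proof.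
move=> sf sg xB; rewrite /lap mulr_sumr -big_split /=; apply: eq_bigr => i _.
have E y : pball y -> partial i (fun z => f z + c * g z) y = partial i f y + c * partial i g y.
  exact: (partial_lin _ _ sf sg).
apply: (etrans (partial_ext i E xB)).
exact: (partial_lin _ _ (psymbol_partial i sf) (psymbol_partial i sg) xB).
Qed.

Lemma gradlap_lin c f g i x : psymbol 3 0 f -> psymbol 3 0 g -> pball x ->
  gradlap i (fun y => f y + c * g y) x = gradlap i f x + c * gradlap i g x.
Proof.
move=> sf sg xB; rewrite /gradlap.
have E y : pball y -> lap (fun z => f z + c * g z) y = lap f y + c * lap g y.
  exact: (lap_lin _ sf sg).
apply: (etrans (partial_ext i E xB)).
exact: (partial_lin _ _ (psymbol_lap sf) (psymbol_lap sg) xB).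
Qed.

Lemma gradlap_ext f g i x : (forall y, pball y -> f y = g y) -> pball x ->
  gradlap i f x = gradlap i g x.
Proof.
move=> fg xB; have E y : pball y -> lap f y = lap g y by exact: lap_ext.
exact: partial_ext E xB.
Qed.

Lemma T3C f g : T3 f g = T3 g f.
Proof. rewrite !T3E; apply: (congr1 ball_int); apply/funext => x; apply: eq_bigr => i _.
exact: mulrC. Qed.

Lemma T3_ext f f' g g' : psymbol 3 0 f -> psymbol 3 0 g ->
  (forall y, pball y -> f y = f' y) -> (forall y, pball y -> g y = g' y) ->
  T3 f g = T3 f' g'.
Proof.
move=> sf sg ff gg; rewrite !T3E; apply: (ball_int_eq n7 (psymbol_T3 sf sg)) => x xB.
apply: eq_bigr => i _; have Ef := gradlap_ext i ff xB.
by have Eg := gradlap_ext i gg xB; rewrite Ef Eg.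
Qed.

Lemma T3_linl c f g h : psymbol 3 0 f -> psymbol 3 0 g -> psymbol 3 0 h ->
  T3 (fun y => f y + c * g y) h = T3 f h + c * T3 g h.
Proof.
move=> sf sg sh.
have sgh := psymbol_T3 sg sh; have sfh := psymbol_T3 sf sh.
rewrite !T3E -(ball_intZ n7 c sgh) -(ball_intD n7 sfh (psymbolZ c sgh)).
apply: (ball_int_eq n7 (m := 0)).
  by apply: (psymbol_T3 _ sh); exact: (psymbolD sf (psymbolZ c sg)).
move=> x xB; rewrite mulr_sumr -big_split; apply: eq_bigr => i _ /=.
apply: (etrans (congr1 (fun a => a * gradlap i h x) (gradlap_lin c i sf sg xB))).
by rewrite mulrDl mulrA.
Qed.

Lemma T3_linr c f g h : psymbol 3 0 f -> psymbol 3 0 g -> psymbol 3 0 h ->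
  T3 h (fun y => f y + c * g y) = T3 h f + c * T3 h g.
Proof. move=> sf sg sh; have E := T3_linl c sf sg sh.
apply: (etrans (T3C _ _)); apply: (etrans E).
by rewrite (T3C f h) (T3C g h). Qed.

Lemma T3_0l (f : 'rV[R]_n -> R) : psymbol 3 0 f -> T3 (cst 0) f = 0.
Proof.
move=> sf; have s0 : psymbol 3 0 (cst 0 : 'rV[R]_n -> R) := psymbol_const 3 0 0.
have := T3_linl 1 s0 s0 sf.
have -> : (fun y : 'rV[R]_n => cst 0 y + 1 * cst 0 y) = cst 0 :> ('rV[R]_n -> R).
  by apply/funext => y; rewrite /cst mulr0 addr0.
by rewrite mul1r; move: (T3 (cst 0) f) => t h; lra.
Qed.

Lemma T3_sqr_lin c f g : psymbol 3 0 f -> psymbol 3 0 g ->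
  T3 (fun y => f y + c * g y) (fun y => f y + c * g y) =
  T3 f f + 2 * c * T3 f g + c ^+ 2 * T3 g g.
Proof.
move=> sf sg; have sfg : psymbol 3 0 (fun y => f y + c * g y).
  exact: (psymbolD sf (psymbolZ c sg)).
have E1 := T3_linl c sf sg sfg; have E2 := T3_linr c sf sg sf.
have E3 := T3_linr c sf sg sg; have E4 := T3C g f.
apply: (etrans E1); move: E2 E3 E4.
move: (T3 f (fun y => f y + c * g y)) (T3 g (fun y => f y + c * g y)) => a b -> -> ->.
by ring.
Qed.

End energy_form.

(** * The components of the equator map *)

Section equator.
Context {R : realType} {n : nat}.
Hypothesis n7 : (7 <= n)%N.
Implicit Types (f g h : 'rV[R]_n -> R) (x y : 'rV[R]_n) (i : 'I_n) (j : 'I_(n + 1)).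
Local Notation B := (@unit_ball R n).
Local Notation u j := (component (@equator_map R n) j).

Lemma equator_lshift i : u (lshift 1 i) = unitv i.
Proof.
by apply/funext => x; rewrite /component /equator_map row_mxEl mxE mulrC.
Qed.

Lemma equator_rshift k : u (rshift n k) = cst 0.
Proof. by apply/funext => x; rewrite /component /equator_map row_mxEr mxE. Qed.

Lemma psymbol_equator m j : psymbol m 0 (u j).
Proof.
case: (fintype.splitP j) => [i ji|k jk].
  rewrite (_ : j = lshift 1 i) ?equator_lshift; last exact/val_inj.
  exact: psymbol_unitv.
rewrite (_ : j = rshift n k) ?equator_rshift; last exact/val_inj.
exact: psymbol_const.
Qed.

Lemma sum_equator_sqr x : pball x -> \sum_j u j x ^+ 2 = 1.
Proof.
move=> xB; rewrite big_split_ord /= big_ord1 equator_rshift /= expr0n addr0.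
rewrite -[RHS](sum_unitv_sqr xB); apply: eq_bigr => i _.
by rewrite equator_lshift.
Qed.

Lemma sobolev_sphere_equator : sobolev_sphere 3 (@equator_map R n).
Proof.
split=> [j|]; first exact: (psymbol_sobolev n7 (leqnn 3) (psymbol_equator 3 j)).
apply: filterS (ae_pball n7) => x H /H xB.
by rewrite /unit_sphere /= /enorm (sum_equator_sqr xB) sqrtr1.
Qed.

Variable K : set 'rV[R]_n.
Hypotheses (cK : compact K) (KB : K `<=` B).

Lemma T3_equator j f : psymbol 3 0 f -> (forall x, pball x -> ~ K x -> f x = 0) ->
  T3 (u j) f = @lam R n * ball_int (fun x => rho x ^+ 6 * (u j x * f x)).
Proof.
move=> sf f0; case: (fintype.splitP j) => [i ji|k jk].
  rewrite (_ : j = lshift 1 i) ?equator_lshift; last exact/val_inj.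
  exact: (T3_unitv n7 cK KB i sf f0).
rewrite (_ : j = rshift n k) ?equator_rshift; last exact/val_inj.
rewrite (T3_0l n7 sf) [X in ball_int X](_ : _ = cst 0).
  by rewrite ball_intE Rintegral_cst ?mul0r ?mulr0//; exact: measurable_unit_ball.
by apply/funext => x; rewrite /cst mul0r mulr0.
Qed.

End equator.

(** The accounting of errors in the minimality proof. Here E, Ev, T are the energies of u, v and u -
    phi, S is the squared Sobolev norm of z, G the integral of rho^6 (|phi|^2 - 2 u . phi), V the
    volume of the ball and tau the truncation error. The volume term, tau and the terms in S cost at
    most k/4 each. L = l + 1 replaces l to keep the denominator of e positive. *)
Lemma perturbation_arith {R : realFieldType} (E Ev l G T S d k M V tau c N : R) :
  let L := l + 1 in
  let e := k / (4 * L * M * (V + 1)) in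
  let Q := L * (M * (e^-1 * c)) + d^-1 * N + 1 in
  0 < d -> d < 1 -> 0 < k -> 0 <= l -> 0 < M -> 0 <= V -> 0 <= tau ->
  0 <= N -> 0 <= c -> 0 <= S -> L * tau <= k / 4 -> Q * S <= k / 4 ->
  (1 - d) * T - d^-1 * (N * S) <= Ev ->
  - (M * (e * V + e^-1 * (c * S)) + tau) <= G -> E + l * G <= T ->
  (1 - d) * E <= Ev + k.
Proof.
move=> L e Q d0 d1 k0 l0 M0 V0 tau0 N0 c0 S0 Lt Ss h1 h2 h3.
have L0 : 0 < L by rewrite /L; lra.
have V1 : 0 < V + 1 by lra.
have e0 : 0 < e by rewrite /e divr_gt0// !mulr_gt0.
have eV : L * (M * (e * V)) <= k / 4.
  have -> : L * (M * (e * V)) = k / 4 * (V / (V + 1)).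
    by rewrite /e; field; rewrite !gt_eqF.
  by rewrite ger_pMr ?divr_gt0// ler_pdivrMr ?mul1r; lra.
pose Y := M * (e^-1 * (c * S)).
have ei : 0 < e^-1 by rewrite invr_gt0.
have Y0 : 0 <= Y by apply: mulr_ge0; [exact: ltW|apply: mulr_ge0; [exact: ltW|exact: mulr_ge0]].
have U0 : 0 <= M * (e * V) by apply: mulr_ge0; [exact: ltW|apply: mulr_ge0; [exact: ltW|]].
have h4 : - (M * (e * V) + Y + tau) <= G by move: h2; rewrite mulrDr.
have QE : Q * S = L * Y + d^-1 * (N * S) + S by rewrite /Q /Y; ring.
have LY : 0 <= L * Y by rewrite mulr_ge0// ltW.
have LU : 0 <= L * (M * (e * V)) by rewrite mulr_ge0// ltW.
have LT : 0 <= L * tau by rewrite mulr_ge0// ltW.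
have h5 : - (L * (M * (e * V)) + L * Y + L * tau) <= l * G.
  by have := ler_wpM2l l0 h4; apply: le_trans; rewrite /L; lra.
clear h2 h4.
set P := L * (M * (e * V)) + L * Y + L * tau in h5.
have P0 : 0 <= P by rewrite /P !addr_ge0.
have h6 : (1 - d) * (E - P) <= (1 - d) * T.
  by apply: ler_wpM2l; lra.
have h7 : (1 - d) * P <= P by apply: ler_piMl => //; lra.
have h8 : P + d^-1 * (N * S) <= 3 * (k / 4) by rewrite /P; lra.
have k4 : 3 * (k / 4) <= k by lra.
rewrite mulrBr in h6; clear -h1 h6 h7 h8 k4.
move: (d^-1 * (N * S)) ((1 - d) * E) ((1 - d) * P) ((1 - d) * T) h1 h6 h7 h8 => a b p t *.
lra.
Qed.

Lemma le_of_scaled_approx {R : realFieldType} (a b : R) : 0 <= a ->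
  (forall d k : R, 0 < d -> d < 1 -> 0 < k -> (1 - d) * a <= b + k) -> a <= b.
Proof.
move=> E0 key.
apply/ler_addgt0Pr => k k0.
pose d := k / (2 * (a + 1 + k)).
have d0 : 0 < d by rewrite /d divr_gt0// mulr_gt0//; lra.
have d1 : d < 1 by rewrite /d ltr_pdivrMr ?mul1r ?mulr_gt0//; lra.
have := key d (k / 2) d0 d1 ltac:(lra).
have : d * a <= k / 2.
  have -> : d * a = k / 2 * (a / (a + 1 + k)).
    by rewrite /d; field; rewrite gt_eqF//; lra.
  by rewrite ger_pMr ?ler_pdivrMr ?mul1r; lra.
lra.
Qed.

Section minimality.
Context {R : realType} {n : nat}.
Hypothesis n7 : (7 <= n)%N.
Implicit Types (f g h : 'rV[R]_n -> R) (x y : 'rV[R]_n).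
Local Notation mu := (@lebesgue_rV R n).
Local Notation B := (@unit_ball R n).
Local Notation u := (@equator_map R n).
Let mB : measurable B := @measurable_unit_ball R n.

Lemma L2_integrable f : L2_ball f -> mu.-integrable B (EFin \o (fun x => f x ^+ 2)).
Proof.
move=> [mf foo]; apply/integrableP; split.
  by apply/measurable_EFinP; exact: measurable_funX.
apply: le_lt_trans foo; rewrite le_eqVlt; apply/orP; left; apply/eqP.
by apply: eq_integral => x _; rewrite /= ger0_norm ?sqr_ge0.
Qed.

Lemma integrable_L2 f : measurable_fun B f ->
  mu.-integrable B (EFin \o (fun x => f x ^+ 2)) -> L2_ball f.
Proof.
move=> mf /integrableP[_ foo]; split=> //; apply: le_lt_trans foo.
rewrite le_eqVlt; apply/orP; left; apply/eqP.
by apply: eq_integral => x _; rewrite /= ger0_norm ?sqr_ge0.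
Qed.

Lemma dom_integrable f g : measurable_fun B f -> mu.-integrable B (EFin \o g) ->
  (forall x, B x -> `|f x| <= g x) -> mu.-integrable B (EFin \o f).
Proof.
move=> mf ig fg; apply: (le_integrable mB _ _ ig); first exact/measurable_EFinP.
by move=> x xB; rewrite /= lee_fin (le_trans (fg x xB))// ler_norm.
Qed.

Lemma weak_partial_L2 s f : (size s <= 3)%N -> sobolev 3 f ->
  weak_derivative s f (weak_partial s f) /\ L2_ball (weak_partial s f).
Proof.
move=> s3 /(_ s s3)[g fg [mg goo]]; have wg := weak_partialP fg; split => //.
have [_ [mw _] _] := wg; split => //; apply: le_lt_trans goo.
rewrite le_eqVlt; apply/orP; left; apply/eqP.
apply: ge0_ae_eq_integral => //.
- by apply/measurable_EFinP; exact: measurable_funX.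
- by apply/measurable_EFinP; exact: measurable_funX.
- by move=> x _; rewrite lee_fin sqr_ge0.
- by move=> x _; rewrite lee_fin sqr_ge0.
by apply: filterS (weak_partial_ae fg) => x H xB; rewrite /= H.
Qed.

Lemma sobolev_sub f g : sobolev 3 f -> sobolev 3 g -> sobolev 3 (fun x => f x - g x).
Proof.
move=> sf sg s s3; have [f' ff [mf f2]] := sf s s3; have [g' gg [mg g2]] := sg s s3.
exists (fun x => f' x - g' x); first exact: weak_derivativeB.
have If := L2_integrable (conj mf f2); have Ig := L2_integrable (conj mg g2).
apply: integrable_L2; first exact: measurable_funB.
apply: (le_integrable mB _ _ (integrableD mB (integrableZl mB 2 If) (integrableZl mB 2 Ig))).
  by apply/measurable_EFinP; apply: measurable_funX; exact: measurable_funB.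
move=> x _; rewrite /comp -!EFinM -EFinD lee_fin ger0_norm ?sqr_ge0// ger0_norm.
  by have := sqr_ge0 (f' x + g' x); rewrite !expr2; lra.
by have := sqr_ge0 (f' x); have := sqr_ge0 (g' x); lra.
Qed.

Lemma sobolev_test (phi : 'rV[R]_n -> R) : test_function phi -> sobolev 3 phi.
Proof. by move=> /(test_psymbol 3); exact: psymbol_sobolev. Qed.

Lemma psymbol_lap_test m (phi : 'rV[R]_n -> R) : test_function phi -> psymbol m 0 (lap phi).
Proof.
move=> tphi; have s k : psymbol m 0 (partial k (partial k phi)).
  exact: (test_psymbol m (partial_test k (partial_test k tphi))).
exact: psymbol_sum s.
Qed.

Lemma sobolev_norm_term m k (w : 'rV[R]_n -> 'rV[R]_m) (j : 'I_m) s : (size s <= k)%N ->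
  \int[mu]_(x in B) (weak_partial s (component w j) x ^+ 2) <= sobolev_norm k w ^+ 2.
Proof.
move=> sk; pose F (j : 'I_m) (s : seq 'I_n) := \int[mu]_(x in B) (weak_partial s (component w j) x ^+ 2).
have F0 (a : 'I_m) b : 0 <= F a b by apply: Rintegral_ge0 => x _; exact: sqr_ge0.
have S0 : 0 <= \sum_(j < m) \sum_(l < k.+1) \sum_(s : l.-tuple 'I_n) F j s.
  by do 3![apply: sumr_ge0 => ? _]; exact: F0.
rewrite /sobolev_norm sqr_sqrtr// (bigD1 j)//=.
have slt : (size s < k.+1)%N by rewrite ltnS.
apply: ler_wpDr; first by do 3![apply: sumr_ge0 => ? _]; exact: F0.
rewrite (bigD1 (Ordinal slt))//=.
apply: ler_wpDr; first by do 2![apply: sumr_ge0 => ? _]; exact: F0.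
by rewrite (bigD1 (in_tuple s))//= lerDl; apply: sumr_ge0 => ? _; exact: F0.
Qed.

(** The error z is controlled in L^2 without weight, so [rho ^+ 6] is cut at a level M before it
    meets |z|^2; dominated convergence makes the discarded part small. *)
Lemma truncation_cvg (e : R) : 0 < e -> exists2 M : R, 0 < M &
  ball_int (fun x : 'rV[R]_n => rho x ^+ 6 - Num.min (rho x ^+ 6) M) <= e.
Proof.
move=> e0; have i6 := @integrable_rho6 R n n7.
have m6 : measurable_fun B (fun x : 'rV[R]_n => rho x ^+ 6).
  by apply/measurable_EFinP; case/integrableP : i6.
pose f_ (k : nat) (x : 'rV[R]_n) := rho x ^+ 6 - Num.min (rho x ^+ 6) k.+1%:R.
have mf k : measurable_fun B (fun x => (f_ k x)%:E).
  by apply/measurable_EFinP; apply: measurable_funB => //; exact: measurable_minr.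
have cv : {ae mu, forall x, B x -> (f_ k x)%:E @[k --> \oo] --> (cst 0%E) x}.
  apply: aeW => x xB; apply: cvg_near_cst.
  exists (Num.bound (rho x ^+ 6)) => // k /= kb; rewrite /f_ min_l ?subrr//.
  have := archi_boundP (exprn_ge0 6 (rho_ge0 x)) => /ltW /le_trans; apply.
  by rewrite ler_nat (leq_trans kb).
have dom : {ae mu, forall x k, B x -> (`|(f_ k x)%:E| <= (rho x ^+ 6)%:E)%E}.
  apply: aeW => x k _; rewrite lee_fin /f_ ger0_norm ?subr_ge0 ?ge_min ?lexx//.
  by rewrite gerBl le_min exprn_ge0 ?rho_ge0 ?ler0n.
have [_ _] := dominated_convergence mB mf (measurable_cst 0%E) cv i6 dom.
rewrite integral0 => /fine_cvgP[_ /cvgrPdist_le /(_ e e0)[k _ /(_ k (leqnn _))]].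
rewrite /= sub0r normrN => H; exists k.+1%:R; first by rewrite ltr0n.
by rewrite ball_intE; exact: le_trans (ler_norm _) H.
Qed.

Lemma ball_int_sum_integrable (I : finType) (F : I -> 'rV[R]_n -> R) :
  (forall j, mu.-integrable B (EFin \o F j)) ->
  mu.-integrable B (EFin \o (fun x => \sum_j F j x)) /\
  ball_int (fun x => \sum_j F j x) = \sum_j ball_int (F j).
Proof.
move=> iF; rewrite ball_intE; under [in RHS]eq_bigr do rewrite ball_intE.
elim: (index_enum I) => [|j r [IH1 IH2]].
  under [X in EFin \o X]eq_fun do rewrite big_nil.
  under eq_Rintegral do rewrite big_nil.
  rewrite big_nil Rintegral_cst// mul0r; split=> //.
  rewrite [X in integrable _ _ X](_ : _ = cst 0%E); last exact/funext.
  exact: integrable0.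
under [X in EFin \o X]eq_fun do rewrite big_cons.
under eq_Rintegral do rewrite big_cons.
rewrite big_cons RintegralD// IH2; split=> //.
exact: (integrableD mB (iF j) IH1).
Qed.

Lemma le_ball_int_ae f g : mu.-integrable B (EFin \o f) -> mu.-integrable B (EFin \o g) ->
  {ae mu, forall x, B x -> f x <= g x} -> ball_int f <= ball_int g.
Proof.
move=> intf intg fg; rewrite -subr_ge0 !ball_intE -RintegralB//.
have mf : measurable_fun B f by apply/measurable_EFinP; case/integrableP : intf.
have mg : measurable_fun B g by apply/measurable_EFinP; case/integrableP : intg.
have mgf := measurable_funB mg mf.
rewrite (Rintegral_ae (g := fun x => `|g x - f x|) mgf).
- by apply: Rintegral_ge0 => x _; exact: normr_ge0.
- exact: measurableT_comp.
by apply: filterS fg => x H xB; rewrite ger0_norm// subr_ge0 H.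
Qed.

(** The constant 2^p is cruder than that of Cauchy-Schwarz, but it only multiplies a norm that is
    made arbitrarily small. *)
Lemma sqr_sum_le (p : nat) (a : 'I_p -> R) :
  (\sum_j a j) ^+ 2 <= 2 ^+ p * \sum_j a j ^+ 2.
Proof.
elim: p a => [|p IH] a; first by rewrite !big_ord0 expr0n mulr0.
rewrite !big_ord_recr /=; have := IH (fun j => a (widen_ord (leqnSn p) j)).
set S := \sum_(_ < p) _; set Q := \sum_(_ < p) _; set b := a _ => H.
have Q0 : 0 <= Q by apply: sumr_ge0 => j _; exact: sqr_ge0.
have p1 : 1 <= 2 ^+ p :> R by rewrite exprn_ege1// ler1n.
have b0 := sqr_ge0 b.
apply: (@le_trans _ _ (2 * S ^+ 2 + 2 * b ^+ 2)).
  by have := sqr_ge0 (S - b); rewrite !expr2; lra.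
rewrite [2 ^+ p.+1]exprS -[leRHS]mulrA -mulrDr ler_wpM2l// mulrDr lerD//.
by rewrite ler_peMl.
Qed.

(** Pointwise (a - b)^2 >= (1 - d) a^2 - b^2/d, with a the i-th derivative of lap w_j and b the sum
    over k of the third weak derivatives [k; k; i] of z_j. The numerical factors come from the
    components, the directions and the square of that sum. *)
Lemma E3ext_perturbation m (w z v : 'rV[R]_n -> 'rV[R]_m) (d : R) : 0 < d ->
  (forall j, psymbol 3 0 (component w j)) -> sobolev_map 3 z -> sobolev_map 3 v ->
  (forall j, component v j = (fun x => component w j x - component z j x)) ->
  (1 - d) * (\sum_j T3 (component w j) (component w j)) -
    d^-1 * (m%:R * (n%:R * (2 ^+ n * (n%:R * sobolev_norm 3 z ^+ 2)))) <= E3ext v.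
Proof.
move=> d0 sw sz sv vwz.
pose P j i k x := weak_partial [:: k; k; i] (component z j) x.
pose c j i x := \sum_k P j i k x.
pose A j i x := gradlap i (component w j) x.
have PL j i k : weak_derivative [:: k; k; i] (component z j) (P j i k) /\ L2_ball (P j i k).
  exact: weak_partial_L2.
have mP j i k : measurable_fun B (P j i k) by have [_ []] := PL j i k.
have mc j i : measurable_fun B (c j i) by exact: measurable_sum.
have mA j i : measurable_fun B (A j i) by exact: measurable_psymbol (psymbol_gradlap i (sw j)).
have wd j i k : weak_derivative [:: k; k; i] (component v j)
    (fun x => iter_partial [:: i; k; k] (component w j) x - P j i k x).
  rewrite vwz; apply: weak_derivativeB (PL j i k).1.
  exact: (psymbol_weak_derivative n7 (k := 0) (s := [:: k; k; i]) (leqnn 3) isT (sw j)).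
have wg j i := weak_gradlap_ae (sv j) (wd j i).
have Ev : E3ext v = ball_int (fun x => \sum_j \sum_i (A j i x - c j i x) ^+ 2).
  rewrite ball_intE; apply: E3ext_ae.
  - by move=> j i; have [[_ [mw _] _] _] := wg j i.
  - by move=> j i; exact: measurable_funB.
  move=> j i; have [_ wE] := wg j i.
  apply: filterS2 wE (ae_pball n7) => x H xp xB.
  rewrite H// sumrB; congr (_ - _); rewrite /A gradlapE//; exact: xp.
have iP j i k := L2_integrable (PL j i k).2.
have [iSP SPE] : (forall j i, mu.-integrable B (EFin \o (fun x => \sum_k P j i k x ^+ 2))) /\
    (forall j i, ball_int (fun x => \sum_k P j i k x ^+ 2) = \sum_k ball_int (fun x => P j i k x ^+ 2)).
  by split=> j i; have [] := ball_int_sum_integrable (iP j i).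
have iA j i : mu.-integrable B (EFin \o (fun x => A j i x ^+ 2)).
  apply: L2_integrable.
  exact: (psymbol_L2 n7 (leqnn 3) (psymbol_gradlap i (sw j))).
have ic j i : mu.-integrable B (EFin \o (fun x => c j i x ^+ 2)).
  apply: dom_integrable (integrableZl mB (2 ^+ n) (iSP j i)) _; first exact: measurable_funX.
  by move=> x xB; rewrite ger0_norm ?sqr_ge0//; exact: sqr_sum_le.
have iAc j i : mu.-integrable B (EFin \o (fun x => (A j i x - c j i x) ^+ 2)).
  apply: dom_integrable (integrableD mB (integrableZl mB 2 (iA j i)) (integrableZl mB 2 (ic j i))) _.
    by apply: measurable_funX; exact: measurable_funB.
  move=> x xB; rewrite ger0_norm ?sqr_ge0//.
  by have := sqr_ge0 (A j i x + c j i x); rewrite /= !expr2; lra.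
set X := n%:R * (2 ^+ n * (n%:R * _)).
have cX j i : ball_int (fun x => c j i x ^+ 2) <= 2 ^+ n * (n%:R * sobolev_norm 3 z ^+ 2).
  apply: (@le_trans _ _ (ball_int (fun x => 2 ^+ n * \sum_k P j i k x ^+ 2))).
    apply: le_ball_int_ae => //; first exact: (integrableZl mB (2 ^+ n) (iSP j i)).
    by apply: aeW => x xB; exact: sqr_sum_le.
  rewrite ball_intE RintegralZl// -ball_intE SPE ler_wpM2l ?exprn_ge0//.
  rewrite -[n in n%:R]card_ord mulr_natl -sumr_const; apply: ler_sum => k _.
  by rewrite ball_intE; exact: (@sobolev_norm_term m 3 z j [:: k; k; i]).
have lo j i : (1 - d) * ball_int (fun x => A j i x ^+ 2) -
    d^-1 * ball_int (fun x => c j i x ^+ 2) <= ball_int (fun x => (A j i x - c j i x) ^+ 2).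
  have i1 := integrableZl mB (1 - d) (iA j i); have i2 := integrableZl mB d^-1 (ic j i).
  rewrite !ball_intE -!RintegralZl// -RintegralB// -!ball_intE.
  apply: le_ball_int_ae => //; first exact: (integrableB mB i1 i2).
  apply: aeW => x xB; set a := A j i x; set b := c j i x.
  have := sqr_ge0 (d * a - b); rewrite -(pmulr_rge0 _ (_ : 0 < d^-1)) ?invr_gt0//.
  have -> : d^-1 * (d * a - b) ^+ 2 = d * a ^+ 2 - 2 * a * b + d^-1 * b ^+ 2.
    by field; rewrite gt_eqF.
  by have := sqr_ge0 b; rewrite !expr2; lra.
have [_ E1] := ball_int_sum_integrable (fun j => (ball_int_sum_integrable (iAc j)).1).
rewrite Ev E1 mulr_sumr -[m in m%:R]card_ord mulr_natl -sumr_const mulr_sumr -sumrB.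
apply: ler_sum => j _; have [_ E2] := ball_int_sum_integrable (iAc j); rewrite E2.
have [_ E3] := ball_int_sum_integrable (iA j).
have E4 : T3 (component w j) (component w j) = \sum_i ball_int (fun x => A j i x ^+ 2).
  by rewrite -E3 T3E; apply: (congr1 ball_int); apply/funext => x; apply: eq_bigr.
rewrite E4 mulr_sumr /X -[n in n%:R]card_ord mulr_natl -sumr_const mulr_sumr -sumrB.
apply: ler_sum => i _; apply: le_trans (lo j i); rewrite lerB//.
by apply: ler_wpM2l; [rewrite invr_ge0 ltW|rewrite card_ord; exact: cX].
Qed.

Lemma sobolev_norm_L2 m k (w : 'rV[R]_n -> 'rV[R]_m) (j : 'I_m) :
  (k <= 3)%N -> sobolev_map k w ->
  mu.-integrable B (EFin \o (fun x => component w j x ^+ 2)) /\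
  ball_int (fun x => component w j x ^+ 2) <= sobolev_norm k w ^+ 2.
Proof.
move=> k3 sw; have [g wg Lg] := sw j [::] isT.
have lw : locally_integrable_ball (component w j) by case: wg.
have ww : weak_derivative [::] (component w j) (component w j).
  by split=> // phi _; rewrite expr0 mul1r.
have mw : measurable_fun B (component w j) by case: lw.
have mg : measurable_fun B g by case: Lg.
have mp : measurable_fun B (weak_partial [::] (component w j)).
  by have [_ [mp _] _] := weak_partialP ww.
have wpE := weak_partial_ae ww; have wpg := weak_partial_ae wg.
split; last first.
  rewrite ball_intE; apply: le_trans (@sobolev_norm_term m k w j [::] isT).
  rewrite le_eqVlt; apply/orP; left; apply/eqP.
  apply: Rintegral_ae; try exact: measurable_funX.
  by apply: filterS wpE => x H xB; rewrite H.
apply/integrableP; split; first by apply/measurable_EFinP; exact: measurable_funX.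
have [_ goo] := Lg; apply: le_lt_trans goo; rewrite le_eqVlt; apply/orP; left; apply/eqP.
apply: ge0_ae_eq_integral => //.
- by apply: measurableT_comp => //; apply/measurable_EFinP; exact: measurable_funX.
- by apply/measurable_EFinP; exact: measurable_funX.
- by move=> x _; rewrite lee_fin sqr_ge0.
apply: filterS2 wpE wpg => x H1 H2 xB.
by rewrite /= ger0_norm ?sqr_ge0// -H1// H2.
Qed.

(* For [z = 0] the right-hand side integrates [rho ^+ 6 * (|u - phi| ^+ 2 - 1)],
   which vanishes as [|v| = 1].  In general [|u - phi| ^+ 2 - 1] is bounded below
   both by [-1], which is used where [rho ^+ 6] exceeds [M], and by a multiple of
   [- (e + |z| ^+ 2 / e)]. *)
Lemma weight_lower_bound (phi z v : 'rV[R]_n -> 'rV[R]_(n + 1)) (M e : R) :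
  0 < M -> 0 < e -> test_map phi -> sobolev_map 3 z -> sobolev_sphere 3 v ->
  (forall x, v x = u x - phi x - z x) ->
  - (M * (e * ball_int (cst 1 : 'rV[R]_n -> R) +
          e^-1 * ((n + 1)%:R * sobolev_norm 3 z ^+ 2)) +
     ball_int (fun x : 'rV[R]_n => rho x ^+ 6 - Num.min (rho x ^+ 6) M)) <=
  ball_int (fun x => \sum_j rho x ^+ 6 *
     (component phi j x ^+ 2 - 2 * (component u j x * component phi j x))).
Proof.
move=> M0 e0 tphi sz [sv vS] vE.
have i6 := @integrable_rho6 R n n7.
have m6 : measurable_fun B (fun x : 'rV[R]_n => rho x ^+ 6).
  by apply/measurable_EFinP; case/integrableP : i6.
have i1 : mu.-integrable B (EFin \o (cst 1 : 'rV[R]_n -> R)).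
  exact: (integrable_psymbol n7 (leq0n 6) (psymbol_const 0 0 1)).
have iM : mu.-integrable B (EFin \o (fun x : 'rV[R]_n => rho x ^+ 6 - Num.min (rho x ^+ 6) M)).
  apply: (dom_integrable _ i6).
    by apply: measurable_funB => //; exact: measurable_minr.
  move=> x xB; rewrite ger0_norm ?subr_ge0 ?ge_min ?lexx//.
  by rewrite gerBl le_min exprn_ge0 ?rho_ge0 ?ltW.
have zL j := @sobolev_norm_L2 _ 3 z j (leqnn 3) sz.
have [iZ ZE] := ball_int_sum_integrable (fun j => (zL j).1).
have iez := integrableD mB (integrableZl mB e i1) (integrableZl mB e^-1 iZ).
have il := integrableD mB (integrableZl mB M iez) iM.
set l := (X in - X <= _).
have lE : ball_int (fun x => M * (e * cst 1 x + e^-1 * \sum_j component z j x ^+ 2) +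
    (rho x ^+ 6 - Num.min (rho x ^+ 6) M)) <= l.
  rewrite ball_intE RintegralD//; last exact: (integrableZl mB M iez).
  rewrite RintegralZl// RintegralD//; [|exact: (integrableZl mB e i1)|exact: (integrableZl mB e^-1 iZ)].
  rewrite !RintegralZl// -!ball_intE ZE /l lerD2r.
  apply: ler_wpM2l; [exact: ltW|rewrite lerD2l].
  apply: ler_wpM2l; first by rewrite invr_ge0 ltW.
  rewrite -[n in n%:R](card_ord (n + 1)) mulr_natl -sumr_const.
  by apply: ler_sum => j _; have [] := zL j.
rewrite lerNl; apply: le_trans lE.
have sg : psymbol 0 6 (fun x => \sum_j rho x ^+ 6 *
     (component phi j x ^+ 2 - 2 * (component u j x * component phi j x))).
  have sg0 j : psymbol 0 6 (fun x => rho x ^+ 6 *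
     (component phi j x ^+ 2 - 2 * (component u j x * component phi j x))).
    have sp := test_psymbol 0 (tphi j).
    have sp2 : psymbol 0 0 (fun x => component phi j x ^+ 2).
      by under eq_fun do rewrite expr2; exact: (psymbolM (k := 0) (l := 0) sp sp).
    have sup := psymbolM (k := 0) (l := 0) (psymbol_equator 0 j) sp.
    exact: (psymbolM (k := 6) (l := 0) (psymbol_rhoX 0 6) (psymbolB sp2 (psymbolZ 2 sup))).
  by apply: (symbol_sum open_pball rho_ge1) => j; exact: sg0.
have ig := integrable_psymbol n7 (leqnn 6) sg.
have E : ball_int (fun x => - 1 * (\sum_j rho x ^+ 6 *
     (component phi j x ^+ 2 - 2 * (component u j x * component phi j x)))) =
   - ball_int (fun x => \sum_j rho x ^+ 6 *
     (component phi j x ^+ 2 - 2 * (component u j x * component phi j x))).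
  by rewrite (ball_intZ n7 _ sg) mulN1r.
rewrite -E; apply: le_ball_int_ae => //; first exact: (integrableZl mB (-1) ig).
apply: filterS2 vS (ae_pball n7) => x vx xp xB.
have {}vx : \sum_j component v j x ^+ 2 = 1.
  by rewrite -enorm_sqr (vx xB : enorm _ = 1) expr1n.
have ux := sum_equator_sqr (xp xB).
set Z := \sum_j component z j x ^+ 2.
pose W := \sum_j (component phi j x ^+ 2 - 2 * (component u j x * component phi j x)).
have uz j : component v j x = component u j x - component phi j x - component z j x.
  by rewrite /component vE !mxE.
(* As |u| = 1, W is |u - phi|^2 - 1. *)
have W1 : -1 <= W.
  rewrite -ux -sumrN; apply: ler_sum => j _.
  have := sqr_ge0 (component u j x - component phi j x); rewrite !expr2; lra.
(* As u - phi = v + z and |v| = 1, W is 2 v . z + |z|^2, and Young's inequality bounds 2 v . z below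
   by - e |v|^2 - |z|^2 / e. *)
have W2 : - (e + e^-1 * Z) <= W.
  rewrite -[X in X + _]mulr1 -[X in e * X]vx !mulr_sumr -big_split -sumrN /=.
  rewrite -[W](addrK 1) -[X in _ <= _ + X - _]ux /W -big_split -[X in _ <= _ - X]vx -sumrB.
  apply: ler_sum => j _ /=; rewrite uz.
  set a := component u j x; set b := component phi j x; set q := component z j x.
  have : 0 <= e^-1 * (e * (a - b - q) + q) ^+ 2 by rewrite mulr_ge0 ?sqr_ge0// invr_ge0 ltW.
  have -> : e^-1 * (e * (a - b - q) + q) ^+ 2 =
    e * (a - b - q) ^+ 2 + 2 * (a - b - q) * q + e^-1 * q ^+ 2 by field; rewrite gt_eqF.
  have := sqr_ge0 q; rewrite !expr2; lra.
rewrite -mulr_sumr -/W mulr1.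
set r := rho x ^+ 6; have r0 : 0 <= r by rewrite exprn_ge0 ?rho_ge0.
set m := Num.min r M.
have m0 : 0 <= m by rewrite /m le_min r0 ltW.
have mr : m <= r by rewrite /m ge_min lexx.
have mM : m <= M by rewrite /m ge_min lexx orbT.
have Z0 : 0 <= e + e^-1 * Z.
  apply: addr_ge0; first exact: ltW.
  apply: mulr_ge0; first by rewrite invr_ge0 ltW.
  by apply: sumr_ge0 => j _; exact: sqr_ge0.
(* The weight splits as r = (r - m) + m: the bound -1 is applied to the excess over M, the other
   bound to the part m <= M. *)
have h1 : 0 <= (r - m) * (W + 1) by apply: mulr_ge0; lra.
have h2 : 0 <= m * (W + (e + e^-1 * Z)) by apply: mulr_ge0; lra.
have h3 : 0 <= (M - m) * (e + e^-1 * Z) by apply: mulr_ge0; lra.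
lra.
Qed.

Lemma minimizing_equator : (12 <= n)%N -> minimizing u.
Proof.
move=> n12.
have arith (l a b p q : R) : l * p <= b ->
    a + l * (p - 2 * q) <= a + 2 * -1 * (l * q) + (-1) ^+ 2 * b.
  by move=> H; rewrite sqrrN expr1n; lra.
have arith4 (a b : R) : b != 0 -> b * (a / (4 * b)) = a / 4 by move=> b0; field.
move=> v [sv vS] [suv apx].
have su := @psymbol_equator R n 3.
have Eu := E3ext_psymbol n7 su.
have E0 : 0 <= E3ext u by rewrite Eu; apply: sumr_ge0 => j _; rewrite T3E ball_intE;
  apply: Rintegral_ge0 => x _; apply: sumr_ge0 => i _; rewrite -expr2 sqr_ge0.
have lam0 : 0 <= @lam R n.
  have n12' : 12 <= n%:R :> R by rewrite ler_nat.
  by rewrite /lam !mulr_ge0//; lra.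
pose V := ball_int (cst 1 : 'rV[R]_n -> R).
have V0 : 0 <= V by rewrite /V ball_intE; apply: Rintegral_ge0 => x _; exact: ler01.
(* An approximate inequality, with a factor 1 - d from Young's inequality and an error k; both
   disappear at the end by letting d and k tend to 0. *)
have key (d k : R) : 0 < d -> d < 1 -> 0 < k -> (1 - d) * E3ext u <= E3ext v + k.
  move=> d0 d1 k0.
  pose L := @lam R n + 1; have L0 : 0 < L by rewrite /L; lra.
  (* The order of choice matters: M from k, then e from M, then the accuracy s from d, M and e, and
     the test map phi last. What phi misses of u - v is z, so that v = u - phi - z. *)
  have [M M0 tM] := @truncation_cvg (k / (4 * L)) ltac:(by rewrite divr_gt0// mulr_gt0).
  pose e := k / (4 * L * M * (V + 1)).
  have e0 : 0 < e by rewrite /e divr_gt0// !mulr_gt0//; lra.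
  pose N := (n + 1)%:R * (n%:R * (2 ^+ n * n%:R)) : R.
  have N0 : 0 <= N by rewrite /N !mulr_ge0// exprn_ge0.
  pose Q := L * (M * (e^-1 * (n + 1)%:R)) + d^-1 * N + 1.
  have Q0 : 0 < Q.
    rewrite /Q ltr_wpDl// addr_ge0//; last by rewrite mulr_ge0// invr_ge0 ltW.
    by rewrite !mulr_ge0// ?invr_ge0 ltW.
  pose s := Num.sqrt (k / (4 * Q)).
  have kQ0 : 0 < k / (4 * Q) by rewrite divr_gt0// mulr_gt0.
  have s0 : 0 < s by rewrite sqrtr_gt0.
  have [phi tphi] := apx s s0; set z := (u \- v) \- phi => zs.
  have sz : sobolev_map 3 z.
    move=> j; have -> : component z j = fun x => component (u \- v) j x - component phi j x.
      by apply/funext => x; rewrite /component /z /= mxE [X in _ + X]mxE.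
    by apply: sobolev_sub; [exact: suv|exact: sobolev_test].
  pose w : 'rV[R]_n -> 'rV[R]_(n + 1) := fun x => u x - phi x.
  have sphi j : psymbol 3 0 (component phi j) by exact: test_psymbol.
  have wE j : component w j = fun y => component u j y + -1 * component phi j y.
    by apply/funext => y; rewrite /component /w !mxE mulN1r.
  have sw j : psymbol 3 0 (component w j).
    by rewrite wE; exact: (psymbolD (su j) (psymbolZ (-1) (sphi j))).
  have vE x : v x = u x - phi x - z x.
    by apply/rowP => i; rewrite /z /= !mxE; ring.
  have vwz j : component v j = (fun x => component w j x - component z j x).
    by apply/funext => x; rewrite /component vE /w [in RHS]mxE [in LHS]mxE [X in _ + X]mxE !mxE.
  have h1 := E3ext_perturbation d0 sw sz sv vwz.
  have h2 := weight_lower_bound M0 e0 tphi sz (conj sv vS) vE.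
  set S := sobolev_norm 3 z ^+ 2 in h1 h2.
  set G := (X in _ <= X) in h2; set T := (X in (1 - d) * X) in h1.
  (* The square is expanded in each component: the equation of u evaluates the cross term, and
     Hardy-Rellich, whose constant is at least [lam] for n >= 12, bounds the term in phi alone. *)
  have h3 : E3ext u + @lam R n * G <= T.
    have sr f : psymbol 0 0 f -> psymbol 0 6 (fun x => rho x ^+ 6 * f x).
      exact: (psymbolM (k := 6) (l := 0) (psymbol_rhoX 0 6)).
    have s1 j : psymbol 0 0 (fun x => component phi j x ^+ 2).
      by have sp := psymbol_order (leq0n 3) (sphi j);
        under eq_fun do rewrite expr2; exact: (psymbolM (k := 0) (l := 0) sp sp).
    have s2 j : psymbol 0 0 (fun x => component u j x * component phi j x).
      exact: (psymbolM (k := 0) (l := 0) (psymbol_equator 0 j) (psymbol_order (leq0n 3) (sphi j))).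
    have sq j : psymbol 0 6 (fun x => rho x ^+ 6 *
        (component phi j x ^+ 2 - 2 * (component u j x * component phi j x))).
      by apply: sr; exact: (psymbolB (s1 j) (psymbolZ 2 (s2 j))).
    rewrite Eu /G (ball_int_sum n7 sq) mulr_sumr -big_split /=; apply: ler_sum => j _.
    have [_ [K [cK KB f0]]] := tphi j.
    have f0' x : pball x -> ~ K x -> component phi j x = 0 by move=> _; exact: f0.
    have E1 := T3_equator n7 cK KB j (sphi j) f0'.
    have E2 := hardy_rellich n7 cK KB (sphi j) (psymbol_lap_test 1 (tphi j)) f0'.
    have E3 : ball_int (fun x => rho x ^+ 6 *
          (component phi j x ^+ 2 - 2 * (component u j x * component phi j x))) =
        ball_int (fun x => rho x ^+ 6 * component phi j x ^+ 2) -
        2 * ball_int (fun x => rho x ^+ 6 * (component u j x * component phi j x)).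
      rewrite -(ball_intZ n7 2 (sr _ (s2 j))).
      rewrite -(ball_intB n7 (sr _ (s1 j)) (psymbolZ 2 (sr _ (s2 j)))).
      by apply: (ball_int_eq n7 (sq j)) => x _; ring.
    have E4 : 0 <= ball_int (fun x => rho x ^+ 6 * component phi j x ^+ 2).
      apply: (ball_int_ge0 n7 (sr _ (s1 j))) => x _.
      by rewrite mulr_ge0 ?sqr_ge0// exprn_ge0 ?rho_ge0.
    have E5 := T3_sqr_lin n7 (-1) (su j) (sphi j).
    rewrite wE E5 E1 E3.
    exact: arith (le_trans (ler_wpM2r E4 (@lam_le_hardy_rellich_constant R n n12)) E2).
  have S0 : 0 <= S by exact: sqr_ge0.
  have Ss : Q * S <= k / 4.
    have -> : k / 4 = Q * s ^+ 2.
      by rewrite /s sqr_sqrtr ?(ltW kQ0)// arith4// gt_eqF.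
    by rewrite ler_wpM2l ?(ltW Q0)// /S ler_sqr ?nnegrE ?sqrtr_ge0// ltW.
  set tau := ball_int _ in tM h2.
  have Lt : L * tau <= k / 4.
    have -> : k / 4 = L * (k / (4 * L)).
      by rewrite arith4// gt_eqF.
    by apply: ler_wpM2l => //; exact: ltW.
  have tau0 : 0 <= tau.
    rewrite /tau ball_intE; apply: Rintegral_ge0 => x _.
    by rewrite subr_ge0 ge_min lexx.
  have NE : (n + 1)%:R * (n%:R * (2 ^+ n * (n%:R * S))) = N * S by rewrite /N !mulrA.
  rewrite NE in h1.
  exact: (perturbation_arith d0 d1 k0 lam0 M0 V0 tau0 N0 (ler0n _ _) S0 Lt Ss h1 h2 h3).
exact: le_of_scaled_approx E0 key.
Qed.

End minimality.

(** * Variations *)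

Section families.
Context {R : realType} {n : nat}.
Hypothesis n7 : (7 <= n)%N.
Variable d : R.
Hypothesis d1 : d <= 1.
Implicit Types (f g h : R -> 'rV[R]_n -> R) (x y : 'rV[R]_n).

Definition params : set R := [set t | `|t| < d].
Local Notation I := params.
Local Notation I2 := (params `*` params).
Let op : open (@pball R n) := open_pball.
Let rg : forall x : 'rV[R]_n, pball x -> 1 <= rho x := @rho_ge1 R n.

(* A parametrized family of symbols of degree 0 and order 3; locked so that the
   closure lemmas below are selected on the shape of the family only. *)
Fact fsym_key : unit. Proof. by []. Qed.
Definition fsym := locked_with fsym_key
  (fun (T : Type) (P : set T) (F : T -> 'rV[R]_n -> R) => symbol axis pball rho P 3 0 F).

Section closure.
Context {T : Type} (P : set T).
Implicit Types F G : T -> 'rV[R]_n -> R.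

Lemma fsymE F : fsym P F = symbol axis pball rho P 3 0 F.
Proof. by rewrite /fsym unlock. Qed.

Lemma fsym_psymbol F (a : T) : P a -> fsym P F -> psymbol 3 0 (F a).
Proof. by rewrite fsymE => Pa; exact: (symbol_reparam (f := fun=> a) (fun _ _ => Pa)). Qed.

Lemma psymbol_fsym (F : 'rV[R]_n -> R) : psymbol 3 0 F -> fsym P (fun=> F).
Proof. by rewrite fsymE; exact: (symbol_reparam (f := fun=> tt) (fun _ _ => Logic.I)). Qed.

Lemma fsym_ext F G : (forall a x, P a -> pball x -> F a x = G a x) -> fsym P F -> fsym P G.
Proof. by rewrite !fsymE; exact: (symbol_ext op). Qed.

Lemma fsym_const (c : R) : fsym P (fun _ _ => c).
Proof. by rewrite fsymE; exact: (symbol_const _ op rg). Qed.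

Lemma fsym_cst (c : T -> R) (C : R) : (forall a, P a -> `|c a| <= C) -> fsym P (fun a _ => c a).
Proof. by rewrite fsymE => cC; exact: (symbol_cst _ op rg _ _ cC). Qed.

Lemma fsymD F G : fsym P F -> fsym P G -> fsym P (fun a x => F a x + G a x).
Proof. by rewrite !fsymE; exact: (symbolD op rg). Qed.

Lemma fsymM F G : fsym P F -> fsym P G -> fsym P (fun a x => F a x * G a x).
Proof. by rewrite !fsymE; exact: (symbolM00 op rg). Qed.

Lemma fsymZ (c : R) F : fsym P F -> fsym P (fun a x => c * F a x).
Proof. by rewrite !fsymE; exact: (symbolZ op rg). Qed.

Lemma fsymV F (c : R) : 0 < c -> (forall a x, P a -> pball x -> c <= F a x) ->
  fsym P F -> fsym P (fun a x => (F a x)^-1).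
Proof. by move=> c0 Fc; rewrite !fsymE; exact: (symbolV op rg c0 Fc). Qed.

Lemma fsym_isqrt F (c : R) : 0 < c -> (forall a x, P a -> pball x -> c <= F a x) ->
  fsym P F -> fsym P (fun a x => (Num.sqrt (F a x))^-1).
Proof. by move=> c0 Fc; rewrite !fsymE; exact: (symbol_isqrt op rg c0 Fc). Qed.

Lemma fsym_bound F : fsym P F ->
  exists2 C, 0 <= C & forall a x, P a -> pball x -> `|F a x| <= C.
Proof.
rewrite fsymE => /(symbol_bound rg)[C C0 bC]; exists C => // a x Pa xB.
by have := bC a x Pa xB; rewrite expr0 mulr1.
Qed.

Lemma fsym_gradlap F i : fsym P F ->
  symbol axis pball rho P 0 3 (fun a => gradlap i (F a)).
Proof.
rewrite fsymE => sF; apply: (symbolD1 i).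
by apply: (symbol_sum op rg) => k; do 2!apply: symbolD1.
Qed.

End closure.

Lemma fsym_reparam T (P : set T) T' (P' : set T') (f : T' -> T) (F : T -> 'rV[R]_n -> R) :
  (forall a, P' a -> P (f a)) -> fsym P F -> fsym P' (fun a => F (f a)).
Proof. by rewrite !fsymE; exact: symbol_reparam. Qed.

Ltac fsym_tac := repeat (assumption || apply: fsymD || apply: fsymZ || apply: fsymM).

(** The integrands are dominated by one and the same multiple of rho^6 for all parameters. *)
Lemma T3_bound T (P : set T) (F G : T -> 'rV[R]_n -> R) :
  fsym P F -> fsym P G ->
  exists C, forall t, P t -> `|T3 (F t) (G t)| <= C.
Proof.
move=> sF sG.
have sFG : symbol axis pball rho P 0 6 (fun t x => \sum_(i < n) gradlap i (F t) x * gradlap i (G t) x).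
  apply: (symbol_sum op rg) => i.
  exact: (symbolM op rg (k := 3) (l := 3) (fsym_gradlap i sF) (fsym_gradlap i sG)).
have [C C0 bC] := symbol_bound rg sFG.
have s6 : psymbol 0 6 (fun x : 'rV[R]_n => C * rho x ^+ 6) := psymbolZ C (psymbol_rhoX 0 6).
exists (ball_int (fun x : 'rV[R]_n => C * rho x ^+ 6)) => t Pt.
have sFGt : psymbol 0 6 (fun x => \sum_(i < n) gradlap i (F t) x * gradlap i (G t) x).
  exact: (symbol_reparam (f := fun _ : unit => t) (fun _ _ => Pt) sFG).
rewrite T3E ler_norml -(ball_intN n7 s6); apply/andP; split.
  apply: (ball_int_le n7 (psymbolN s6) sFGt) => x xB.
  by have := bC t x Pt xB; rewrite ler_norml => /andP[].
apply: (ball_int_le n7 sFGt s6) => x xB.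
by have := bC t x Pt xB; rewrite ler_norml => /andP[].
Qed.

(* [f] is differentiable in the parameter with derivative [f'], with a
   second-order Taylor remainder which is again a symbol. *)
Definition C11 f f' := [/\ fsym I f, fsym I f' &
  exists2 r : R * R -> 'rV[R]_n -> R, fsym I2 r &
    forall s t x, I s -> I t -> pball x ->
      f t x = f s x + (t - s) * f' s x + (t - s) ^+ 2 * r (s, t) x].

Lemma C11_ext f f' g g' : C11 f f' ->
  (forall t x, I t -> pball x -> f t x = g t x) ->
  (forall t x, I t -> pball x -> f' t x = g' t x) -> C11 g g'.
Proof.
move=> [sf sf' [r sr fr]] fg fg'; split.
- exact: (fsym_ext fg sf).
- exact: (fsym_ext fg' sf').
by exists r => // s t x Is It xB; rewrite -!fg// -fg'//; exact: fr.
Qed.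

Lemma C11_const (F : 'rV[R]_n -> R) : psymbol 3 0 F -> C11 (fun=> F) (fun _ _ => 0).
Proof.
move=> sF; split; [exact: psymbol_fsym|exact: fsym_const|].
exists (fun _ _ => 0); first exact: fsym_const.
by move=> s t x _ _ _; rewrite !mulr0 !addr0.
Qed.

Lemma C11_id : C11 (fun t _ => t) (fun _ _ => 1).
Proof.
split; [|exact: fsym_const|].
  by apply: (@fsym_cst _ _ _ 1) => t /ltW It; exact: le_trans It d1.
exists (fun _ _ => 0); first exact: fsym_const.
by move=> s t x _ _ _; rewrite mulr0 addr0 mulr1 addrC subrK.
Qed.

Lemma C11D f f' g g' : C11 f f' -> C11 g g' ->
  C11 (fun t x => f t x + g t x) (fun t x => f' t x + g' t x).
Proof.
move=> [sf sf' [r sr fr]] [sg sg' [q sq gq]]; split.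
- exact: fsymD.
- exact: fsymD.
exists (fun p x => r p x + q p x); first exact: fsymD.
by move=> s t x Is It xB; rewrite (fr s t)// (gq s t)//; ring.
Qed.

Let I2l (p : R * R) : I2 p -> I p.1. Proof. by case. Qed.
Let I2r (p : R * R) : I2 p -> I p.2. Proof. by case. Qed.

Lemma fsym_step : fsym I2 (fun p _ => p.2 - p.1).
Proof.
apply: (@fsym_cst _ _ _ 2) => -[s t] [/= /ltW Is /ltW It].
by rewrite (le_trans (ler_normB _ _))//; have := (le_trans Is d1, le_trans It d1); case; lra.
Qed.

Lemma C11M f f' g g' : C11 f f' -> C11 g g' ->
  C11 (fun t x => f t x * g t x) (fun t x => f' t x * g t x + f t x * g' t x).
Proof.
move=> [sf sf' [r sr fr]] [sg sg' [q sq gq]].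
have [f1 f1' g1 g1'] : [/\ fsym I2 (fun p => f p.1), fsym I2 (fun p => f' p.1),
    fsym I2 (fun p => g p.1) & fsym I2 (fun p => g' p.1)].
  by split; exact: (fsym_reparam I2l).
have st := fsym_step.
split.
- exact: fsymM.
- by fsym_tac.
exists (fun p x => f' p.1 x * g' p.1 x + f p.1 x * q p x + r p x * g p.1 x +
   (p.2 - p.1) * (f' p.1 x * q p x + r p x * g' p.1 x + (p.2 - p.1) * (r p x * q p x))).
  by fsym_tac.
by move=> s t x Is It xB; rewrite (fr s t)// (gq s t)//=; ring.
Qed.

(** Let a and b be the values of p = h^(-1/2) at s and t. Since h = p^-2, b - a = -(h(t) - h(s)) a^2
    b^2/(a + b): the difference is rational in quantities that are already symbols, and the Taylor
    remainder can be written explicitly. *)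
Lemma C11_isqrt h h' (c : R) : 0 < c -> (forall t x, I t -> pball x -> c <= h t x) ->
  C11 h h' -> C11 (fun t x => (Num.sqrt (h t x))^-1)
                  (fun t x => - 2^-1 * (h' t x * ((Num.sqrt (h t x))^-1) ^+ 3)).
Proof.
move=> c0 hc [sh sh' [q sq hq]].
pose p t x := (Num.sqrt (h t x))^-1.
have sp : fsym I p := fsym_isqrt c0 hc sh.
have hpos t x : I t -> pball x -> 0 < h t x by move=> It xB; exact: lt_le_trans (hc _ _ It xB).
have ppos t x : I t -> pball x -> 0 < p t x.
  by move=> It xB; rewrite invr_gt0 sqrtr_gt0 hpos.
have pE t x : I t -> pball x -> h t x = (p t x)^-1 * (p t x)^-1.
  by move=> It xB; rewrite /p invrK -expr2 sqr_sqrtr// ltW// hpos.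
have [C C0 bC] := fsym_bound sh.
pose c' := (Num.sqrt (C + 1))^-1.
have c'0 : 0 < c' by rewrite invr_gt0 sqrtr_gt0; lra.
(* An upper bound on h is a positive lower bound on p, which makes (p(s) + p(t))^-1 a symbol. *)
have pc t x : I t -> pball x -> c' <= p t x.
  move=> It xB; rewrite /c' /p lef_pV2 ?posrE ?sqrtr_gt0 ?hpos//; last by lra.
  rewrite ler_wsqrtr//; have := bC t x It xB.
  by have := ler_norm (h t x); lra.
have [p1 p2 h1'] : [/\ fsym I2 (fun a => p a.1), fsym I2 (fun a => p a.2) &
    fsym I2 (fun a => h' a.1)].
  by split; [exact: (fsym_reparam I2l)|exact: (fsym_reparam I2r)|exact: (fsym_reparam I2l)].
have sv : fsym I2 (fun a x => (p a.1 x + p a.2 x)^-1).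
  apply: (fsymV c'0); last exact: fsymD.
  move=> a x [I1 I2'] xB; have := pc _ x I1 xB; have := ppos _ x I2' xB.
  by move=> /ltW p0 p1'; exact: ler_wpDr.
pose k a x := (p a.2 x * p a.2 x) * (p a.1 x * p a.1 x) * (p a.1 x + p a.2 x)^-1.
have sk : fsym I2 k by fsym_tac.
have st := fsym_step.
pose X a x := - 1 * ((h' a.1 x + (a.2 - a.1) * q a x) * k a x).
have sX : fsym I2 X by fsym_tac.
split => //.
  apply: fsymZ; apply: (fsymM sh'); apply: (@fsym_ext _ _ (fun t x => p t x * p t x * p t x)).
    by move=> t x _ _; rewrite /p !exprS expr0 mulr1 mulrA.
  by fsym_tac.
(* Here (t - s) X is p(t) - p(s). The first term comes from the remainder of h, the second from a^2
   b^2/(a + b) - a^3/2 = a^2 (b - a)(2b + a)/(2(a + b)). *)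
exists (fun a x => - 1 * (q a x * k a x) + - 2^-1 * (h' a.1 x * (X a x *
   (p a.1 x * p a.1 x * ((2 * p a.2 x + p a.1 x) * (p a.1 x + p a.2 x)^-1))))).
  by fsym_tac.
move=> s t x Is It xB /=; rewrite -/(p t x) -/(p s x).
have ps := ppos s x Is xB; have pt := ppos t x It xB.
have := hq s t x Is It xB; rewrite (pE t)// (pE s)//.
rewrite /X /k /=; move: (p s x) (p t x) (h' s x) (q (s, t) x) ps pt => a b e o a0 b0.
move: (t - s) => u H.
have [ab a1 b1] : [/\ a + b != 0, a != 0 & b != 0] by rewrite !gt_eqF// addr_gt0.
have o2 : u ^+ 2 * o = b^-1 * b^-1 - a^-1 * a^-1 - u * e by rewrite H; ring.
clear -o2 ab a1 b1.
have -> : a + u * (- 2^-1 * (e * a ^+ 3)) +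
    u ^+ 2 * (-1 * (o * (b * b * (a * a) * (a + b)^-1)) +
    - 2^-1 * (e * (-1 * ((e + u * o) * (b * b * (a * a) * (a + b)^-1)) *
      (a * a * ((2 * b + a) * (a + b)^-1))))) =
  a - 2^-1 * (u * e) * a ^+ 3 - (u ^+ 2 * o) * (b * b * (a * a) * (a + b)^-1) +
    2^-1 * (u * e) * ((u * e + u ^+ 2 * o) * (b * b * (a * a) * (a + b)^-1) *
      (a * a * ((2 * b + a) * (a + b)^-1))) by ring.
by rewrite o2; field; rewrite ab a1 b1.
Qed.

Lemma T3_taylor (f f' r g g' q : 'rV[R]_n -> R) (u : R) :
  psymbol 3 0 f -> psymbol 3 0 f' -> psymbol 3 0 r ->
  psymbol 3 0 g -> psymbol 3 0 g' -> psymbol 3 0 q ->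
  T3 (fun x => (f x + u * f' x) + u ^+ 2 * r x) (fun x => (g x + u * g' x) + u ^+ 2 * q x) =
  T3 f g + u * (T3 f' g + T3 f g') + u ^+ 2 * (T3 f' g' + T3 f q + T3 r g +
    u * (T3 f' q + T3 r g') + u ^+ 2 * T3 r q).
Proof.
move=> sf sf' sr sg sg' sq.
have s1 : psymbol 3 0 (fun x => f x + u * f' x) := psymbolD sf (psymbolZ u sf').
have s2 : psymbol 3 0 (fun x => g x + u * g' x) := psymbolD sg (psymbolZ u sg').
have s3 : psymbol 3 0 (fun x => (g x + u * g' x) + u ^+ 2 * q x) := psymbolD s2 (psymbolZ _ sq).
have lr F : psymbol 3 0 F -> T3 F (fun x => (g x + u * g' x) + u ^+ 2 * q x) =
    T3 F g + u * T3 F g' + u ^+ 2 * T3 F q.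
  move=> sF; apply: (etrans (T3_linr n7 _ s2 sq sF)).
  by apply: (congr1 (fun a => a + _)); exact: (T3_linr n7 u sg sg' sF).
apply: (etrans (T3_linl n7 _ s1 sr s3)).
have E1 := etrans (T3_linl n7 u sf sf' s3)
  (congr2 (fun a b => a + u * b) (lr _ sf) (lr _ sf')).
apply: (etrans (congr2 (fun a b => a + u ^+ 2 * b) E1 (lr _ sr))).
move: (T3 f g) (T3 f g') (T3 f q) (T3 f' g) (T3 f' g') (T3 f' q) (T3 r g) (T3 r g') (T3 r q).
by move=> *; ring.
Qed.

(** Differentiation under the integral by bilinearity: inserting the two Taylor formulas leaves u^2
    times a combination of values of [T3], and [T3_bound] bounds these uniformly. *)
Lemma is_derive_T3 f f' g g' s : C11 f f' -> C11 g g' -> I s ->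
  is_derive s (1 : R) (fun t => T3 (f t) (g t)) (T3 (f' s) (g s) + T3 (f s) (g' s)).
Proof.
move=> [sf sf' [r sr fr]] [sg sg' [q sq gq]] Is.
have [f1 f1' g1 g1'] : [/\ fsym I2 (fun p => f p.1), fsym I2 (fun p => f' p.1),
    fsym I2 (fun p => g p.1) & fsym I2 (fun p => g' p.1)].
  by split; exact: (fsym_reparam I2l).
have [C1 b1] := T3_bound f1' g1'; have [C2 b2] := T3_bound f1 sq.
have [C3 b3] := T3_bound sr g1; have [C4 b4] := T3_bound f1' sq.
have [C5 b5] := T3_bound sr g1'; have [C6 b6] := T3_bound sr sq.
(* This keeps s + u in the parameter interval and |u| <= 1, so that the further powers of u in the
   remainder are at most 1. *)
pose e := Num.min (d - `|s|) 1.
have e0 : 0 < e by rewrite /e lt_min ltr01 andbT subr_gt0.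
apply: (is_derive_quadratic (C := C1 + C2 + C3 + (C4 + C5) + C6) e0) => u ue.
have Iu : I (s + u).
  apply: le_lt_trans (ler_normD _ _) _; move: ue; rewrite /e lt_min => /andP[]; lra.
have u1 : `|u| <= 1 by move: ue; rewrite lt_min => /andP[_ /ltW].
have Iss : I2 (s, s + u) by [].
have fE x : pball x -> f (s + u) x = f s x + u * f' s x + u ^+ 2 * r (s, s + u) x.
  by move=> xB; rewrite (fr s (s + u) x)// [s + u]addrC addrK.
have gE x : pball x -> g (s + u) x = g s x + u * g' s x + u ^+ 2 * q (s, s + u) x.
  by move=> xB; rewrite (gq s (s + u) x)// [s + u]addrC addrK.
have E := T3_ext n7 (fsym_psymbol Iu sf) (fsym_psymbol Iu sg) fE gE.
have E2 := etrans E (T3_taylor u (fsym_psymbol Is sf) (fsym_psymbol Is sf') (fsym_psymbol Iss sr)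
  (fsym_psymbol Is sg) (fsym_psymbol Is sg') (fsym_psymbol Iss sq)).
move: (b1 _ Iss) (b2 _ Iss) (b3 _ Iss) (b4 _ Iss) (b5 _ Iss) (b6 _ Iss) => /=.
rewrite E2 {E E2 fE gE}.
move: (T3 (f s) (g s)) (T3 (f s) (g' s)) (T3 (f s) (q _)) (T3 (f' s) (g s)) (T3 (f' s) (g' s))
  (T3 (f' s) (q _)) (T3 (r _) (g s)) (T3 (r _) (g' s)) (T3 (r _) (q _)).
move=> a1 a2 a3 a4 a5 a6 a7 a8 a9 h1 h2 h3 h4 h5 h6.
have -> : a1 + u * (a4 + a2) + u ^+ 2 * (a5 + a3 + a7 + u * (a6 + a8) + u ^+ 2 * a9) - a1 -
   u * (a4 + a2) = u ^+ 2 * (a5 + a3 + a7 + u * (a6 + a8) + u ^+ 2 * a9) by ring.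
rewrite normrM [`|u ^+ 2|]ger0_norm ?sqr_ge0// mulrC ler_wpM2r ?sqr_ge0//.
have k1 (a b : R) : `|a| <= 1 -> `|a * b| <= `|b|.
  by move=> a1'; rewrite normrM ler_piMl.
apply: (le_trans (ler_normD _ _)); apply: lerD; last first.
  by apply: le_trans h6; apply: k1; rewrite normrX exprn_ile1.
apply: (le_trans (ler_normD _ _)); apply: lerD; last first.
  by apply: (le_trans (k1 _ _ u1)); apply: (le_trans (ler_normD _ _)); exact: lerD.
by apply: (le_trans (ler_normD _ _)); apply: lerD => //; apply: (le_trans (ler_normD _ _)); exact: lerD.
Qed.

End families.

Section variation.
Context {R : realType} {n : nat}.
Hypothesis n7 : (7 <= n)%N.
Local Notation u j := (component (@equator_map R n) j).
Variable phi : 'rV[R]_n -> 'rV[R]_(n + 1).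
Hypothesis tphi : test_map phi.
Implicit Types (x y : 'rV[R]_n) (j : 'I_(n + 1)) (t : R).
Local Notation f j := (component phi j).

Definition alpha x : R := \sum_j u j x * f j x.
Definition beta x : R := \sum_j f j x * f j x.
(** The value of |u + t phi|^2 where |u| = 1, that is off the origin. Primes below denote
    derivatives in t. *)
Definition sqr_var t x : R := 1 + t * (2 * alpha x + t * beta x).
Definition sqr_var' t x : R := 2 * alpha x + t * (2 * beta x).
Definition isq t x : R := (Num.sqrt (sqr_var t x))^-1.
Definition isq' t x : R := - 2^-1 * (sqr_var' t x * isq t x ^+ 3).
Definition isq'' t x : R := - 2^-1 * (2 * beta x * isq t x ^+ 3 +
  sqr_var' t x * (3 * isq' t x * isq t x ^+ 2)).
Definition var j t x : R := isq t x * (u j x + t * f j x).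
Definition var' j t x : R := isq' t x * (u j x + t * f j x) + isq t x * f j x.
Definition var'' j t x : R := isq'' t x * (u j x + t * f j x) + 2 * (isq' t x * f j x).

Lemma psymbol_test_component m j : psymbol m 0 (f j).
Proof. exact: test_psymbol. Qed.

Lemma psymbol_alpha : psymbol 3 0 alpha.
Proof.
apply: (symbol_sum open_pball rho_ge1) => j.
exact: (psymbolM (k := 0) (l := 0) (psymbol_equator 3 j) (psymbol_test_component 3 j)).
Qed.

Lemma psymbol_beta : psymbol 3 0 beta.
Proof.
apply: (symbol_sum open_pball rho_ge1) => j.
exact: (psymbolM (k := 0) (l := 0) (psymbol_test_component 3 j) (psymbol_test_component 3 j)).
Qed.

Lemma sqr_varE t x : pball x -> \sum_j (u j x + t * f j x) ^+ 2 = sqr_var t x.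
Proof.
move=> xB; transitivity (\sum_j u j x ^+ 2 + t * (2 * alpha x + t * beta x)); last first.
  by rewrite sum_equator_sqr.
rewrite /alpha /beta !mulr_sumr -big_split /= mulr_sumr -big_split /=.
by apply: eq_bigr => j _; ring.
Qed.

Lemma variationE j t x : pball x ->
  component (sphere_variation (@equator_map R n) phi t) j x = var j t x.
Proof.
move=> xB; have E i : (@equator_map R n x + t *: phi x) ord0 i = u i x + t * f i x.
  by rewrite [LHS]mxE [X in _ + X]mxE.
rewrite /component /sphere_variation /nearest_point [LHS]mxE E /var /isq.
rewrite -(sqr_varE t xB) /enorm; congr ((Num.sqrt _)^-1 * _).
by apply: eq_bigr => i _; rewrite E.
Qed.

Lemma small_params : exists d : R, [/\ 0 < d, d <= 1 &
  forall t x, `|t| < d -> pball x -> 2^-1 <= sqr_var t x].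
Proof.
have [A A0 bA] := symbol_bound rho_ge1 psymbol_alpha.
have [D D0 bD] := symbol_bound rho_ge1 psymbol_beta.
(* [A] and [D] bound alpha and beta, so |u + t phi|^2 differs from 1 by at most d (2A + D) <=
   1/2. *)
pose d := (2 * (2 * A + D + 1))^-1.
have d0 : 0 < d by rewrite invr_gt0; lra.
have d1 : d <= 1 by rewrite invf_le1; lra.
exists d; split=> // t x td xB.
have := bA tt x Logic.I xB; have := bD tt x Logic.I xB; rewrite expr0 !mulr1 => hD hA.
have H : `|t * (2 * alpha x + t * beta x)| <= 2^-1.
  rewrite normrM; apply: (@le_trans _ _ (d * (2 * A + D))).
    apply: ler_pM => //; first exact: ltW.
    apply: (le_trans (ler_normD _ _)); apply: lerD.
      by rewrite normrM ger0_norm// ler_wpM2l.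
    rewrite normrM; apply: le_trans hD; rewrite ler_piMl//.
    by apply: ltW; exact: lt_le_trans td d1.
  by rewrite /d invfM -mulrA ger_pMr// ler_pdivrMl; lra.
by move: H; rewrite ler_norml /sqr_var => /andP[]; lra.
Qed.

Section small.
Variable d : R.
Hypotheses (d0 : 0 < d) (d1 : d <= 1).
Hypothesis dh : forall t x, `|t| < d -> pball x -> 2^-1 <= sqr_var t x.
Local Notation C := (C11 d).

Lemma C11_t (F : 'rV[R]_n -> R) : psymbol 3 0 F -> C (fun t x => t * F x) (fun _ x => F x).
Proof.
move=> sF; apply: (C11_ext (C11M d1 (C11_id d1) (C11_const d sF))) => t x _ _ //.
by rewrite mul1r mulr0 addr0.
Qed.

Lemma C11_sqr_var' : C sqr_var' (fun _ x => 2 * beta x).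
Proof.
have := C11D (C11_const d (psymbolZ 2 psymbol_alpha)) (C11_t (psymbolZ 2 psymbol_beta)).
by move/C11_ext; apply=> t x _ _ //; rewrite add0r.
Qed.

Lemma C11_sqr_var : C sqr_var sqr_var'.
Proof.
have c1 := C11D (C11_const d (psymbolZ 2 psymbol_alpha)) (C11_t psymbol_beta).
have c2 := C11D (C11_const d (psymbol_const 3 0 1)) (C11M d1 (C11_id d1) c1).
apply: (C11_ext c2) => t x _ _ //.
by rewrite /sqr_var'; ring.
Qed.

Lemma C11_isq : C isq isq'.
Proof.
have c0 : 0 < 2^-1 :> R by rewrite invr_gt0.
exact: (C11_ext (C11_isqrt d1 c0 dh C11_sqr_var)).
Qed.

Lemma C11_isq' : C isq' isq''.
Proof.
have c3 := C11M d1 C11_isq (C11M d1 C11_isq C11_isq).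
have := C11M d1 (C11_const d (psymbol_const 3 0 (- 2^-1))) (C11M d1 C11_sqr_var' c3).
move/C11_ext; apply=> t x _ _; first by rewrite /isq'; ring.
by rewrite /isq''; ring.
Qed.

Lemma C11_affine j : C (fun t x => u j x + t * f j x) (fun _ x => f j x).
Proof.
have := C11D (C11_const d (psymbol_equator 3 j)) (C11_t (psymbol_test_component 3 j)).
by move/C11_ext; apply=> t x _ _ //; rewrite add0r.
Qed.

Lemma C11_var j : C (var j) (var' j).
Proof. exact: (C11_ext (C11M d1 C11_isq (C11_affine j))). Qed.

Lemma C11_var' j : C (var' j) (var'' j).
Proof.
have := C11D (C11M d1 C11_isq' (C11_affine j))
  (C11M d1 C11_isq (C11_const d (psymbol_test_component 3 j))).
by move/C11_ext; apply=> t x _ _ //; rewrite /var''; ring.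
Qed.

Lemma E3ext_variation t : `|t| < d ->
  E3ext (sphere_variation (@equator_map R n) phi t) = \sum_j T3 (var j t) (var j t).
Proof.
move=> td; have sv j : psymbol 3 0 (var j t).
  by have [sv _ _] := C11_var j; exact: (fsym_psymbol (a := t) td sv).
have vE j x : pball x -> var j t x = component (sphere_variation (@equator_map R n) phi t) j x.
  by move=> xB; rewrite variationE.
rewrite (E3ext_psymbol n7) => [|j]; last exact: (psymbol_ext (vE j) (sv j)).
by apply: eq_bigr => j _; apply/esym; exact: (T3_ext n7 (sv j) (sv j) (vE j) (vE j)).
Qed.

Lemma near_params (s : R) : `|s| < d -> \forall t \near s, `|t| < d.
Proof.
move=> sd; have o : open [set t : R | `|t| < d].
  by apply: open_comp (@open_lt R d) => t _; exact: (@norm_continuous _ R^o).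
exact: open_nbhs_nbhs.
Qed.

Lemma is_derive_E3ext s : `|s| < d ->
  is_derive s (1 : R) (fun t => E3ext (sphere_variation (@equator_map R n) phi t))
    (\sum_j 2 * T3 (var' j s) (var j s)).
Proof.
move=> sd; have D j : is_derive s (1 : R) (fun t => T3 (var j t) (var j t))
    (2 * T3 (var' j s) (var j s)).
  apply: (is_derive_eq (is_derive_T3 n7 (C11_var j) (C11_var j) sd)).
  by rewrite [T3 (var j s) _]T3C; ring.
apply: near_eq_is_derive (is_derive_sum D).
by apply: filterS (near_params sd) => t td; rewrite fct_sumE E3ext_variation.
Qed.

Lemma second_derivative_E3ext :
  second_derivative (fun t => E3ext (sphere_variation (@equator_map R n) phi t)) 0
    (\sum_j 2 * (T3 (var'' j 0) (var j 0) + T3 (var' j 0) (var' j 0))).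
Proof.
have z0 : `|0 : R| < d by rewrite normr0.
split.
  by apply: filterS (near_params z0) => t td; have [] := is_derive_E3ext td.
have D j : is_derive (0 : R) (1 : R) (fun t => 2 * T3 (var' j t) (var j t))
    (2 * (T3 (var'' j 0) (var j 0) + T3 (var' j 0) (var' j 0))).
  have DT := is_derive_T3 n7 (C11_var' j) (C11_var j) z0.
  apply: (is_derive_eq (is_deriveM' (is_derive_cst (2 : R) (0 : R) (1 : R)) DT)).
  by rewrite mul0r addr0.
apply: near_eq_is_derive (is_derive_sum D).
apply: filterS (near_params z0) => t td; rewrite fct_sumE derive1E.
by have [_ ->] := is_derive_E3ext td.
Qed.

End small.

Lemma test_map_support : exists K : set 'rV[R]_n,
  [/\ compact K, K `<=` @unit_ball R n & forall j x, ~ K x -> f j x = 0].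
Proof.
have [K KQ] := choice (fun j => (tphi j).2).
exists (\big[setU/set0]_j K j); split.
- by elim/big_ind: _ => [|A A' cA cA'|j _]; [exact: compact0|exact: compactU|case: (KQ j)].
- by elim/big_ind: _ => // [A A' cA cA'|j _]; [rewrite subUset|case: (KQ j)].
- move=> j x Kx; have [_ _ ] := KQ j; apply => Kj; apply: Kx.
  by rewrite (bigD1 j)//=; left.
Qed.

Lemma isq0 x : isq 0 x = 1.
Proof. by rewrite /isq /sqr_var mul0r addr0 sqrtr1 invr1. Qed.

Lemma isq'0 x : isq' 0 x = - alpha x.
Proof. by rewrite /isq' isq0 /sqr_var' mul0r addr0 expr1n mulr1; field. Qed.

Lemma var0 j x : var j 0 x = u j x.
Proof. by rewrite /var isq0 mul1r mul0r addr0. Qed.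

Lemma var'0 j x : var' j 0 x = f j x - alpha x * u j x.
Proof. by rewrite /var' isq0 isq'0; ring. Qed.

(** When phi is orthogonal to u, the acceleration of the variation is normal to the sphere, of size
    |phi|^2. *)
Lemma var''0 j x : alpha x = 0 -> var'' j 0 x = - (beta x * u j x).
Proof.
move=> a0; by rewrite /var'' /isq'' isq'0 isq0 a0 /sqr_var' a0; field.
Qed.

End variation.

Section triharmonic.
Context {R : realType} {n : nat}.
Hypothesis n7 : (7 <= n)%N.
Local Notation u := (@equator_map R n).

Lemma extrinsic_triharmonic_equator : extrinsic_triharmonic u.
Proof.
split; first exact: sobolev_sphere_equator.
move=> phi tphi; have [d [d0 d1 dh]] := small_params tphi.
have z0 : `|0 : R| < d by rewrite normr0.
apply: (is_derive_eq (is_derive_E3ext n7 tphi d1 dh z0)).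
have [K [cK KB f0]] := test_map_support tphi.
have su j := @psymbol_equator R n 3 j.
have sf j := psymbol_test_component tphi 3 j.
(* The velocity of the variation at t = 0, tangent to the sphere. The equation reduces the first
   variation to a multiple of the integral of rho^6 u . g, and u . g = 0. *)
pose g j x := component phi j x - alpha phi x * component u j x.
have sg j : psymbol 3 0 (g j).
  exact: (psymbolB (sf j) (psymbolM (k := 0) (l := 0) (psymbol_alpha tphi) (su j))).
have g0 j x : pball x -> ~ K x -> g j x = 0.
  move=> xB Kx; rewrite /g /alpha f0// big1 ?mul0r ?subr0// => i _.
  by rewrite f0// mulr0.
have E j : T3 (var' phi j 0) (var phi j 0) =
    @lam R n * ball_int (fun x => rho x ^+ 6 * (component u j x * g j x)).
  rewrite -(T3_equator n7 cK KB j (sg j) (g0 j)) T3C.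
  by apply: (congr2 T3); apply/funext => x; rewrite ?var0 ?var'0.
under eq_bigr do rewrite E.
have sug j : psymbol 0 6 (fun x => rho x ^+ 6 * (component u j x * g j x)).
  have sug := psymbolM (k := 0) (l := 0) (su j) (sg j).
  exact: (psymbolM (k := 6) (l := 0) (psymbol_rhoX 0 6) (psymbol_order (leq0n 3) sug)).
rewrite -!mulr_sumr -(ball_int_sum n7 sug).
have S : psymbol 0 6 (fun x => \sum_j rho x ^+ 6 * (component u j x * g j x)).
  exact: (symbol_sum open_pball rho_ge1 _ _ sug).
rewrite (ball_int_eq n7 S (g := cst 0)).
  by rewrite ball_intE Rintegral_cst ?mul0r ?mulr0//; exact: measurable_unit_ball.
move=> x xB; rewrite -mulr_sumr /cst.
rewrite (_ : \sum_j _ = 0) ?mulr0// /g.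
under eq_bigr do rewrite mulrBr mulrCA -expr2.
by rewrite sumrB -mulr_sumr sum_equator_sqr// mulr1 subrr.
Qed.

End triharmonic.

(** * Instability *)

Section bounded_smooth.
Context {R : realType}.
Implicit Types (A F W : R -> R) (b c s x : R).

Definition bsmooth F := forall m, symbol1 m F.

Let oT : open [set: R] := openT.
Let w1 := @symbol1_le1 R.

Lemma bsmooth_derive F x : bsmooth F -> is_derive x (1 : R) F (derive1 F x).
Proof. by move=> sF; exact: (symbol1_derive x (sF 1)). Qed.

Lemma bsmooth_derive1 F : bsmooth F -> bsmooth (derive1 F).
Proof. by move=> sF m; exact: symbol1S (sF m.+1). Qed.

Lemma bsmooth_ext F W : F =1 W -> bsmooth F -> bsmooth W.
Proof. by move=> /funext ->. Qed.

Lemma bsmoothD F W : bsmooth F -> bsmooth W -> bsmooth (fun x => F x + W x).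
Proof. by move=> sF sW m; exact: (symbolD oT w1 (sF m) (sW m)). Qed.

Lemma bsmoothM F W : bsmooth F -> bsmooth W -> bsmooth (fun x => F x * W x).
Proof. by move=> sF sW m; exact: (symbolM00 oT w1 (sF m) (sW m)). Qed.

Lemma bsmoothZ c F : bsmooth F -> bsmooth (fun x => c * F x).
Proof. by move=> sF m; exact: (symbolZ oT w1 c (sF m)). Qed.

Lemma bsmooth_bound F : bsmooth F -> exists2 C, 0 <= C & forall x, `|F x| <= C.
Proof.
move=> sF; have [C C0 bC] := symbol_bound w1 (sF 0); exists C => // x.
by have := bC tt x Logic.I Logic.I; rewrite mulr1.
Qed.

Lemma bsmooth_affine F c b : bsmooth F -> bsmooth (fun x => F (c * x + b)).
Proof. by move=> sF m; exact: symbol1_affine. Qed.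

Definition vanish_off b c F := forall x, ~ (b <= x <= c) -> F x = 0.

Lemma vanish_off_derive1 b c F : vanish_off b c F -> vanish_off b c (derive1 F).
Proof.
move=> F0 x xbc; rewrite derive1E (@near_eq_derive _ _ _ _ (cst 0)) ?derive_cst//.
have o : open (~` `[b, c]%classic : set R) by apply: closed_openC; exact: interval_closed.
have xo : (~` `[b, c]%classic) x by move=> /=; rewrite in_itv.
apply: filterS (open_nbhs_nbhs (conj o xo)) => y /= yo.
by rewrite F0// => ybc; apply: yo; rewrite in_itv.
Qed.

(* [g] is a function followed by its successive derivatives. *)
Lemma bsmooth_mul_local b c F (g : nat -> R -> R) :
  (forall j s, is_derive s (1 : R) (g j) (g j.+1 s)) ->
  (forall j, exists M, forall s, b <= s <= c -> `|g j s| <= M) ->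
  bsmooth F -> vanish_off b c F -> bsmooth (fun s => g 0%N s * F s).
Proof.
have aux F' (g' : nat -> R -> R) : (forall j s, is_derive s (1 : R) (g' j) (g' j.+1 s)) ->
    (forall j, exists M, forall s, b <= s <= c -> `|g' j s| <= M) ->
    bsmooth F' -> vanish_off b c F' -> symbol1 0 (fun s => g' 0%N s * F' s).
  move=> dg bg sF F0; have [C C0 FC] := bsmooth_bound sF; have [M gM] := bg 0%N.
  split=> // [|_ x _ _].
    exists (`|M| * C) => _ x _ _; rewrite mulr1 normrM.
    have [xbc|xbc] := pselect (b <= x <= c); last by rewrite F0// normr0 mulr0 mulr_ge0.
    by apply: ler_pM => //; apply: le_trans (gM x xbc) (ler_norm _).
  apply: continuousM; last exact: (symbol_cont (sF 0%N) (t := tt)).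
  by apply: differentiable_continuous; apply/derivable1_diffP; case: (dg 0%N x).
move=> dg bg sF F0 m; elim: m F g sF F0 dg bg => [|m IH] F g sF F0 dg bg; first exact: aux.
have [bd cont _] := aux F g dg bg sF F0.
apply: (symbolS_intro oT) => // _.
exists (fun _ s => g 1%N s * F s + g 0%N s * derive1 F s).
  move=> _ x _ _; have := is_deriveM' (dg 0%N x) (bsmooth_derive x sF).
  by rewrite addrC.
apply: (symbol_degree oT w1 (k := 0)) => //.
apply: (symbolD oT w1).
  by apply: (IH F (fun j => g j.+1)).
by apply: (IH (derive1 F) g) => //; [exact: bsmooth_derive1|exact: vanish_off_derive1].
Qed.

Lemma is_derive_expM q F s (a : R) : is_derive s (1 : R) F a ->
  is_derive s (1 : R) (fun s => expR (- (q * s)) * F s) (expR (- (q * s)) * (a - q * F s)).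
Proof.
move=> dF; have d1 : is_derive s (1 : R) (fun s : R => - (q * s)) (- q).
  by apply: is_derive_eq; rewrite -[_ *: _]/(_ * _) mulr1.
have h := is_deriveM' (is_derive_chain d1 (is_derive_expR _)) dF.
by apply: (is_derive_eq h) => /=; ring.
Qed.

(** The exponential is unbounded on the line, but it is bounded with all its derivatives on [b, c],
    outside of which [F] vanishes. *)
Lemma bsmooth_expM b c q F : 0 <= q -> bsmooth F -> vanish_off b c F ->
  bsmooth (fun s => expR (- (q * s)) * F s).
Proof.
move=> q0 sF F0; pose g (j : nat) s := (- q) ^+ j * expR (- (q * s)).
have dg (j : nat) s : is_derive s (1 : R) (g j) (g j.+1 s).
  have d1 : is_derive s (1 : R) (fun s : R => - (q * s)) (- q).
    by apply: is_derive_eq; rewrite -[_ *: _]/(_ * _) mulr1.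
  have := is_deriveM' (is_derive_cst ((- q) ^+ j) s (1 : R)) (is_derive_chain d1 (is_derive_expR _)).
  by move=> h; apply: (is_derive_eq h); rewrite mul0r addr0 /g exprS /cst; ring.
apply: (bsmooth_ext (F := fun s => g 0%N s * F s)).
  by move=> s; rewrite /g expr0 mul1r.
apply: (bsmooth_mul_local dg) sF F0 => j.
exists (q ^+ j * expR (- (q * b))) => s /andP[bs _].
rewrite /g normrM normrX normrN (ger0_norm q0) ger0_norm ?expR_ge0// ler_wpM2l ?exprn_ge0//.
by rewrite ler_expR lerN2 ler_wpM2l.
Qed.

Lemma bsmooth_idM b c F : bsmooth F -> vanish_off b c F -> bsmooth (fun s => s * F s).
Proof.
move=> sF F0; pose g (j : nat) (s : R) : R := if j is j'.+1 then (if j' is _.+1 then 0 else 1) else s.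
have dg (j : nat) s : is_derive s (1 : R) (g j) (g j.+1 s).
  by case: j => [|[|j]] /=; [exact: is_derive_id|exact: is_derive_cst|exact: is_derive_cst].
apply: (bsmooth_mul_local (g := g) dg) sF F0 => -[|[|j]] /=.
- exists (`|b| + `|c|) => s /andP[bs sc].
  have := ler_norm c; have := ler_norm (- b); rewrite normrN.
  by rewrite ler_norml; have := normr_ge0 b; have := normr_ge0 c; move=> *; apply/andP; split; lra.
- by exists 1 => s _; rewrite normr1.
- by exists 0 => s _; rewrite normr0.
Qed.

(** On ]-1, 1[ this is exp(-2/(1 - x^2)); the affine arguments have the shape expected by
    [symbol1_flat_affine]. *)
Definition cutoff x : R := flat 0 (1 * x + 1) * flat 0 (-1 * x + 1).

Lemma bsmooth_cutoff : bsmooth cutoff.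
Proof. by apply: bsmoothM => m; exact: symbol1_flat_affine. Qed.

Lemma cutoff_ge0 x : 0 <= cutoff x.
Proof. by rewrite mulr_ge0// flat_ge0. Qed.

Lemma cutoff_eq0 x : ~ (-1 < x < 1) -> cutoff x = 0.
Proof.
move=> xi; rewrite /cutoff; have [x1|x1] := leP x (-1).
  by rewrite flat_eq0 ?mul0r//; lra.
rewrite [X in _ * X]flat_eq0 ?mulr0//; have [x2|x2] := ltP x 1; last by lra.
by case: xi; rewrite x1 x2.
Qed.

Lemma cutoff_vanish : vanish_off (-1) 1 cutoff.
Proof. by move=> x xi; apply: cutoff_eq0 => /andP[x1 x2]; apply: xi; rewrite !ltW. Qed.

Lemma cutoff_gt0 x : -1 < x -> x < 1 -> 0 < cutoff x.
Proof. by move=> x1 x2; rewrite mulr_gt0// flat_gt0//; lra. Qed.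

Lemma cutoff_derive1 x : derive1 cutoff x =
  flat 2 (x + 1) * flat 0 (1 - x) - flat 0 (x + 1) * flat 2 (1 - x).
Proof.
have da (c : R) : is_derive x (1 : R) (fun x : R => c * x + 1) c.
  by apply: is_derive_eq; rewrite addr0 -[_ *: _]/(_ * _) mulr1.
have := is_deriveM' (is_derive_chain (da 1) (is_derive_flat 0 _))
   (is_derive_chain (da (-1)) (is_derive_flat 0 _)).
move=> [_]; rewrite derive1E => -> /=.
by rewrite !mul0r !subr0 !mul1r !mulN1r [- x + 1]addrC; ring.
Qed.

(* At the ends of its support the flatness of [F = cutoff] makes the derivative
   [(x F)'] large and negative compared with [F].  As it integrates to [0], the
   integral of [F] is bounded by that of [F ^+ 2], uniformly under rescaling. *)
Lemma cutoff_le_sqr : exists2 C, 0 <= C & forall x,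
  cutoff x + 2 * (cutoff x + x * derive1 cutoff x) <= C * cutoff x ^+ 2.
Proof.
(* For |x| <= 1/2 both factors of the cutoff F are at least exp(-2), so 1 <= exp(4) F; the 3 is what
   remains of the left-hand side once the nonpositive term in x F' is dropped. *)
exists (3 * expR 4); first by rewrite mulr_ge0// expR_ge0.
move=> x; have [xi|xi] := pselect (-1 < x < 1); last first.
  rewrite (cutoff_eq0 xi).
  have -> : derive1 cutoff x = 0.
    rewrite cutoff_derive1; have [x1|x1] := leP x (-1).
      have y0 : x + 1 <= 0 by lra.
      by rewrite !(flat_eq0 _ y0) !mul0r subr0.
    have y0 : 1 - x <= 0.
      have [x2|x2] := ltP x 1; last by lra.
      by case: xi; rewrite x1 x2.
    by rewrite !(flat_eq0 _ y0) !mulr0 subr0.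
  by rewrite expr0n /= !mulr0 !addr0 mulr0.
case/andP: xi => x1 x2.
have [y1 y2] : 0 < x + 1 /\ 0 < 1 - x by split; lra.
have F0 := cutoff_gt0 x1 x2.
have f2 y : 0 < y -> flat 2 y = y^-1 ^+ 2 * flat 0 y :> R.
  by move=> y0; rewrite /flat y0 expr0 mul1r.
have FE : cutoff x = flat 0 (x + 1) * flat 0 (1 - x).
  by rewrite /cutoff mul1r mulN1r [- x + 1]addrC.
have dE : derive1 cutoff x = cutoff x * ((x + 1)^-1 ^+ 2 - (1 - x)^-1 ^+ 2).
  by rewrite cutoff_derive1 !f2// FE; ring.
have xE : 1 - x ^+ 2 = (x + 1) * (1 - x) by ring.
have D0 : 0 < (1 - x ^+ 2) ^+ 2 by rewrite exprn_gt0// xE mulr_gt0.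
have dE2 : x * derive1 cutoff x = - (cutoff x * (4 * x ^+ 2 / (1 - x ^+ 2) ^+ 2)).
  rewrite dE xE; by field; rewrite !gt_eqF.
have -> : cutoff x + 2 * (cutoff x + x * derive1 cutoff x) =
    cutoff x * (3 - 2 * (4 * x ^+ 2 / (1 - x ^+ 2) ^+ 2)) by rewrite dE2; ring.
have q0 : 0 <= 4 * x ^+ 2 / (1 - x ^+ 2) ^+ 2.
  by rewrite divr_ge0 ?sqr_ge0// mulr_ge0 ?sqr_ge0.
(* For x^2 >= 1/4 the factor 3 - 8 x^2/(1 - x^2)^2 is already nonpositive; otherwise |x| < 1/2. *)
have [xh|xh] := leP (4^-1) (x ^+ 2).
  apply: (@le_trans _ _ 0); last by rewrite mulr_ge0 ?sqr_ge0// mulr_ge0// expR_ge0.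
  rewrite mulr_ge0_le0//; first exact: ltW.
  suff : 3 / 2 <= 4 * x ^+ 2 / (1 - x ^+ 2) ^+ 2 by lra.
  rewrite ler_pdivlMr//.
  have x21 : x ^+ 2 <= 1 by have := mulr_gt0 y1 y2; rewrite -xE; lra.
  by move: (x ^+ 2) xh x21 => z *; nra.
apply: (@le_trans _ _ (cutoff x * 3)).
  by rewrite ler_wpM2l//; [exact: ltW|lra].
rewrite expr2 mulrA [_ * cutoff x * _]mulrC ler_wpM2l//; first exact: ltW.
rewrite -mulrA ler_peMr//.
have xl : -2^-1 < x /\ x < 2^-1 by split; nra.
have fl y : 2^-1 <= y -> expR (-2) <= flat 0 y :> R.
  move=> hy; have y0 : 0 < y by lra.
  rewrite /flat y0 expr0 mul1r ler_expR lerN2.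
  by rewrite -[2]invrK lef_pV2// ?posrE// invr_gt0.
have : expR (-2) * expR (-2) <= cutoff x.
  by rewrite FE ler_pM ?expR_ge0//; apply: fl; lra.
rewrite -expRD => h; rewrite -[leLHS](expR0 R) -(subrr 4) expRD.
rewrite ler_wpM2l ?expR_ge0//; apply: le_trans h.
by rewrite ler_expR; lra.
Qed.

End bounded_smooth.

(** * Radial functions in the variable ln |x| *)

Section radial_functions.
Context {R : realType} {n : nat}.
Hypothesis n7 : (7 <= n)%N.
Implicit Types (A F W : R -> R) (x y : 'rV[R]_n) (i : 'I_n).
Local Notation mu := (@lebesgue_rV R n).
Local Notation B := (@unit_ball R n).

Definition logr x : R := - ln (rho x).

Lemma is_derive_logr i x : pball x -> is_derive x (axis i) logr (rho x * unitv i x).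
Proof.
move=> xB; have r0 := rho_gt0 xB.
have h1 := is_derive_chain (is_derive_rho i xB) (is_derive1_ln r0).
have h2 := is_deriveM' (is_derive_cst (-1 : R) x (axis i)) h1.
have -> : logr = fun y => cst (-1) y * (@ln R \o rho) y.
  by apply/funext => y; rewrite /cst /= mulN1r.
apply: (is_derive_eq h2); rewrite mul0r addr0 /cst mulN1r mulNr mulrN opprK.
by field; rewrite gt_eqF.
Qed.

Lemma continuous_logr x : pball x -> {for x, continuous logr}.
Proof.
move=> xB; apply: continuousN; apply: continuous_comp.
  exact: (psymbol_cont (psymbol_rho 0) xB).
by apply: continuous_ln; exact: rho_gt0.
Qed.

Lemma psymbol_radial m F : bsmooth F -> psymbol m 0 (F \o logr).
Proof.
move=> sF; apply: (@symbol_comp _ _ 'I_n axis pball rho open_pball rho_ge1 logr unit setT m F sF);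
  first exact: continuous_logr.
move=> i; exists (fun x => rho x * unitv i x); first exact: is_derive_logr.
by move=> m'; exact: (psymbolM (k := 1) (l := 0) (psymbol_rho m') (psymbol_unitv m' i)).
Qed.

Lemma is_derive_radial F (a : R) i x : pball x -> is_derive (logr x) (1 : R) F a ->
  is_derive x (axis i) (F \o logr) (rho x * unitv i x * a).
Proof. by move=> xB dF; rewrite mulrC; exact: is_derive_chain (is_derive_logr i xB) dF. Qed.

(** In the variable s = ln |x| the Laplacian has constant coefficients up to the factor |x|^-2. Only
    natural powers of [rho] occur as such; the exponent -(n - 6)/2 will be carried by [F], as an
    exponential in s. *)
Lemma lap_radial k F (F1 F2 : R -> R) x :
  (forall s, is_derive s (1 : R) F (F1 s)) -> (forall s, is_derive s (1 : R) F1 (F2 s)) ->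
  pball x ->
  lap (fun y => rho y ^+ k * F (logr y)) x =
  rho x ^+ k.+2 * (F2 (logr x) + (n%:R - 2 - 2 * k%:R) * F1 (logr x) -
                   k%:R * (n%:R - 2 - k%:R) * F (logr x)).
Proof.
move=> dF dF1 xB; pose M s := F1 s - k%:R * F s.
have dM s : is_derive s (1 : R) M (F2 s - k%:R * F1 s).
  have h := is_deriveD' (dF1 s) (is_deriveM' (is_derive_cst (- k%:R : R) s (1 : R)) (dF s)).
  have -> : M = fun s => F1 s + cst (- k%:R) s * F s.
    by apply/funext => t; rewrite /M /cst mulNr.
  by apply: (is_derive_eq h); rewrite mul0r addr0 /cst mulNr.
have E i y : pball y -> partial i (fun y => rho y ^+ k * F (logr y)) y = runitv k.+1 i y * M (logr y).
  move=> yB; rewrite (partial_val (is_deriveM' (is_derive_rhoX k i yB)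
    (is_derive_radial i yB (dF (logr y))))) /runitv /M !exprS /=; ring.
rewrite /lap (eq_bigr (fun i => partial i (runitv k.+1 i) x * M (logr x) +
    runitv k.+1 i x * (rho x * unitv i x * (F2 (logr x) - k%:R * F1 (logr x))))); last first.
  move=> i _; rewrite (partial_ext i (E i) xB).
  have dr := is_derive_runitv k.+1 i i xB.
  rewrite (partial_val dr) (partial_val (is_deriveM' dr (is_derive_radial i xB (dM (logr x))))) /=.
  by rewrite addrC mulrC [X in X + _]mulrC.
rewrite big_split -mulr_suml div_runitv//.
have -> : \sum_i runitv k.+1 i x * (rho x * unitv i x * (F2 (logr x) - k%:R * F1 (logr x))) =
    rho x ^+ k.+2 * (F2 (logr x) - k%:R * F1 (logr x)).
  rewrite -[RHS]mul1r -(sum_unitv_sqr xB) mulr_suml; apply: eq_bigr => i _.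
  by rewrite /runitv !exprS; ring.
by rewrite /M -natr1 /=; ring.
Qed.

(** Below f lies a positive multiple of the indicator of a small half-open box, whose measure is
    explicit. *)
Lemma ball_int_gt0 m f x0 : psymbol m 6 f -> (forall x, pball x -> 0 <= f x) ->
  pball x0 -> 0 < f x0 -> 0 < ball_int f.
Proof.
move=> sf f0 xB fx0.
have nf : \forall y \near x0, pball y /\ f x0 / 2 <= f y.
  apply: filterS2 (Omega_near open_pball xB) _; last first.
    have := psymbol_cont sf xB => /cvgrPdist_le /(_ (f x0 / 2)).
    by rewrite divr_gt0// => /(_ isT); exact.
  by move=> y yB /=; rewrite ler_norml => /andP[_]; split=> //; lra.
have [ab [abx abA]] := open_box_nbhs nf.
pose lo i : R := ratr (ab i).1; pose hi i : R := ratr (ab i).2.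
have lohi i : lo i < hi i by have /andP[] := abx i; exact: lt_trans.
pose U : set 'rV[R]_n := [set y | forall i, lo i < y ord0 i <= hi i].
have mUE : mu U = (\prod_i (hi i - lo i))%:E by apply: lebesgue_rV_box => i; exact: ltW.
have mU : measurable U.
  have -> : U = \bigcap_(i in [set: 'I_n]) [set y | `]lo i, hi i]%classic (y ord0 i)].
    apply/seteqP; split=> y /= H i; first by move=> _; rewrite /= in_itv /=; exact: H.
    by have := H i Logic.I; rewrite /= in_itv.
  by apply: fin_bigcap_measurable => // i _; exact: measurable_coord_preimage.
have UA y : U y -> pball y /\ f x0 / 2 <= f y.
  by move=> Uy; apply: abA => i; have /andP[/ltW -> ->] := Uy i.
have mB : measurable B := @measurable_unit_ball R n.
have i1 : mu.-integrable B (EFin \o (cst 1 : 'rV[R]_n -> R)).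
  exact: (integrable_psymbol n7 (leq0n 6) (psymbol_const 0 0 1)).
have iU : mu.-integrable B (EFin \o (\1_U : 'rV[R]_n -> R)).
  apply: (dom_integrable _ i1); first exact: measurable_indic.
  by move=> y _; rewrite indicE normr_nat lern1 leq_b1.
have UE : ball_int (\1_U : 'rV[R]_n -> R) = \prod_i (hi i - lo i).
  have UB : U `&` B = U.
    by apply/seteqP; split=> [y []//|y Uy]; split=> //; have [[]] := UA y Uy.
  by rewrite ball_intE /Rintegral integral_indic// UB; exact: (congr1 fine mUE).
apply: (@lt_le_trans _ _ (ball_int (fun y => f x0 / 2 * \1_U y))).
  rewrite ball_intE RintegralZl// -ball_intE UE mulr_gt0 ?divr_gt0//.
  by apply: prodr_gt0 => i _; rewrite subr_gt0.
apply: le_ball_int_ae; first exact: (integrableZl mB (f x0 / 2) iU).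
  exact: (integrable_psymbol n7 (leqnn 6) sf).
apply: filterS (ae_pball n7) => y yp yB; rewrite indicE; case: (boolP (y \in U)) => yU.
  by rewrite mulr1; have [] := UA y (set_mem yU).
by rewrite mulr0 f0//; exact: yp.
Qed.

Variable K : set 'rV[R]_n.
Hypotheses (cK : compact K) (KB : K `<=` B).
Let p : R := (n%:R - 6) / 2.

(** As rho^6 exp(-2ps) = |x|^-n, polar coordinates would reduce this to the integral of W' over the
    line. They are replaced by the divergence of the field |x|^-5 x/|x|, whose coefficient n - 6 =
    2p cancels the derivative of the exponential. *)
Lemma ball_int_radial_derive W (W1 : R -> R) :
  (forall s, is_derive s (1 : R) W (W1 s)) ->
  psymbol 1 0 (fun x => expR (- (2 * p * logr x)) * W (logr x)) ->
  psymbol 0 0 (fun x => expR (- (2 * p * logr x)) * W1 (logr x)) ->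
  (forall x, pball x -> ~ K x -> W (logr x) = 0) ->
  ball_int (fun x => rho x ^+ 6 * (expR (- (2 * p * logr x)) * W1 (logr x))) = 0.
Proof.
move=> dW sW sW1 W0.
have H := radial_divergence n7 cK KB (k := 5) (l := 0) isT sW.
have {}H := H (fun x xB Kx => etrans (congr1 (fun a => _ * a) (W0 x xB Kx)) (mulr0 _)).
have s6 (g : 'rV[R]_n -> R) : psymbol 0 0 g -> psymbol 0 6 (fun x => rho x ^+ 6 * g x).
  exact: (psymbolM (k := 6) (l := 0) (psymbol_rhoX 0 6)).
have sW' := s6 _ (psymbol_order (leq0n 1) sW).
have sW1' := s6 _ sW1.
have dE s := is_derive_expM (2 * p) (dW s).
have E : ball_int (fun x => \sum_i runitv 5 i x * partial i (fun x => expR (- (2 * p * logr x)) * W (logr x)) x)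
  = ball_int (fun x => rho x ^+ 6 * (expR (- (2 * p * logr x)) * W1 (logr x)) +
     (- (2 * p)) * (rho x ^+ 6 * (expR (- (2 * p * logr x)) * W (logr x)))).
  apply/esym; apply: (ball_int_eq n7 (psymbolD sW1' (psymbolZ (- (2 * p)) sW'))) => x xB.
  have D i := partial_val (is_derive_radial i xB (dE (logr x))).
  apply: (etrans _ (eq_bigr _ (fun i _ => congr1 (fun a => runitv 5 i x * a) (esym (D i))))).
  set e := expR _; set w := W _; set w1 := W1 _.
  have -> : rho x ^+ 6 * (e * w1) + - (2 * p) * (rho x ^+ 6 * (e * w)) =
     (\sum_i unitv i x ^+ 2) * (rho x ^+ 6 * (e * (w1 - 2 * p * w))).
    by rewrite sum_unitv_sqr//; ring.
  by rewrite mulr_suml; apply: eq_bigr => i _; rewrite /runitv; ring.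
move: H; rewrite E (ball_intD n7 sW1' (psymbolZ (- (2 * p)) sW')) (ball_intZ n7 _ sW').
set J := ball_int _; set J' := ball_int _.
have -> : 2 * p = n%:R - 1 - 5 by rewrite /p; lra.
by rewrite mulNr => /(canRL (addrK _)); rewrite subrr.
Qed.

End radial_functions.

Section radial_profile.
Context {R : realType} {n : nat}.
Hypothesis n7 : (7 <= n)%N.
Implicit Types (x y : 'rV[R]_n) (i : 'I_n).
Local Notation B := (@unit_ball R n).
Let p : R := (n%:R - 6) / 2.

Let p0 : 0 < p.
Proof.
have : 7 <= n%:R :> R by rewrite ler_nat.
by rewrite /p; lra.
Qed.

(** Written with n = 2p + 6. Around k = 2 the first-order coefficient is odd and the zero-order one
    even, which will make the composition of the cases k = 0, 2, 4 even in d/ds. *)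
Lemma lap_exp_radial k (F F1 F2 : R -> R) x :
  (forall s, is_derive s (1 : R) F (F1 s)) -> (forall s, is_derive s (1 : R) F1 (F2 s)) ->
  pball x ->
  lap (fun y => rho y ^+ k * (expR (- (p * logr y)) * F (logr y))) x =
  rho x ^+ k.+2 * (expR (- (p * logr x)) * (F2 (logr x) + (4 - 2 * k%:R) * F1 (logr x) -
    (p + k%:R) * (p + 4 - k%:R) * F (logr x))).
Proof.
move=> dF dF1 xB.
have dE s := is_derive_expM p (dF s).
have dF1' s : is_derive s (1 : R) (fun s => F1 s - p * F s) (F2 s - p * F1 s).
  have h := is_deriveD' (dF1 s) (is_deriveM' (is_derive_cst (- p : R) s (1 : R)) (dF s)).
  have -> : (fun s => F1 s - p * F s) = fun s => F1 s + cst (- p) s * F s.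
    by apply/funext => t; rewrite /cst mulNr.
  by apply: (is_derive_eq h); rewrite mul0r addr0 /cst mulNr.
have dE1 s := is_derive_expM p (dF1' s).
rewrite (lap_radial k dE dE1 xB).
have -> : n%:R = 2 * p + 6 by rewrite /p; lra.
by move: (expR _) (F _) (F1 _) (F2 _) => *; ring.
Qed.

Definition annulus (b c : R) : set 'rV[R]_n := [set x | expR b <= enorm x <= expR c].

Lemma compact_annulus b c : c < 0 -> compact (annulus b c).
Proof.
move=> c0; have cb := @compact_closed_box R n (fun=> -1) (fun=> 1).
apply: (subclosed_compact _ cb).
  have -> : annulus b c = @enorm R n @^-1` `[expR b, expR c]%classic.
    by apply/seteqP; split=> x /=; rewrite in_itv.
  apply: preimage_closed => [x _|]; first exact: continuous_enorm.
  exact: interval_closed.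
move=> x /andP[_ xc] i.
have := le_trans (ler_coord_enorm x i) xc; rewrite ler_norml => /andP[h1 h2].
have : expR c <= 1 by rewrite -(expR0 R) ler_expR ltW.
by move=> h; apply/andP; split; lra.
Qed.

Lemma annulus_pball b c : c < 0 -> annulus b c `<=` @pball R n.
Proof.
move=> c0 x /andP[bx xc]; split.
  by rewrite /unit_ball /=; apply: le_lt_trans xc _; rewrite -(expR0 R) ltr_expR.
by apply/eqP => x0; move: bx; rewrite x0 enorm0 leNgt expR_gt0.
Qed.

Lemma annulusP b c x : pball x -> annulus b c x <-> b <= logr x <= c.
Proof.
move=> xB; have x0 : 0 < enorm x by case: xB => _; exact: enorm_gt0.
have -> : logr x = ln (enorm x) by rewrite /logr /rho lnV ?posrE// opprK.
by rewrite /annulus /= -{1 2}(lnK (x := enorm x)) ?posrE// !ler_expR.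
Qed.

Section profile.
Variables (b c : R) (F : nat -> R -> R).
Hypotheses (c0 : c < 0) (dF : forall j s, is_derive s (1 : R) (F j) (F j.+1 s)).
Hypotheses (sF : forall j, bsmooth (F j)) (F0 : forall j, vanish_off b c (F j)).

Definition profile x : R := if pselect (pball x) then expR (- (p * logr x)) * F 0 (logr x) else 0.

Lemma profile_pball x : pball x -> profile x = expR (- (p * logr x)) * F 0 (logr x).
Proof. by rewrite /profile; case: pselect. Qed.

Lemma psymbol_exp_radial m q j : 0 <= q ->
  psymbol m 0 (fun x => expR (- (q * logr x)) * F j (logr x)).
Proof. by move=> q0; exact: (psymbol_radial m (bsmooth_expM q0 (sF j) (F0 j))). Qed.

Lemma psymbol_profile m : psymbol m 0 profile.
Proof.
apply: (psymbol_ext _ (psymbol_exp_radial m 0 (ltW p0))) => x xB.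
by rewrite profile_pball.
Qed.

Lemma F_annulus j x : pball x -> ~ annulus b c x -> F j (logr x) = 0.
Proof. by move=> xB Kx; apply: F0 => h; apply: Kx; exact/(annulusP _ _ xB). Qed.

Lemma profile_supp x : ~ annulus b c x -> profile x = 0.
Proof.
move=> Kx; rewrite /profile; case: pselect => // xB.
by rewrite F_annulus// mulr0.
Qed.

(** With D = d/ds the three Laplacians act as D^2 + 4D - a, D^2 - d and D^2 - 4D - a, and their
    product (D^4 - (2a + 16) D^2 + a^2)(D^2 - d) has even powers only. The constant a^2 d is
    [hardy_rellich_constant]. *)
Lemma T3_profile :
  let a := p * (p + 4) in let d := (p + 2) ^+ 2 in
  T3 profile profile = ball_int (fun x => rho x ^+ 6 * (expR (- (2 * p * logr x)) *
    (F 0 (logr x) * (a ^+ 2 * d * F 0 (logr x) - ((a ^+ 2 + (2 * a + 16) * d) * F 2 (logr x) -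
       (2 * a + 16 + d) * F 4 (logr x) + F 6 (logr x)))))).
Proof.
move=> a d.
have sp := psymbol_profile.
have KB : annulus b c `<=` B by move=> x /(annulus_pball c0)[].
have cK := compact_annulus (b := b) c0.
rewrite (T3_lap3 n7 cK KB (sp 6) (sp 3)); last by move=> x _; exact: profile_supp.
pose E s := expR (- (p * s)).
have D (u : R) j s : is_derive s (1 : R) (fun s => u * F j s) (u * F j.+1 s).
  have h := is_deriveM' (is_derive_cst u s (1 : R)) (dF j s).
  by apply: (is_derive_eq h); rewrite mul0r addr0.
pose B0 j s := F j.+2 s + 4 * F j.+1 s + - a * F j s.
have dB j s : is_derive s (1 : R) (B0 j) (B0 j.+1 s).
  exact: (is_deriveD' (is_deriveD' (dF j.+2 s) (D 4 j.+1 s)) (D (- a) j s)).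
pose C0 j s := B0 j.+2 s + - d * B0 j s.
have dC j s : is_derive s (1 : R) (C0 j) (C0 j.+1 s).
  have h := is_deriveM' (is_derive_cst (- d) s (1 : R)) (dB j s).
  by apply: (is_derive_eq (is_deriveD' (dB j.+2 s) h)); rewrite mul0r addr0.
have L1 x : pball x -> lap profile x = rho x ^+ 2 * (E (logr x) * B0 0 (logr x)).
  move=> xB; rewrite (lap_ext (g := fun y => rho y ^+ 0 * (E (logr y) * F 0 (logr y))) _ xB).
    rewrite (lap_exp_radial 0 (dF 0) (dF 1) xB) /B0 /a /E.
    by move: (expR _) (F _ _) (F _ _) (F _ _) => *; ring.
  by move=> y yB; rewrite profile_pball// expr0 mul1r.
have L2 x : pball x -> lap (lap profile) x = rho x ^+ 4 * (E (logr x) * C0 0 (logr x)).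
  move=> xB; rewrite (lap_ext L1 xB) (lap_exp_radial 2 (dB 0) (dB 1) xB) /C0 /d /E.
  by move: (expR _) (B0 _ _) (B0 _ _) (B0 _ _) => *; ring.
have L3 x : pball x -> lap (lap (lap profile)) x =
    rho x ^+ 6 * (E (logr x) * (C0 2 (logr x) - 4 * C0 1 (logr x) - a * C0 0 (logr x))).
  move=> xB; rewrite (lap_ext L2 xB) (lap_exp_radial 4 (dC 0) (dC 1) xB) /a /E.
  by move: (expR _) (C0 _ _) (C0 _ _) (C0 _ _) => *; ring.
have s6 : psymbol 0 6 (fun x => lap (lap (lap profile)) x * profile x).
  exact: (psymbolM (k := 6) (l := 0) (psymbol_lap (psymbol_lap (psymbol_lap (sp 6)))) (sp 0)).
rewrite -(ball_intN n7 s6); apply: (ball_int_eq n7 (psymbolN s6)) => x xB.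
rewrite L3// profile_pball// -/(E (logr x)).
have -> : expR (- (2 * p * logr x)) = E (logr x) * E (logr x) by rewrite /E -expRD; congr expR; ring.
rewrite /C0 /B0; move: (E _) => e.
move: (F 0 _) (F 1 _) (F 2 _) (F 3 _) (F 4 _) (F 5 _) (F 6 _) => *; rewrite /a /d.
ring.
Qed.

End profile.

End radial_profile.

Section compact_support.
Context {R : realType} {n : nat}.
Implicit Types (f : 'rV[R]_n -> R) (x : 'rV[R]_n) (i : 'I_n).
Variable K : set 'rV[R]_n.
Hypotheses (cK : compact K) (KB : K `<=` @pball R n).

Let near_off x : ~ K x -> \forall y \near x, ~ K y.
Proof.
move=> Kx; have oKc : open (~` K).
  by apply: closed_openC; apply: compact_closed => //; exact: norm_hausdorff.
exact: open_nbhs_nbhs.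
Qed.

(** [K] avoids the origin: on [K] smoothness comes from the symbol estimates, and off [K] the
    function is 0 in a neighbourhood. *)
Lemma psymbol_test_function f : (forall m, psymbol m 0 f) -> (forall x, ~ K x -> f x = 0) ->
  test_function f.
Proof.
move=> sf f0; split; last by exists K; split=> // x /KB[].
have H s : (forall m, psymbol m (size s) (iter_partial s f)) /\
    (forall x, ~ K x -> iter_partial s f x = 0).
  elim: s => [|i s [IHs IH0]] //=; split=> [m|x Kx]; first exact: psymbol_partial.
  rewrite /partial (@near_eq_derive _ _ _ _ (cst 0)) ?derive_cst//.
  by apply: filterS (near_off Kx) => y; exact: IH0.
move=> s; have [ss s0] := H s.
have E x : ~ K x -> \forall y \near x, (cst 0 : 'rV[R]_n -> R) y = iter_partial s f y.
  by move=> Kx; apply: filterS (near_off Kx) => y Ky; rewrite s0.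
split=> [x|x i]; have [Kx|Kx] := pselect (K x).
- exact: psymbol_cont (ss 0%N) (KB Kx).
- by apply: near_continuous (E x Kx) _; exact: cst_continuous.
- by case: (psymbol_derive i (ss 1%N) (KB Kx)).
- by apply: near_eq_derivable (E x Kx) _; exact: derivable_cst.
Qed.

End compact_support.

Lemma error_bound {R : realDomainType} (a1 a2 t x y z X Y Z : R) : 0 <= a1 -> 0 <= a2 ->
  `|x| <= t * X -> `|y| <= t * Y -> `|z| <= t * Z ->
  - (a2 * x + (- a1) * y + z) <= t * (a2 * X + a1 * Y + Z).
Proof.
move=> a10 a20; rewrite !ler_norml => /andP[hx _] /andP[_ hy] /andP[hz _].
have h1 := ler_wpM2l a20 hx; have h2 := ler_wpM2l a10 hy.
have -> : t * (a2 * X + a1 * Y + Z) = - (a2 * - (t * X)) + a1 * (t * Y) + t * Z by ring.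
have -> : - (a2 * x + (- a1) * y + z) = - (a2 * x) + a1 * y - z by ring.
by apply: lerD; [apply: lerD => //; rewrite lerN2|rewrite lerNl].
Qed.

(** Here v is the cutoff, u collects the terms with its derivatives, and w will be an exact
    derivative. The error is only linear in v; the last hypothesis trades it for a multiple of v^2
    and of w, and w integrates to 0. *)
Lemma remainder_bound {R : realDomainType} (k t M C u v w : R) : 0 <= v -> 0 <= t * M ->
  - u <= t * M -> v + 2 * w <= C * (v * v) ->
  v * (k * v + (-1) * u) <= (k + t * (M * C)) * (v * v) - 2 * (t * M) * w.
Proof.
move=> v0 tM0 hu hv; have h1 := ler_wpM2l v0 hu; have h2 := ler_wpM2l tM0 hv.
have -> : v * (k * v + (-1) * u) = k * (v * v) + v * - u by ring.
have -> : (k + t * (M * C)) * (v * v) - 2 * (t * M) * w =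
  k * (v * v) + (t * M * (C * (v * v)) - t * M * (2 * w)) by ring.
by rewrite lerD2l; apply: (le_trans h1); rewrite lerBrDr [v * (t * M)]mulrC -mulrDr ler_wpM2l.
Qed.

Section unstable_profile.
Context {R : realType} {n : nat}.
Hypotheses (n7 : (7 <= n)%N) (n12 : (n < 12)%N).
Implicit Types (x y : 'rV[R]_n) (i : 'I_n).
Let p : R := (n%:R - 6) / 2.

Let p0 : 0 < p.
Proof.
have : 7 <= n%:R :> R by rewrite ler_nat.
by rewrite /p; lra.
Qed.

Definition cutoffn (j : nat) : R -> R := iter j (@derive1 R R^o) cutoff.

Lemma bsmooth_cutoffn j : bsmooth (cutoffn j).
Proof. by elim: j => [|j IH]; [exact: bsmooth_cutoff|exact: bsmooth_derive1]. Qed.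

Lemma cutoffn_vanish j : vanish_off (-1) 1 (cutoffn j).
Proof. by elim: j => [|j IH]; [exact: cutoff_vanish|exact: vanish_off_derive1]. Qed.

(** The j-th derivative of s -> cutoff(e s + 2). For e > 0 the shift by 2 puts the support in
    [-3/e, -1/e], so that ln |x| stays negative and bounded: the profile lives inside the ball and
    away from the origin. *)
Definition scaled_cutoff (e : R) j s : R := e ^+ j * cutoffn j (e * s + 2).

Lemma is_derive_rescale (e : R) (F : R -> R) (s a : R) : is_derive (e * s + 2) (1 : R) F a ->
  is_derive s (1 : R) (fun s => F (e * s + 2)) (e * a).
Proof.
move=> dF; have d1 : is_derive s (1 : R) (fun s : R => e * s + 2) e.
  by apply: is_derive_eq; rewrite addr0 -[_ *: _]/(_ * _) mulr1.
by rewrite mulrC; exact: (is_derive_chain d1 dF).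
Qed.

Lemma is_derive_scaled_cutoff e j s :
  is_derive s (1 : R) (scaled_cutoff e j) (scaled_cutoff e j.+1 s).
Proof.
have d1 := is_derive_rescale (bsmooth_derive (e * s + 2) (bsmooth_cutoffn j)).
have := is_deriveM' (is_derive_cst (e ^+ j) s (1 : R)) d1.
by move=> h; apply: (is_derive_eq h); rewrite mul0r addr0 /scaled_cutoff exprSr mulrA.
Qed.

Lemma vanish_off_rescale e (F : R -> R) : 0 < e -> vanish_off (-1) 1 F ->
  vanish_off (- (3 / e)) (- (1 / e)) (fun s => F (e * s + 2)).
Proof.
move=> e0 F0 s sbc; apply: F0 => /andP[h1 h2]; apply: sbc.
by apply/andP; split; rewrite -mulNr ?ler_pdivrMr ?ler_pdivlMr// mulrC; lra.
Qed.

Lemma exists_enorm (r : R) : 0 <= r -> exists x : 'rV[R]_n, enorm x = r.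
Proof.
move=> r0; have n0 : (0 < n)%N by apply: leq_trans n7.
pose i0 : 'I_n := Ordinal n0; exists (\row_i (if i == i0 then r else 0)).
rewrite /enorm (bigD1 i0)//= mxE eqxx big1 ?addr0 ?sqrtr_sqr ?ger0_norm// => i /negbTE ii0.
by rewrite mxE ii0 expr0n.
Qed.

(** The derivatives of the rescaled cutoff that occur carry a factor e^2 at least, so the energy is
    at most (c + e^2 M C) times the integral of rho^6 eta^2; as c < [lam] for n < 12, a small e
    suffices. *)
Lemma unstable_profile : exists (K : set 'rV[R]_n) (eta : 'rV[R]_n -> R),
  [/\ compact K, K `<=` @pball R n, forall m, psymbol m 0 eta,
      forall x, ~ K x -> eta x = 0 &
      T3 eta eta < @lam R n * ball_int (fun x => rho x ^+ 6 * eta x ^+ 2)].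
Proof.
have gap := @hardy_rellich_constant_lt_lam R n ltac:(by rewrite n7 n12).
pose a := p * (p + 4); pose d := (p + 2) ^+ 2.
have hcE : @hardy_rellich_constant R n = a ^+ 2 * d.
  by rewrite /hardy_rellich_constant /a /d /p; field.
have [a0 d0] : 0 <= a /\ 0 <= d by split; [apply: mulr_ge0; have := p0; lra|exact: sqr_ge0].
have [C C0 bC] := @cutoff_le_sqr R.
have [C2 C20 b2] := bsmooth_bound (bsmooth_cutoffn 2).
have [C4 C40 b4] := bsmooth_bound (bsmooth_cutoffn 4).
have [C6 C60 b6] := bsmooth_bound (bsmooth_cutoffn 6).
pose e1 := 2 * a + 16 + d; pose e2 := a ^+ 2 + (2 * a + 16) * d.
have e10 : 0 <= e1 by rewrite /e1; lra.
have e20 : 0 <= e2 by rewrite /e2 addr_ge0 ?sqr_ge0// mulr_ge0//; lra.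
(* e^2 M will bound the derivative terms of [T3_profile]: as e <= 1, the factors e^4 and e^6 are at
   most e^2. *)
pose M := e2 * C2 + e1 * C4 + C6.
have M0 : 0 <= M by rewrite /M !addr_ge0// mulr_ge0.
have MC0 : 0 <= M * C by rewrite mulr_ge0.
pose g := @lam R n - @hardy_rellich_constant R n.
have g0 : 0 < g by rewrite subr_gt0.
(* Both bounds on e give e^2 M C <= e M C < g, where g is the gap between [lam] and c. *)
pose e := Num.min 1 (g / (M * C + 1)).
have e0 : 0 < e by rewrite lt_min ltr01 divr_gt0//; lra.
have ele : e <= 1 by rewrite ge_min lexx.
have eg : e ^+ 2 * (M * C) < g.
  have h1 : e * (M * C + 1) <= g by rewrite -ler_pdivlMr ?ge_min ?lexx ?orbT//; lra.
  have h2 : e * (M * C) <= M * C by rewrite ler_piMl.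
  have h3 : e * (e * (M * C)) <= e * (M * C) by rewrite ler_wpM2l// ltW.
  by rewrite expr2 -mulrA; lra.
pose F := scaled_cutoff e; pose b := - (3 / e); pose c := - (1 / e).
have c0 : c < 0 by rewrite oppr_lt0 divr_gt0.
have dF : forall j s, is_derive s (1 : R) (F j) (F j.+1 s) := is_derive_scaled_cutoff e.
have sF j : bsmooth (F j) by apply: bsmoothZ; apply: bsmooth_affine; exact: bsmooth_cutoffn.
have F0 j : vanish_off b c (F j).
  by move=> s sbc; rewrite /F /scaled_cutoff (vanish_off_rescale e0 (cutoffn_vanish j) sbc) mulr0.
have F0E s : F 0%N s = cutoff (e * s + 2) by rewrite /F /scaled_cutoff expr0 mul1r.
pose eta := @profile R n F; pose K := @annulus R n b c.
have cK : compact K := compact_annulus c0.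
have KP : K `<=` @pball R n := annulus_pball c0.
have KB : K `<=` @unit_ball R n by move=> x /KP[].
have seta m : psymbol m 0 eta := psymbol_profile n7 sF F0 m.
have eta0 x : ~ K x -> eta x = 0 := profile_supp F0 (x := x).
exists K, eta; split=> //.
pose Q x := expR (- (2 * p * logr x)).
have pp0 : 0 <= 2 * p by rewrite mulr_ge0// ltW.
have sQ m (G : R -> R) : bsmooth G -> vanish_off b c G -> psymbol m 0 (fun x => Q x * G (logr x)).
  by move=> sG G0; exact: (psymbol_radial m (bsmooth_expM pp0 sG G0)).
have s6 (h : 'rV[R]_n -> R) : psymbol 0 0 h -> psymbol 0 6 (fun x => rho x ^+ 6 * h x).
  exact: (psymbolM (k := 6) (l := 0) (psymbol_rhoX 0 6)).
have T : T3 eta eta = ball_int (fun x => rho x ^+ 6 * (Q x * (F 0 (logr x) *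
   (a ^+ 2 * d * F 0 (logr x) - (e2 * F 2 (logr x) - e1 * F 4 (logr x) + F 6 (logr x)))))).
  exact: (T3_profile n7 c0 dF sF F0).
pose idb (s : R) := s * cutoff s.
have sidb : bsmooth idb := bsmooth_idM bsmooth_cutoff cutoff_vanish.
have vidb : vanish_off (-1) 1 idb by move=> s h; rewrite /idb cutoff_vanish ?mulr0.
pose idb1 (s : R) := cutoff s + s * derive1 cutoff s.
have didb s : is_derive s (1 : R) idb (idb1 s).
  have h := is_deriveM' (is_derive_id s (1 : R)) (bsmooth_derive s bsmooth_cutoff).
  by apply: (is_derive_eq h); rewrite mul1r addrC.
have sidb1 : bsmooth idb1.
  apply: bsmoothD; first exact: bsmooth_cutoff.
  exact: (bsmooth_idM (bsmooth_cutoffn 1) (cutoffn_vanish 1)).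
have vidb1 : vanish_off (-1) 1 idb1.
  by move=> s h; rewrite /idb1 cutoff_vanish// (vanish_off_derive1 cutoff_vanish h) mulr0 addr0.
(* The factor e^-1 compensates the rescaling, so that the derivative of W is exactly the rescaled (x
   F)' of [cutoff_le_sqr]; its weighted integral vanishes. *)
pose W s := e^-1 * idb (e * s + 2); pose W1 s := idb1 (e * s + 2).
have dW s : is_derive s (1 : R) W (W1 s).
  have h := is_deriveM' (is_derive_cst e^-1 s (1 : R)) (is_derive_rescale (didb (e * s + 2))).
  by apply: (is_derive_eq h); rewrite mul0r addr0 /cst mulrA mulVf ?mul1r// gt_eqF.
have sW : bsmooth W by apply: bsmoothZ; exact: bsmooth_affine.
have sW1 : bsmooth W1 by exact: bsmooth_affine.
have vW1 : vanish_off b c W1 := vanish_off_rescale e0 vidb1.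
have vW : vanish_off b c W.
  by move=> s sbc; rewrite /W (vanish_off_rescale e0 vidb sbc) mulr0.
have JW : ball_int (fun x => rho x ^+ 6 * (Q x * W1 (logr x))) = 0.
  apply: (ball_int_radial_derive n7 cK KB dW (sQ _ _ sW vW) (sQ _ _ sW1 vW1)) => x xB Kx.
  by apply: vW => h; apply: Kx; exact/(annulusP _ _ xB).
have sFF : bsmooth (fun s => F 0%N s * F 0%N s) := bsmoothM (sF 0%N) (sF 0%N).
have vFF : vanish_off b c (fun s => F 0%N s * F 0%N s) by move=> s h; rewrite F0// mul0r.
pose I2 := ball_int (fun x => rho x ^+ 6 * (Q x * (F 0%N (logr x) * F 0%N (logr x)))).
have sI2 : psymbol 0 6 (fun x => rho x ^+ 6 * (Q x * (F 0%N (logr x) * F 0%N (logr x)))).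
  exact: (s6 _ (sQ 0%N _ sFF vFF)).
have I2E : ball_int (fun x => rho x ^+ 6 * eta x ^+ 2) = I2.
  apply/esym; apply: (ball_int_eq n7 sI2) => x xB; rewrite /eta profile_pball// exprMn /Q.
  have -> : expR (- (2 * p * logr x)) = expR (- (p * logr x)) ^+ 2.
    by rewrite expr2 -expRD; congr expR; ring.
  by rewrite expr2.
have I20 : 0 < I2.
  have [x0 x0E] := exists_enorm (expR_ge0 (- (2 / e))).
  have x0B : pball x0.
    split; first by rewrite /unit_ball /= x0E -(expR0 R) ltr_expR oppr_lt0 divr_gt0.
    by apply/eqP => z; move: x0E; rewrite z enorm0 => /esym/eqP; rewrite gt_eqF// expR_gt0.
  have lx0 : logr x0 = - (2 / e).
    by rewrite /logr /rho x0E lnV ?posrE ?expR_gt0// opprK expRK.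
  apply: (ball_int_gt0 n7 sI2 _ x0B) => [x xB|].
    by rewrite mulr_ge0 ?exprn_ge0 ?rho_ge0// mulr_ge0 ?expR_ge0// -expr2 sqr_ge0.
  have h : 0 < F 0%N (logr x0).
    rewrite F0E lx0 mulrN mulrCA divff ?gt_eqF// mulr1 addNr.
    by apply: cutoff_gt0; lra.
  by rewrite mulr_gt0 ?exprn_gt0 ?rho_gt0// mulr_gt0 ?expR_gt0// mulr_gt0.
have sR := psymbolD (psymbolZ (a ^+ 2 * d + e ^+ 2 * (M * C)) sI2)
  (psymbolZ (- (2 * (e ^+ 2 * M))) (s6 _ (sQ 0%N _ sW1 vW1))).
pose G s := F 0%N s * (a ^+ 2 * d * F 0%N s + (-1) * (e2 * F 2%N s + (- e1) * F 4%N s + F 6%N s)).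
have sG : bsmooth G.
  by apply: bsmoothM => //; apply: bsmoothD; [exact: bsmoothZ|apply: bsmoothZ];
    apply: bsmoothD => //; apply: bsmoothD; exact: bsmoothZ.
have vG : vanish_off b c G by move=> s h; rewrite /G F0// mul0r.
rewrite I2E T; apply: (@le_lt_trans _ _ ((a ^+ 2 * d + e ^+ 2 * (M * C)) * I2)); last first.
  by rewrite ltr_pM2r// -hcE; move: eg; rewrite /g; lra.
have -> : (a ^+ 2 * d + e ^+ 2 * (M * C)) * I2 = ball_int (fun x =>
    (a ^+ 2 * d + e ^+ 2 * (M * C)) * (rho x ^+ 6 * (Q x * (F 0%N (logr x) * F 0%N (logr x)))) +
    (- (2 * (e ^+ 2 * M))) * (rho x ^+ 6 * (Q x * W1 (logr x)))).
  have sW6 := s6 _ (sQ 0%N _ sW1 vW1).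
  rewrite (ball_intD n7 (psymbolZ _ sI2) (psymbolZ _ sW6)) (ball_intZ n7 _ sI2) (ball_intZ n7 _ sW6).
  by rewrite JW mulr0 addr0.
have sL := s6 _ (sQ 0%N _ sG vG).
rewrite [X in X <= _](_ : _ = ball_int (fun x => rho x ^+ 6 * (Q x * G (logr x)))); last first.
  by congr ball_int; apply/funext => x; rewrite /G mulN1r mulNr.
apply: (ball_int_le n7 sL sR) => x xB.
have r0 : 0 <= rho x ^+ 6 * Q x by rewrite mulr_ge0 ?expR_ge0// exprn_ge0// rho_ge0.
suff : G (logr x) <= (a ^+ 2 * d + e ^+ 2 * (M * C)) * (F 0%N (logr x) * F 0%N (logr x)) -
    2 * (e ^+ 2 * M) * W1 (logr x).
  move=> /(ler_wpM2l r0); set u := G _; set v := F 0%N _; set w := W1 _; set q := rho x ^+ 6.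
  by move=> h; apply: (le_trans _ (le_trans h _)); rewrite le_eqVlt; apply/orP; left; apply/eqP; ring.
move: (logr x) => s {r0 xB x}.
have f0 : 0 <= F 0%N s by rewrite F0E cutoff_ge0.
have e2le : e ^+ 4 <= e ^+ 2 by rewrite (_ : 4 = 2 + 2)%N// exprD ler_piMl ?sqr_ge0// exprn_ile1// ltW.
have e6le : e ^+ 6 <= e ^+ 2 by rewrite (_ : 6 = 4 + 2)%N// exprD ler_piMl ?sqr_ge0// exprn_ile1// ltW.
have bF j Cj : 0 <= Cj -> (forall x : R, `|cutoffn j x| <= Cj) -> e ^+ j <= e ^+ 2 -> `|F j s| <= e ^+ 2 * Cj.
  have ej0 : 0 <= e ^+ j by rewrite exprn_ge0// ltW.
  move=> Cj0 bj ej; rewrite /F /scaled_cutoff normrM (ger0_norm ej0).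
  by apply: ler_pM.
have h2 := bF 2%N _ C20 b2 (lexx _).
have h4 := bF 4%N _ C40 b4 e2le.
have h6 := bF 6%N _ C60 b6 e6le.
have err : - (e2 * F 2%N s + (- e1) * F 4%N s + F 6%N s) <= e ^+ 2 * M.
  exact: (error_bound e10 e20 h2 h4 h6).
have bs : F 0%N s + 2 * W1 s <= C * (F 0%N s * F 0%N s).
  by have := bC (e * s + 2); rewrite F0E expr2.
have eM0 : 0 <= e ^+ 2 * M by apply: mulr_ge0 => //; exact: sqr_ge0.
have H := @remainder_bound R (a ^+ 2 * d) (e ^+ 2) M C _ _ _ f0 eM0 err bs.
exact: H.
Qed.

End unstable_profile.

Section instability.
Context {R : realType} {n : nat}.
Hypotheses (n7 : (7 <= n)%N) (n12 : (n < 12)%N).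
Local Notation u := (@equator_map R n).
Local Notation B := (@unit_ball R n).
Implicit Types (x y : 'rV[R]_n).

Lemma enorm_equator x : x != 0 -> enorm (u x) = 1.
Proof.
move=> x0; rewrite /enorm big_split_ord /= big_ord1 row_mxEr mxE expr0n addr0.
rewrite (eq_bigr (fun i => (enorm x)^-1 ^+ 2 * x ord0 i ^+ 2)); last first.
  by move=> i _; rewrite row_mxEl mxE exprMn.
rewrite -mulr_sumr -enorm_sqr -exprMn mulVf ?expr1n ?sqrtr1//.
by rewrite gt_eqF// enorm_gt0.
Qed.

Lemma sobolev_norm_subrr m k (w : 'rV[R]_n -> 'rV[R]_m) : sobolev_norm k (w \- w) = 0.
Proof.
rewrite /sobolev_norm big1 ?sqrtr0// => j _; rewrite big1// => l _; rewrite big1// => s _.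
have -> : component (w \- w) j = (fun=> 0).
  by apply/funext => x; rewrite /component /= subrr mxE.
have w0 := weak_derivative0 s (R := R).
have [_ [mw _] _] := weak_partialP w0.
rewrite (Rintegral_ae (g := fun=> 0)) ?Rintegral_cst ?mul0r//.
- exact: measurable_unit_ball.
- exact: measurable_funX.
- by apply: filterS (weak_partial_ae w0) => x H xB; rewrite H// expr0n.
Qed.

Lemma sobolev0_test_map m (w : 'rV[R]_n -> 'rV[R]_m) : test_map w -> sobolev0_map 3 w.
Proof.
move=> tw; split=> [j|e e0].
  exact: (psymbol_sobolev n7 (leqnn 3) (test_psymbol 3 (tw j))).
by exists w => //; rewrite sobolev_norm_subrr.
Qed.

(** The variation pushes u towards a pole, orthogonally to the hyperplane of the equator, so alpha =
    0 and beta = eta^2. *)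
Lemma not_stable_equator : ~ stable u.
Proof.
have [K [eta [cK KP seta eta0 neg]]] := unstable_profile (R := R) n7 n12.
have KB : K `<=` B by move=> x /KP[].
pose phi x : 'rV[R]_(n + 1) := row_mx (0 : 'rV[R]_n) (const_mx (eta x) : 'rV[R]_1).
have phil i : component phi (lshift 1 i) = cst 0.
  by apply/funext => x; rewrite /component /phi row_mxEl mxE.
have phir i : component phi (rshift n i) = eta.
  by apply/funext => x; rewrite /component /phi row_mxEr mxE.
have phiP j : component phi j = cst 0 \/ component phi j = eta.
  case: (fintype.splitP j) => [i ji|k jk]; [left|right].
    by rewrite (_ : j = lshift 1 i) ?phil//; exact/val_inj.
  by rewrite (_ : j = rshift n k) ?phir//; exact/val_inj.
have phi0 x : ~ K x -> phi x = 0.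
  move=> Kx; apply/rowP => j; rewrite [RHS]mxE.
  have E : component phi j x = 0 by case: (phiP j) => -> //; exact: eta0.
  exact: E.
have sphi m j : psymbol m 0 (component phi j).
  by case: (phiP j) => ->; [exact: psymbol_const|exact: seta].
have tphi : test_map phi.
  move=> j; apply: (psymbol_test_function cK KP) => [m|x Kx]; first exact: sphi.
  by rewrite /component phi0// mxE.
have al0 x : alpha phi x = 0.
  rewrite /alpha big_split_ord /= big_ord1 equator_rshift /cst mul0r addr0.
  by apply: big1 => i _; rewrite phil /cst mulr0.
have be x : beta phi x = eta x ^+ 2.
  rewrite /beta big_split_ord /= big_ord1 phir big1 ?add0r ?expr2// => i _.
  by rewrite phil /cst mulr0.
have [d [d0 d1 dh]] := small_params tphi.
have z0 : `|0 : R| < d by rewrite normr0.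
have S := second_derivative_E3ext n7 tphi d0 d1 dh.
(* Symbols of every order, beyond the order 3 of [C11], because u_t - u is going to be a test map
   and hence an admissible variation. *)
have svar m t j : `|t| < d -> psymbol m 0 (var phi j t).
  move=> td.
  have sal : psymbol m 0 (sqr_var phi t).
    have se2 := psymbolM (k := 0) (l := 0) (seta m) (seta m).
    apply: (psymbol_ext _ (psymbolD (psymbol_const m 0 1) (psymbolZ (t * t) se2))) => x _.
    by rewrite /sqr_var al0 be; ring.
  have dh' (_ : unit) x : setT tt -> pball x -> 2^-1 <= sqr_var phi t x by move=> _; exact: dh.
  have c0 : 0 < 2^-1 :> R by rewrite invr_gt0.
  have si : psymbol m 0 (isq phi t) := symbol_isqrt open_pball rho_ge1 c0 dh' sal.
  exact: (psymbolM (k := 0) (l := 0) si (psymbolD (psymbol_equator m j) (psymbolZ t (sphi m j)))).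
have adm : \forall t \near (0 : R), sobolev0_map 3 (sphere_variation u phi t \- u).
  apply: filterS (near_params z0) => t td; apply: sobolev0_test_map => j.
  apply: (psymbol_test_function cK KP) => [m|x Kx].
    apply: (psymbol_ext _ (psymbolB (svar m t j td) (psymbol_equator m j))) => x xB.
    rewrite -(variationE phi j t xB) [RHS]mxE; congr (_ + _).
    by rewrite [RHS]mxE.
  rewrite /component /= /sphere_variation /nearest_point phi0// scaler0 addr0.
  (* At the origin u is the zero vector, not a unit one, and its projection is again 0. *)
  have [->|x0] := eqVneq x 0; last by rewrite enorm_equator// invr1 scale1r subrr mxE.
  have -> : u 0 = 0 by rewrite /equator_map scaler0 row_mx0.
  by rewrite scaler0 subrr mxE.
move=> st; have := st phi tphi adm _ S; apply/negP; rewrite -ltNge.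
(* The acceleration - eta^2 u. Inserted in the equation of u it contributes - [lam] times the
   integral of rho^6 eta^2, as |u| = 1. *)
pose g j x := - (beta phi x * component u j x).
have sg j : psymbol 3 0 (g j).
  exact: (psymbolN (psymbolM (k := 0) (l := 0) (psymbol_beta tphi) (psymbol_equator 3 j))).
have g0 j x : pball x -> ~ K x -> g j x = 0.
  by move=> _ Kx; rewrite /g be eta0// expr0n mul0r oppr0.
have E1 j : T3 (var'' phi j 0) (var phi j 0) =
    @lam R n * ball_int (fun x => rho x ^+ 6 * (component u j x * g j x)).
  rewrite -(T3_equator n7 cK KB j (sg j) (g0 j)) T3C.
  by apply: (congr2 T3); apply/funext => x; rewrite ?var0 ?var''0.
have E2 j : T3 (var' phi j 0) (var' phi j 0) = T3 (component phi j) (component phi j).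
  by apply: (congr2 T3); apply/funext => x; rewrite var'0 al0 mul0r subr0.
have sug j : psymbol 0 6 (fun x => rho x ^+ 6 * (component u j x * g j x)).
  have sug := psymbolM (k := 0) (l := 0) (psymbol_equator 3 j) (sg j).
  exact: (psymbolM (k := 6) (l := 0) (psymbol_rhoX 0 6) (psymbol_order (leq0n 3) sug)).
have se2 : psymbol 0 6 (fun x => rho x ^+ 6 * eta x ^+ 2).
  under eq_fun do rewrite expr2.
  exact: (psymbolM (k := 6) (l := 0) (psymbol_rhoX 0 6) (psymbolM (k := 0) (l := 0) (seta 0%N) (seta 0%N))).
have E3 : \sum_j T3 (component phi j) (component phi j) = T3 eta eta.
  rewrite big_split_ord /= big_ord1 phir big1 ?add0r// => i _.
  by rewrite phil; apply: (T3_0l n7); exact: psymbol_const.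
have Ssug : psymbol 0 6 (fun x => \sum_j rho x ^+ 6 * (component u j x * g j x)).
  exact: (symbol_sum open_pball rho_ge1 _ _ sug).
have E4 : \sum_j ball_int (fun x => rho x ^+ 6 * (component u j x * g j x)) =
    - ball_int (fun x => rho x ^+ 6 * eta x ^+ 2).
  rewrite -(ball_int_sum n7 sug) -(ball_intN n7 se2).
  apply: (ball_int_eq n7 Ssug) => x xB.
  rewrite -mulr_sumr /g be; under eq_bigr do rewrite mulrN mulrCA -expr2.
  by rewrite sumrN -mulr_sumr sum_equator_sqr// mulr1 mulrN.
rewrite -mulr_sumr big_split /= (eq_bigr _ (fun j _ => E1 j)) (eq_bigr _ (fun j _ => E2 j)).
rewrite E3 -mulr_sumr E4 mulrN pmulr_rlt0// addrC subr_lt0.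
exact: neg.
Qed.

End instability.

Theorem corollary1p5 (R : realType) (n : nat) :
  ((12 <= n)%N -> minimizing_extrinsic_triharmonic (@equator_map R n)) /\
  ((7 <= n < 12)%N -> unstable_extrinsic_triharmonic (@equator_map R n)).
Proof.
split=> [n12|/andP[n7 n12]].
  have n7 : (7 <= n)%N by exact: leq_trans n12.
  by split; [exact: extrinsic_triharmonic_equator|exact: minimizing_equator].
by split; [exact: extrinsic_triharmonic_equator|exact: not_stable_equator].
Qed.
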